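(* Let $\alpha\ge0$. Let $g\in H^\infty(\Omega)$ and let $\varphi:\Omega\to\Omega$ be holomorphic with $\varphi(0)=0$. Assume that there is a compact set $K\subset\Omega$ such that $\varphi(\Omega)\subset K$. Then, for all $1<p,q<\infty$, $$C^{(\alpha)}_{g,\varphi}:A^p(\Omega)\to A^q(\Omega)$$ is compact. Moreover, for every $0<s<\infty$, $C^{(\alpha)}_{g,\varphi}\in\mathcal S_s(A^2(\Omega))$. More precisely, there are constants $C,c>0$ such that the singular values of $C^{(\alpha)}_{g,\varphi}$ on $A^2(\Omega)$ satisfy $$s_j(C^{(\alpha)}_{g,\varphi})\le C\exp(-c\,j^{1/n}),\qquad j\ge1.$$
   Context: $\Omega\subset\mathbb C^n$ ($n\ge1$) is a bounded convex domain with smooth ($C^\infty$) boundary of finite type, with $0\in\Omega$. For $1<p<\infty$, $A^p(\Omega)$ is the space of holomorphic functions in $L^p(\Omega,dv)$ ($dv$ Lebesgue volume) with the $L^p$ norm. $H^\infty(\Omega)$ is the space of bounded holomorphic functions on $\Omega$. $Rf(z)=\sum_{k=1}^n z_k\partial_kf(z)$. $\mathcal S_s$ is the Schatten class of order $s$. For $\alpha\ge0$, $$C^{(\alpha)}_{g,\varphi}f(z)=\int_0^1Rf(\varphi(tz))\,g(tz)\,t^{\alpha-1}\,dt.$$ The operator is first defined for $f$ holomorphic in a neighbourhood of $\overline\Omega$ (a dense subspace of $A^p(\Omega)$); when bounded, the same symbol denotes the unique bounded extension to $A^p(\Omega)$. *)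

(* Defs.v *)
From HB Require Import structures.
From mathcomp Require Import all_boot all_order all_algebra.
From mathcomp Require Import complex.
From mathcomp Require Import all_classical all_reals all_analysis.

Set Implicit Arguments.
Unset Strict Implicit.
Unset Printing Implicit Defensive.

Import Order.TTheory GRing.Theory Num.Theory.
Import numFieldNormedType.Exports.

Local Open Scope classical_set_scope.
Local Open Scope ring_scope.
Local Open Scope complex_scope.

#[warnings="-redundant-canonical-projection"]
HB.instance Definition _ (R : realType) := NormedModule.copy R[i] (R[i]^o).

(* The library makes [m1 \x m2] canonically sigma-finite only when [m1] and [m2]
   are subprobabilities; [product_sf] restores the general case. *)
Section product_sf.
Context d1 d2 (T1 : measurableType d1) (T2 : measurableType d2) (R : realType).
Variables (m1 : {sigma_finite_measure set T1 -> \bar R})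
  (m2 : {sigma_finite_measure set T2 -> \bar R}).

Definition product_sf : set (T1 * T2) -> \bar R := (m1 \x m2)%E.

HB.instance Definition _ := Measure.on product_sf.

Let product_sf_sigma_finite : sigma_finite setT product_sf.
Proof.
have /sigma_finiteP[F [TF ndF Foo]] := sigma_finiteT m1.
have /sigma_finiteP[G [TG ndG Goo]] := sigma_finiteT m2.
exists (fun n => F n `*` G n).
  rewrite -setXTT TF TG predeqE => -[x y]; split.
    move=> [/= [n _ Fnx] [k _ Gky]]; exists (maxn n k) => //; split.
    - by move: x Fnx; exact/subsetPset/ndF/leq_maxl.
    - by move: y Gky; exact/subsetPset/ndG/leq_maxr.
  by move=> [n _ []/= ? ?]; split; exists n.
move=> k; have [? ?] := Foo k; have [? ?] := Goo k.
split; first exact: measurableX.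
by rewrite /product_sf product_measure1E// lte_mul_pinfty// ge0_fin_numE.
Qed.

HB.instance Definition _ := Measure_isSigmaFinite.Build _ _ _
  product_sf product_sf_sigma_finite.

End product_sf.

Section tuple_measure.
Context d (T : measurableType d) (R : realType).
Variable mu : {sigma_finite_measure set T -> \bar R}.

Definition tcons n (x : T * n.-tuple T) : n.+1.-tuple T :=
  [the n.+1.-tuple T of x.1 :: x.2].

Lemma measurable_tcons n : measurable_fun [set: T * n.-tuple T] (@tcons n).
Proof. exact: measurable_cons. Qed.

Section step.
Context n (nu : {sigma_finite_measure set (n.-tuple T) -> \bar R}).

Definition tuple_measure_succ : set (n.+1.-tuple T) -> \bar R :=
  pushforward (product_sf mu nu) (@tcons n).

Let succ0 : tuple_measure_succ set0 = 0%E.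
Proof. by rewrite /tuple_measure_succ /pushforward preimage_set0 measure0. Qed.

Let succ_ge0 A : (0 <= tuple_measure_succ A)%E.
Proof. by rewrite /tuple_measure_succ /pushforward measure_ge0. Qed.

Let succ_sigma_additive : semi_sigma_additive tuple_measure_succ.
Proof.
move=> F mF tF mUF; rewrite /tuple_measure_succ /pushforward preimage_bigcup.
apply: measure_semi_sigma_additive.
- by move=> k; rewrite -[X in measurable X]setTI; exact: measurable_tcons.
- apply/trivIsetP => /= i j _ _ ij; rewrite -preimage_setI.
  by move/trivIsetP : tF => /(_ _ _ _ _ ij) ->//; rewrite preimage_set0.
- by rewrite -preimage_bigcup -[X in measurable X]setTI; exact: measurable_tcons.
Qed.

HB.instance Definition _ := isMeasure.Build _ _ _ tuple_measure_succ
  succ0 succ_ge0 succ_sigma_additive.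

Let succ_sigma_finite : sigma_finite setT tuple_measure_succ.
Proof.
have [F TF Foo] : sigma_finite setT (product_sf mu nu) by exact: sigma_finiteT.
pose unc (y : n.+1.-tuple T) : T * n.-tuple T :=
  (tnth y ord0, [tuple of behead y]).
have mu_unc : measurable_fun [set: n.+1.-tuple T] unc.
  apply/measurable_fun_pairP; split; first exact: measurable_tnth.
  exact: measurable_behead.
have unck : unc \o @tcons n = id.
  by apply/funext => -[x y]; congr pair; exact: val_inj.
exists (fun k => unc @^-1` (F k)).
  rewrite -preimage_bigcup -TF preimage_setT //.
move=> k; have [mFk Fk] := Foo k; split.
  by rewrite -[X in measurable X]setTI; exact: mu_unc.
by rewrite /tuple_measure_succ /pushforward -comp_preimage unck.
Qed.

HB.instance Definition _ := Measure_isSigmaFinite.Build _ _ _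
  tuple_measure_succ succ_sigma_finite.

End step.

Fixpoint tuple_measure n : {sigma_finite_measure set (n.-tuple T) -> \bar R} :=
  match n with
  | 0 => [the {sigma_finite_measure set (0.-tuple T) -> \bar R} of
            @dirac _ (0.-tuple T) [tuple] R]
  | m.+1 => [the {sigma_finite_measure set (m.+1.-tuple T) -> \bar R} of
               tuple_measure_succ (tuple_measure m)]
  end.
End tuple_measure.


Section volume.
Context (R : realType) (n : nat).

Definition to_cvec (x : n.-tuple (measurableTypeR R * measurableTypeR R)) :
    'rV[R[i]]_n :=
  \row_k ((tnth x k).1 +i* (tnth x k).2).

Definition volume := tuple_measure
  (product_sf (@lebesgue_measure R) (@lebesgue_measure R)) n.

End volume.

Definition cRintegral d (T : measurableType d) (R : realType)
    (mu : {measure set T -> \bar R}) (D : set T) (F : T -> R[i]) : R[i] :=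
  (\int[mu]_(x in D) complex.Re (F x)) +i* (\int[mu]_(x in D) complex.Im (F x)).

Section domains.
Context (R : realType) (n : nat).
Local Notation C := R[i].
Local Notation Cn := 'rV[R[i]]_n.
Implicit Types (Omega U : set Cn) (r : Cn -> R) (p : Cn).

(* The weights 0 <= lambda <= 1 are real by definition of the order on R[i], so
   this is convexity over the reals. *)
Definition convex_subset Omega :=
  convex_set (Omega : set (convex_lmodType Cn)).

(* The derivative of [r] along [v] as a function of the 2n real variables. *)
Definition real_dderiv (v : Cn) r : Cn -> R :=
  fun z => derive1 (fun t : R => r (z + t%:C *: v)) 0.

Definition smooth_on U r := forall (vs : seq Cn) z, U z ->
  {for z, continuous (foldr real_dderiv r vs)} /\
  forall v, derivable (fun t : R => foldr real_dderiv r vs (z + t%:C *: v)) 0 1.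

Definition local_defining_function Omega p r := exists U,
  [/\ open U, U p, smooth_on U r, (forall z, U z -> (Omega z <-> r z < 0)) &
      exists v, real_dderiv v r p != 0].

Definition boundary Omega := closure Omega `\` Omega°.

Definition smooth_boundary Omega := forall p, boundary Omega p ->
  exists r, local_defining_function Omega p r.

Definition vanishes_to_order (W : normedModType C) (h : C -> W) (k : nat) :=
  h =O_ (0 : C) (fun z : C => z ^+ k).

(* D'Angelo's 1-type at [p], i.e. the supremum of ord(r o gamma) / ord(gamma - p)
   over the nonconstant holomorphic germs gamma : (C, 0) -> (C^n, p), is at most
   [m]. The order [l] of gamma - p is finite exactly when gamma is nonconstant. *)
Definition type_le p r (m : nat) := forall gamma : C -> Cn,
  gamma 0 = p -> (\forall z \near (0 : C), derivable gamma z 1) ->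
  forall l k : nat,
    vanishes_to_order (fun z => gamma z - p) l ->
    ~ vanishes_to_order (fun z => gamma z - p) l.+1 ->
    vanishes_to_order (fun z => (r (gamma z))%:C : C) k ->
    (k <= m * l)%N.

Definition finite_type Omega := forall p r, boundary Omega p ->
  local_defining_function Omega p r -> exists m, type_le p r m.

End domains.

Section bergman.
Context (R : realType) (n : nat).
Local Notation C := R[i].
Local Notation Cn := 'rV[R[i]]_n.
Implicit Types (Omega K : set Cn) (f g h : Cn -> C) (phi : Cn -> Cn).
Implicit Types (p q s : R) (T : (Cn -> C) -> (Cn -> C)).

Definition holomorphic_on (W : normedModType C) Omega (f : Cn -> W) :=
  forall z, Omega z -> differentiable f z.

Definition holomorphic_near (K : set Cn) f := exists U,
  [/\ open U, K `<=` U & holomorphic_on U f].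

Definition Hinfty Omega g := holomorphic_on Omega g /\
  exists M : C, forall z, Omega z -> `|g z| <= M.

Definition Lp_norm Omega p f : \bar R :=
  ((\int[volume R n]_(x in @to_cvec R n @^-1` Omega)
      (complex.Re `|f (to_cvec x)| `^ p)%R%:E) `^ p^-1)%E.

(* The values outside of [Omega] of the functions representing the elements of A^p
   are irrelevant. *)
Definition bergman Omega p : set (Cn -> C) :=
  [set f | holomorphic_on Omega f /\ (Lp_norm Omega p f < +oo)%E].

Definition inner Omega f h : C :=
  cRintegral (volume R n) (@to_cvec R n @^-1` Omega)
    (fun x => f (to_cvec x) * (h (to_cvec x))^*%R).

Definition radial_deriv f : Cn -> C :=
  fun z => \sum_(k < n) z ord0 k * 'D_(delta_mx ord0 k) f z.

(* At t = 0 the library sets 0 `^ (alpha - 1) to a finite value, which does not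
   affect the integral. *)
Definition C_op (alpha : R) g phi f : Cn -> C := fun z =>
  cRintegral (@lebesgue_measure R) `[0, 1]%classic
    (fun t : R => radial_deriv f (phi (t%:C *: z)) * g (t%:C *: z) *
                  (t `^ (alpha - 1))%:C).

Definition linear_operator Omega p T := forall (a : C) f h,
  bergman Omega p f -> bergman Omega p h -> forall z, Omega z ->
  T (fun w => a * f w + h w) z = a * T f z + T h z.

Definition bounded_operator Omega p q T :=
  [/\ forall f, bergman Omega p f -> bergman Omega q (T f),
      linear_operator Omega p T &
      exists M : R, forall f, bergman Omega p f ->
        (Lp_norm Omega q (T f) <= M%:E * Lp_norm Omega p f)%E].

Definition compact_operator Omega p q T := bounded_operator Omega p q T /\
  forall u : nat -> Cn -> C,
    (exists M : R, forall k,
       bergman Omega p (u k) /\ (Lp_norm Omega p (u k) <= M%:E)%E) ->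
    exists (h : nat -> nat) (v : Cn -> C),
      [/\ {homo h : i j / (i < j)%N}, bergman Omega q v &
          Lp_norm Omega q (fun z => T (u (h k)) z - v z) @[k --> \oo] --> 0%E].

Definition bounded_extension Omega p q (alpha : R) g phi T :=
  bounded_operator Omega p q T /\
  forall f, holomorphic_near (closure Omega) f ->
    forall z, Omega z -> T f z = C_op alpha g phi f z.

(* [e] is an eigenvector of |T| = (T^* T)^(1/2) on A^2 for the eigenvalue [tau]:
   testing against all [h] in A^2, the last clause reads T^* T e = tau^2 e. *)
Definition abs_eigenvector Omega T (tau : R) e := 0 <= tau /\
  bergman Omega 2 e /\
  forall h, bergman Omega 2 h ->
    inner Omega (T e) (T h) = (tau ^+ 2)%:C * inner Omega e h.

Definition orthonormal Omega j (e : 'I_j -> Cn -> C) :=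
  forall i k, inner Omega (e i) (e k) = (i == k)%:R.

(* For compact [T] on A^2 and j >= 1: the j-th largest eigenvalue of |T|, counted
   with multiplicity. *)
Definition singular_value Omega T (j : nat) : R :=
  sup [set sigma | 0 <= sigma /\ exists e : 'I_j -> Cn -> C,
         orthonormal Omega e /\
         forall i, exists2 tau, sigma <= tau & abs_eigenvector Omega T tau (e i)].

Definition schatten Omega s T := compact_operator Omega 2 2 T /\
  (\sum_(1 <= j <oo) (singular_value Omega T j `^ s)%:E < +oo)%E.

End bergman.

(* Main.v *)
Require Import Defs.
From HB Require Import structures.
From mathcomp Require Import all_boot all_order all_algebra.
From mathcomp Require Import complex.
From mathcomp Require Import all_classical all_reals all_analysis.
From mathcomp Require Import measurable_realfun.
From mathcomp Require Import ring lra.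

Set Implicit Arguments.
Unset Strict Implicit.
Unset Printing Implicit Defensive.

Import Order.TTheory GRing.Theory Num.Theory.
Import numFieldNormedType.Exports.

Local Open Scope classical_set_scope.
Local Open Scope ring_scope.


Local Open Scope complex_scope.


(** * Real-valued norms over the complex numbers *)

Section real_norm.
Variables (R : realType) (V : normedModType R[i]).
Implicit Types u v w : V.

Definition rnorm (v : V) : R := complex.Re `|v|.

Lemma rnormE v : `|v| = (rnorm v)%:C.
Proof. by rewrite /rnorm RRe_real // normr_real. Qed.

Lemma rnorm_ge0 v : 0 <= rnorm v.
Proof. by rewrite -ler0c -rnormE. Qed.

Lemma rnorm0 : rnorm (0 : V) = 0.
Proof. by rewrite /rnorm normr0. Qed.

Lemma rnorm_eq0 v : rnorm v = 0 -> v = 0.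
Proof. by move=> h; apply/normr0_eq0; rewrite rnormE h. Qed.

Lemma rnorm_gt0 v : v != 0 -> 0 < rnorm v.
Proof.
by move=> v0; rewrite lt0r rnorm_ge0 andbT; apply: contra v0 => /eqP/rnorm_eq0 ->.
Qed.

Lemma rnormN v : rnorm (- v) = rnorm v.
Proof. by rewrite /rnorm normrN. Qed.

Lemma rnormB u v : rnorm (u - v) = rnorm (v - u).
Proof. by rewrite -rnormN opprB. Qed.

Lemma rnormD u v : rnorm (u + v) <= rnorm u + rnorm v.
Proof. by rewrite -lecR rmorphD /= -!rnormE ler_normD. Qed.

Lemma rnormDB u v : rnorm (u - v) <= rnorm u + rnorm v.
Proof. by rewrite -(rnormN v) rnormD. Qed.

Lemma rnorm_tri w u v : rnorm (u - v) <= rnorm (u - w) + rnorm (w - v).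
Proof. by have := rnormD (u - w) (w - v); rewrite addrA subrK. Qed.

Lemma rnorm_sum (I : Type) (r : seq I) (P : pred I) (F : I -> V) :
  rnorm (\sum_(i <- r | P i) F i) <= \sum_(i <- r | P i) rnorm (F i).
Proof.
elim/big_rec2: _ => [|i y x _ h]; first by rewrite rnorm0.
by rewrite (le_trans (rnormD _ _)) // lerD2l.
Qed.

Lemma nbhs_rnormP u (A : set V) :
  nbhs u A <-> exists2 r : R, 0 < r & forall v, rnorm (v - u) < r -> A v.
Proof.
split.
  move=> /nbhs_normP[r /= r0 rA]; exists (complex.Re r).
    by move: r0; rewrite ltcE => /andP[].
  move=> v vr; apply: rA => /=; rewrite distrC rnormE ltcE /= vr andbT.
  by move: r0; rewrite ltcE => /andP[].
move=> [r r0 rA]; apply/nbhs_normP; exists r%:C; first by rewrite /= ltcR.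
by move=> v /=; rewrite distrC rnormE ltcR => /rA.
Qed.

End real_norm.

Section complex_norm.
Variable R : realType.
Implicit Types z w : R[i].

Lemma rnormZ (V : normedModType R[i]) z (v : V) : rnorm (z *: v) = rnorm z * rnorm v.
Proof. by apply/complexI; rewrite rmorphM /= -!rnormE normrZ. Qed.

Lemma rnormM z w : rnorm (z * w) = rnorm z * rnorm w.
Proof. exact: rnormZ. Qed.

Lemma rnorm1 : rnorm (1 : R[i]) = 1.
Proof. by rewrite /rnorm normr1. Qed.

Lemma rnormX z m : rnorm (z ^+ m) = rnorm z ^+ m.
Proof. by elim: m => [|m ih]; rewrite ?expr0 ?rnorm1// !exprS rnormM ih. Qed.

Lemma rnormV z : rnorm z^-1 = (rnorm z)^-1.
Proof. exact: Normc.normcV. Qed.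

Lemma rnorm_real (x : R) : rnorm x%:C = `|x|.
Proof. by rewrite /rnorm normc_def /= expr0n addr0 sqrtr_sqr. Qed.

Lemma rnorm_nat k : rnorm (k%:R : R[i]) = k%:R.
Proof. by have := rnorm_real k%:R; rewrite rmorph_nat normr_nat. Qed.

Lemma rnormC z : rnorm z = Num.sqrt (complex.Re z ^+ 2 + complex.Im z ^+ 2).
Proof. by rewrite /rnorm normc_def. Qed.

Lemma Re_le_rnorm z : `|complex.Re z| <= rnorm z.
Proof. by rewrite rnormC -sqrtr_sqr ler_wsqrtr // lerDl sqr_ge0. Qed.

Lemma Im_le_rnorm z : `|complex.Im z| <= rnorm z.
Proof. by rewrite rnormC -sqrtr_sqr ler_wsqrtr // lerDr sqr_ge0. Qed.

Lemma rnorm_i : rnorm ('i : R[i]) = 1.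
Proof. by rewrite rnormC /= expr0n add0r expr1n sqrtr1. Qed.

Lemma rnorm_le_ReIm z : rnorm z <= `|complex.Re z| + `|complex.Im z|.
Proof.
rewrite [z in rnorm z]complexE (le_trans (rnormD _ _)) // rnormM rnorm_i mul1r.
by rewrite !rnorm_real.
Qed.

Lemma rnormJ z : rnorm (z^*%C) = rnorm z.
Proof. by rewrite /rnorm normcJ. Qed.

End complex_norm.

(** ** Continuity and differentiability in terms of real bounds *)

Section eps_delta.
Variables (R : realType) (V W : normedModType R[i]).
Implicit Types (f : V -> W) (x : V).

Lemma continuous_rnormP f x : {for x, continuous f} <->
  forall e : R, 0 < e -> exists2 r : R, 0 < r &
    forall y, rnorm (y - x) < r -> rnorm (f y - f x) < e.
Proof.
split=> [fx e e0|h A /nbhs_rnormP[e e0 eA]].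
  have : nbhs x (f @^-1` [set w | rnorm (w - f x) < e]).
    by apply: fx; apply/nbhs_rnormP; exists e.
  by move=> /nbhs_rnormP[r r0 h]; exists r.
have [r r0 rA] := h _ e0; apply/nbhs_rnormP; exists r => // y /rA; exact: eA.
Qed.

Lemma lipschitz_linear_continuous (L : {linear V -> W}) (C : R) :
  (forall h, rnorm (L h) <= C * rnorm h) -> continuous L.
Proof.
move=> LC x; apply/continuous_rnormP => e e0.
have C0 : 0 < `|C| + 1 by rewrite ltr_wpDl.
exists (e / (`|C| + 1)); first exact: divr_gt0.
move=> y; rewrite ltr_pdivlMr // => yx; rewrite -linearB (le_lt_trans (LC _)) //.
rewrite (le_lt_trans _ yx) // mulrC ler_wpM2l ?rnorm_ge0 //.
by rewrite (le_trans (ler_norm _)) // lerDl.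
Qed.

Lemma differentiable_rnormP f x : differentiable f x <->
  exists L : {linear V -> W}, continuous L /\
  forall e : R, 0 < e -> exists2 r : R, 0 < r &
    forall h, rnorm h < r -> rnorm (f (x + h) - f x - L h) <= e * rnorm h.
Proof.
split=> [/diff_locallyP[Lc /eqaddoP h]|[L [Lc h]]].
  exists 'd f x; split=> // e e0.
  have := h e%:C; rewrite ltcR => /(_ e0)/nbhs_rnormP[r r0 rh].
  exists r => // v vr; have := rh v; rewrite subr0 => /(_ vr) /=.
  rewrite !rnormE -rmorphM /= lecR. by rewrite !fctE /= opprD addrA (addrC v).
have Lo : f \o shift x = cst (f x) + L +o_ (0 : V) id.
  apply/eqaddoP => e e0.
  have e0' : 0 < complex.Re e by move: e0; rewrite ltcE => /andP[].
  have eE : e = (complex.Re e)%:C.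
    by rewrite RRe_real // gtr0_real.
  have [r r0 rh] := h _ e0'; apply/nbhs_rnormP; exists r => // v.
  rewrite subr0 => /rh; rewrite {2}eE /= !rnormE -rmorphM /= lecR !fctE.
  by rewrite /= opprD addrA (addrC v).
have dL : 'd f x = L :> (V -> W) by exact: diff_unique.
by apply/diff_locallyP; rewrite dL.
Qed.

End eps_delta.

Section eps_delta_line.
Variables (R : realType).
Implicit Types (g : R[i] -> R[i]) (z : R[i]).

Lemma differentiable_lineP g z : differentiable g z <->
  exists d, forall e : R, 0 < e -> exists2 r : R, 0 < r &
    forall h, rnorm h < r -> rnorm (g (z + h) - g z - d * h) <= e * rnorm h.
Proof.
rewrite differentiable_rnormP; split=> [[L [_ h]]|[d h]].
  exists (L 1) => e /h[r r0 rh]; exists r => // v /rh.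
  suff -> : L v = L 1 * v by [].
  by rewrite mulrC -[RHS]/(v *: L 1) -linearZ; congr (L _); rewrite -[RHS]/(v * 1) mulr1.
pose m (v : R[i]) : R[i] := v * d.
have lm : linear m by move=> a u v; rewrite /m mulrDl -mulrA.
pose mM := GRing.isLinear.Build _ _ _ _ m lm.
pose L : {linear R[i] -> R[i]} := HB.pack m mM.
exists L; split=> [|e /h[r r0 rh]].
  apply: (@lipschitz_linear_continuous _ _ _ L (rnorm d)) => x.
  by rewrite /L /= /m rnormM mulrC.
by exists r => // v /rh; rewrite /L /= /m mulrC.
Qed.

Lemma differentiable_idC z : differentiable (fun t : R[i] => t) z.
Proof. exact: ex_diff. Qed.

Lemma differentiable_subr w z : differentiable (fun t : R[i] => t - w) z.
Proof.
by apply: differentiableB; [exact: differentiable_idC|exact: differentiable_cst].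
Qed.

Lemma differentiable_mull w z : differentiable (fun t : R[i] => w * t) z.
Proof.
by apply: differentiableM; [exact: differentiable_cst|exact: differentiable_idC].
Qed.

End eps_delta_line.

(** * Integrals over rectangle boundaries and the theorem of Goursat *)

Section interval_integrals.
Variable R : realType.
Local Notation mu := (@lebesgue_measure R).
Implicit Types (f : R -> R) (a b c m e : R).

Lemma integrable_itvcc f a b :
  (forall x, a <= x <= b -> {for x, continuous f}) ->
  mu.-integrable `[a, b] (EFin \o f).
Proof.
move=> fc; apply: continuous_compact_integrable; first exact: segment_compact.
by apply: continuous_in_subspaceT => x; rewrite inE /= in_itv /= => /fc.
Qed.

Lemma Rintegral_itv_split f a c b : a <= c -> c <= b ->
  mu.-integrable `[a, b] (EFin \o f) ->
  \int[mu]_(x in `[a, b]) f x =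
  \int[mu]_(x in `[a, c]) f x + \int[mu]_(x in `[c, b]) f x.
Proof.
move=> ac cb fi; apply/eqP; rewrite addrC -subr_eq; apply/eqP.
rewrite (@Rintegral_itvB _ _ _ _ c) ?bnd_simp //.
rewrite Rintegral_itv_obnd_cbnd //.
apply: integrableS fi => //.
by apply: subset_itv; rewrite !bnd_simp.
Qed.

Lemma Rintegral_itv_cst a b m : a <= b ->
  \int[mu]_(x in `[a, b]) cst m x = m * (b - a).
Proof.
move=> ab; have mab : fine (mu `[a, b]) = b - a.
  by rewrite lebesgue_measure_itv /= lte_fin; case: ltgtP ab => //= ->; rewrite subrr.
by rewrite Rintegral_cst // mab.
Qed.

Lemma Rintegral_near_cst f a b m e : a <= b ->
  mu.-integrable `[a, b] (EFin \o f) ->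
  (forall x, a <= x <= b -> `|f x - m| <= e) ->
  `|\int[mu]_(x in `[a, b]) f x - m * (b - a)| <= e * (b - a).
Proof.
move=> ab fi fm.
have cint (k : R) : mu.-integrable `[a, b] (EFin \o cst k).
  by apply: integrable_itvcc => x _; exact: cst_continuous.
have ck (k : R) : \int[mu]_(x in `[a, b]) cst k x = k * (b - a).
  exact: Rintegral_itv_cst.
have bd x : `[a, b]%classic x -> m - e <= f x <= m + e.
  by rewrite /= in_itv /= => /fm; rewrite ler_norml => /andP[h1 h2]; apply/andP; lra.
rewrite ler_norml; apply/andP; split.
  rewrite lerBrDr addrC -mulrBl -ck le_Rintegral // => x /bd /andP[] //.
by rewrite lerBlDr addrC -mulrDl -ck le_Rintegral // => x /bd /andP[].
Qed.

End interval_integrals.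

Section rectangles.
Variable R : realType.
Local Notation mu := (@lebesgue_measure R).
Implicit Types (G F : R[i] -> R[i]) (a b c d : R).

Definition in_rect a b c d (z : R[i]) :=
  [/\ a <= complex.Re z, complex.Re z <= b, c <= complex.Im z & complex.Im z <= d].

Definition rect_int G a b c d : R :=
  \int[mu]_(x in `[a, b]) (complex.Re (G (x +i* c)) - complex.Re (G (x +i* d))) -
  \int[mu]_(y in `[c, d]) (complex.Im (G (b +i* y)) - complex.Im (G (a +i* y))).

Definition continuous_on_rect G a b c d :=
  forall z, in_rect a b c d z -> {for z, continuous G}.

Lemma continuous_hor G x c : {for x +i* c, continuous G} ->
  {for x, continuous (fun t => complex.Re (G (t +i* c)))}.
Proof.
move=> /continuous_rnormP Gc; apply/cvgrPdist_lt => e e0.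
have [r r0 rG] := Gc _ e0; near=> t.
rewrite distrC -raddfB (le_lt_trans (Re_le_rnorm _)) // rG //.
have -> : (t +i* c) - (x +i* c) = (t - x)%:C by apply/eqP; rewrite eq_complex /= subrr !eqxx.
rewrite rnorm_real distrC; near: t.
exact: cvgr_dist_lt.
Unshelve. all: by end_near. Qed.

Lemma continuous_ver G a y : {for a +i* y, continuous G} ->
  {for y, continuous (fun t => complex.Im (G (a +i* t)))}.
Proof.
move=> /continuous_rnormP Gc; apply/cvgrPdist_lt => e e0.
have [r r0 rG] := Gc _ e0; near=> t.
rewrite distrC -raddfB (le_lt_trans (Im_le_rnorm _)) // rG //.
have -> : (a +i* t) - (a +i* y) = 'i * (t - y)%:C.
  by apply/eqP; rewrite eq_complex /=; apply/andP; split; apply/eqP; ring.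
rewrite rnormM rnorm_i mul1r rnorm_real distrC; near: t.
exact: cvgr_dist_lt.
Unshelve. all: by end_near. Qed.

Definition on_edges a b c d (z : R[i]) := in_rect a b c d z /\
  [\/ complex.Re z = a, complex.Re z = b, complex.Im z = c | complex.Im z = d].

Definition continuous_on_edges G a b c d :=
  forall z, on_edges a b c d z -> {for z, continuous G}.

Lemma continuous_on_rect_edges G a b c d :
  continuous_on_rect G a b c d -> continuous_on_edges G a b c d.
Proof. by move=> Gc z [zr _]; exact: Gc. Qed.

Lemma integrable_hor G a b c d : c <= d ->
  continuous_on_edges G a b c d -> mu.-integrable `[a, b]
   (EFin \o (fun x => complex.Re (G (x +i* c)) - complex.Re (G (x +i* d)))).
Proof.
move=> cd Gc; apply: integrable_itvcc => x /andP[ax xb].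
by apply: cvgB; apply: continuous_hor; apply: Gc; split=> //;
  [constructor 3|constructor 4].
Qed.

Lemma integrable_ver G a b c d : a <= b ->
  continuous_on_edges G a b c d -> mu.-integrable `[c, d]
   (EFin \o (fun y => complex.Im (G (b +i* y)) - complex.Im (G (a +i* y)))).
Proof.
move=> ab Gc; apply: integrable_itvcc => x /andP[ax xb].
by apply: cvgB; apply: continuous_ver; apply: Gc; split=> //;
  [constructor 2|constructor 1].
Qed.

Lemma continuous_on_subrect G a b c d a' b' c' d' :
  a <= a' -> b' <= b -> c <= c' -> d' <= d ->
  continuous_on_rect G a b c d -> continuous_on_rect G a' b' c' d'.
Proof.
move=> aa bb cc dd Gc z [az zb cz zd]; apply: Gc; split.
- exact: le_trans az.
- exact: le_trans bb.
- exact: le_trans cz.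
- exact: le_trans dd.
Qed.

Lemma rect_int_splitx G a b c d e : a <= e -> e <= b -> c <= d ->
  continuous_on_edges G a e c d -> continuous_on_edges G e b c d ->
  rect_int G a b c d = rect_int G a e c d + rect_int G e b c d.
Proof.
move=> ae eb cd Gc1 Gc2; have ab := le_trans ae eb; rewrite /rect_int.
rewrite (@Rintegral_itv_split _ _ a e b) //; last first.
  apply: integrable_itvcc => x /andP[ax xb].
  by apply: cvgB; apply: continuous_hor; have [xe|xe] := leP x e;
    [apply: Gc1|apply: Gc2|apply: Gc1|apply: Gc2];
    split; [by split=> //=; exact: ltW|by constructor 3|by split=> //=; exact: ltW|by constructor 3
    |by split=> //=; exact: ltW|by constructor 4|by split=> //=; exact: ltW|by constructor 4].
have -> : \int[mu]_(y in `[c, d]) (complex.Im (G (b +i* y)) - complex.Im (G (a +i* y))) =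
  \int[mu]_(y in `[c, d]) (complex.Im (G (e +i* y)) - complex.Im (G (a +i* y))) +
  \int[mu]_(y in `[c, d]) (complex.Im (G (b +i* y)) - complex.Im (G (e +i* y))).
  rewrite -RintegralD //.
  - by apply: eq_Rintegral => y _ /=; ring.
  - exact: (@integrable_ver G a e c d).
  - exact: (@integrable_ver G e b c d).
by rewrite opprD addrACA.
Qed.

Lemma rect_int_splity G a b c d e : c <= e -> e <= d -> a <= b ->
  continuous_on_edges G a b c e -> continuous_on_edges G a b e d ->
  rect_int G a b c d = rect_int G a b c e + rect_int G a b e d.
Proof.
move=> ce ed ab Gc1 Gc2; have cd := le_trans ce ed; rewrite /rect_int.
rewrite (@Rintegral_itv_split _ _ c e d) //; last first.
  apply: integrable_itvcc => x /andP[ax xb].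
  by apply: cvgB; apply: continuous_ver; have [xe|xe] := leP x e;
    [apply: Gc1|apply: Gc2|apply: Gc1|apply: Gc2];
    split; [by split=> //=; exact: ltW|by constructor 2|by split=> //=; exact: ltW|by constructor 2
    |by split=> //=; exact: ltW|by constructor 1|by split=> //=; exact: ltW|by constructor 1].
have -> : \int[mu]_(x in `[a, b]) (complex.Re (G (x +i* c)) - complex.Re (G (x +i* d))) =
  \int[mu]_(x in `[a, b]) (complex.Re (G (x +i* c)) - complex.Re (G (x +i* e))) +
  \int[mu]_(x in `[a, b]) (complex.Re (G (x +i* e)) - complex.Re (G (x +i* d))).
  rewrite -RintegralD //.
  - by apply: eq_Rintegral => y _ /=; ring.
  - exact: (@integrable_hor G a b c e).
  - exact: (@integrable_hor G a b e d).
by rewrite opprD addrACA.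
Qed.

Lemma rect_int_near_affine G a b c d (B : R[i]) g0 (e : R) : a <= b -> c <= d ->
  continuous_on_edges G a b c d ->
  (forall z, on_edges a b c d z -> rnorm (G z - g0 - B * z) <= e) ->
  `|rect_int G a b c d| <= 2 * e * ((b - a) + (d - c)).
Proof.
move=> ab cd Gc GB.
have h : `|\int[mu]_(x in `[a, b]) (complex.Re (G (x +i* c)) - complex.Re (G (x +i* d)))
   - (complex.Im B * (d - c)) * (b - a)| <= (2 * e) * (b - a).
  apply: Rintegral_near_cst => //; first exact: integrable_hor Gc.
  move=> x /andP[ax xb].
  have h1 : rnorm (G (x +i* c) - g0 - B * (x +i* c)) <= e by apply: GB; split=> //; constructor 3.
  have h2 : rnorm (G (x +i* d) - g0 - B * (x +i* d)) <= e by apply: GB; split=> //; constructor 4.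
  have := le_trans (Re_le_rnorm _) h1; have := le_trans (Re_le_rnorm _) h2.
  case: (G _) => u v; case: (G _) => u' v'; case: (B) => p q; case: (g0) => s t /=.
  rewrite !ler_norml => /andP[? ?] /andP[? ?]; apply/andP; lra.
have v : `|\int[mu]_(y in `[c, d]) (complex.Im (G (b +i* y)) - complex.Im (G (a +i* y)))
   - (complex.Im B * (b - a)) * (d - c)| <= (2 * e) * (d - c).
  apply: Rintegral_near_cst => //; first exact: integrable_ver Gc.
  move=> x /andP[ax xb].
  have h1 : rnorm (G (a +i* x) - g0 - B * (a +i* x)) <= e by apply: GB; split=> //; constructor 1.
  have h2 : rnorm (G (b +i* x) - g0 - B * (b +i* x)) <= e by apply: GB; split=> //; constructor 2.
  have := le_trans (Im_le_rnorm _) h1; have := le_trans (Im_le_rnorm _) h2.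
  case: (G _) => u v; case: (G _) => u' v'; case: (B) => p q; case: (g0) => s t /=.
  rewrite !ler_norml => /andP[? ?] /andP[? ?]; apply/andP; lra.
rewrite /rect_int; move: h v; set I := Rintegral _ _ _; set J := Rintegral _ _ _.
rewrite mulrAC => h v; rewrite mulrDr.
rewrite (_ : I - J = I - complex.Im B * (b - a) * (d - c) -
  (J - complex.Im B * (b - a) * (d - c))); last by ring.
by rewrite (le_trans (ler_normB _ _)) // lerD.
Qed.

End rectangles.

Section goursat.
Variable R : realType.
Implicit Types (G : R[i] -> R[i]) (a b c d : R).

Definition differentiable_on_rect G a b c d :=
  forall z, in_rect a b c d z -> differentiable G z.

Lemma differentiable_continuous_on_rect G a b c d :
  differentiable_on_rect G a b c d -> continuous_on_rect G a b c d.
Proof. by move=> Gd z /Gd; exact: differentiable_continuous. Qed.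

Lemma differentiable_on_subrect G a b c d a' b' c' d' :
  a <= a' -> b' <= b -> c <= c' -> d' <= d ->
  differentiable_on_rect G a b c d -> differentiable_on_rect G a' b' c' d'.
Proof.
move=> aa bb cc dd Gc z [az zb cz zd]; apply: Gc; split.
- exact: le_trans az.
- exact: le_trans bb.
- exact: le_trans cz.
- exact: le_trans dd.
Qed.

Lemma nested_intervals (u v : nat -> R) :
  (forall k, u k <= u k.+1) -> (forall k, v k.+1 <= v k) -> (forall k, u k <= v k) ->
  exists p, forall k, u k <= p <= v k.
Proof.
move=> uS vS uv.
have um : {homo u : m n / (m <= n)%N >-> m <= n}.
  by apply: homo_leq => // y x z; exact: le_trans.
have vm : {homo v : m n / (m <= n)%N >-> n <= m}.
  by apply: homo_leq => // y x z h1 h2; exact: le_trans h1.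
have uvk m k : u m <= v k.
  have [mk|km] := leP m k; first exact: le_trans (um _ _ mk) (uv _).
  by apply: le_trans (uv _) (vm _ _ _); exact: ltnW.
exists (sup (range u)) => k; apply/andP; split.
  apply: ub_le_sup; last by exists k.
  by exists (v 0%N) => _ [m _ <-].
apply: sup_le_ub; first by exists (u 0%N), 0%N.
by move=> _ [m _ <-].
Qed.

Let quarter_bounds a b x W W2 : a <= x -> x + W2 <= b -> W2 = W + W -> 0 <= W ->
  [/\ x + W <= b, a <= x + W, x + W + W <= b, x <= x + W <= x + W & x <= x <= x + W].
Proof. by move=> ? ? ? ?; split; rewrite ?lexx /=; lra. Qed.

Let segment_dist a W x y : a <= y -> y <= a + W -> a <= x -> x <= a + W -> `|x - y| <= W.
Proof. by move=> ? ? ? ?; rewrite ler_norml; apply/andP; lra. Qed.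

(** Bisection: one of the four quarters carries at least a quarter of the
    integral, and the nested quarters shrink to a point where the function is
    affine up to an error that is small against the size of the rectangle. *)
Lemma goursat G a b c d : a <= b -> c <= d ->
  differentiable_on_rect G a b c d -> rect_int G a b c d = 0.
Proof.
move=> ab cd Gd; apply/eqP; rewrite -normr_eq0; apply/contraT => RI_neq0.
have RI0 : 0 < `|rect_int G a b c d| by rewrite lt0r RI_neq0 normr_ge0.
pose I : R := `|rect_int G a b c d|; rewrite -/I in RI0; pose w : R := b - a; pose h : R := d - c.
have w0 : 0 <= w by rewrite subr_ge0.
have h0 : 0 <= h by rewrite subr_ge0.
pose q (k : nat) : R := 2 ^- k.
have q0 k : 0 < q k by rewrite invr_gt0 exprn_gt0.
have qS k : q k = q k.+1 + q k.+1.
  by rewrite /q exprSr invfM -mulrDr; rewrite -[in X in _ * X](mul1r 2^-1) -splitr mulr1.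
pose inside k (s : R * R) := [/\ a <= s.1, s.1 + w * q k <= b, c <= s.2 & s.2 + h * q k <= d].
pose RI k (s : R * R) := rect_int G s.1 (s.1 + w * q k) s.2 (s.2 + h * q k).
have step (k : nat) (s : R * R) : exists s', inside k s -> I / 4 ^+ k <= `|RI k s| ->
    [/\ inside k.+1 s', I / 4 ^+ k.+1 <= `|RI k.+1 s'|, s.1 <= s'.1 <= s.1 + w * q k.+1 &
     s.2 <= s'.2 <= s.2 + h * q k.+1].
  have [[ins big]|no] := pselect (inside k s /\ I / 4 ^+ k <= `|RI k s|); last first.
    by exists s => i1 i2; exfalso; apply: no.
  case: s ins big => x y [/= ax xb cy yd] big.
  have wq : 0 <= w * q k.+1 by rewrite mulr_ge0 // ltW.
  have hq : 0 <= h * q k.+1 by rewrite mulr_ge0 // ltW.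
  have wS : w * q k = w * q k.+1 + w * q k.+1 by rewrite qS mulrDr.
  have hS : h * q k = h * q k.+1 + h * q k.+1 by rewrite qS mulrDr.
  have Gc : continuous_on_rect G x (x + w * q k) y (y + h * q k).
    by apply: differentiable_continuous_on_rect; exact: differentiable_on_subrect Gd.
  have [wa wb wc wd we] := quarter_bounds ax xb wS wq.
  have [ha hb hc hd he] := quarter_bounds cy yd hS hq.
  have split4 : RI k (x, y) = RI k.+1 (x, y) + RI k.+1 (x, y + h * q k.+1) +
    (RI k.+1 (x + w * q k.+1, y) + RI k.+1 (x + w * q k.+1, y + h * q k.+1)).
    have ex : x + w * q k.+1 + w * q k.+1 = x + w * q k by rewrite wS addrA.
    have ey : y + h * q k.+1 + h * q k.+1 = y + h * q k by rewrite hS addrA.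
    rewrite /RI /= ex ey.
    have [x1 x2] : x <= x + w * q k.+1 /\ x + w * q k.+1 <= x + w * q k by lra.
    have [y1 y2] : y <= y + h * q k.+1 /\ y + h * q k.+1 <= y + h * q k by lra.
    have Ge := continuous_on_rect_edges.
    rewrite (rect_int_splitx x1 x2 (le_trans y1 y2) (Ge _ _ _ _ _ _ (continuous_on_subrect (lexx _) x2 (lexx _) (lexx _) Gc)) (Ge _ _ _ _ _ _ (continuous_on_subrect x1 (lexx _) (lexx _) (lexx _) Gc))).
    by rewrite !(rect_int_splity y1 y2) //; apply: continuous_on_rect_edges;
      apply: continuous_on_subrect Gc.
  have quarter : I / 4 ^+ k = 4 * (I / 4 ^+ k.+1).
    by rewrite exprS invfM; field; rewrite expf_neq0 // pnatr_eq0.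
  have [h1|h1] := leP (I / 4 ^+ k.+1) `|RI k.+1 (x, y)|.
    by exists (x, y).
  have [h2|h2] := leP (I / 4 ^+ k.+1) `|RI k.+1 (x, y + h * q k.+1)|.
    by exists (x, y + h * q k.+1).
  have [h3|h3] := leP (I / 4 ^+ k.+1) `|RI k.+1 (x + w * q k.+1, y)|.
    by exists (x + w * q k.+1, y).
  have [h4|h4] := leP (I / 4 ^+ k.+1) `|RI k.+1 (x + w * q k.+1, y + h * q k.+1)|.
    by exists (x + w * q k.+1, y + h * q k.+1).
  exfalso; move: big; rewrite split4 quarter leNgt => /negP; apply.
  have n1 := ler_normD (RI k.+1 (x, y) + RI k.+1 (x, y + h * q k.+1))
    (RI k.+1 (x + w * q k.+1, y) + RI k.+1 (x + w * q k.+1, y + h * q k.+1)).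
  have n2 := ler_normD (RI k.+1 (x, y)) (RI k.+1 (x, y + h * q k.+1)).
  have n3 := ler_normD (RI k.+1 (x + w * q k.+1, y)) (RI k.+1 (x + w * q k.+1, y + h * q k.+1)).
  by apply: le_lt_trans n1 _; lra.
have [next nextP] := choice (fun ks : nat * (R * R) => step ks.1 ks.2).
pose s := fix s k := if k is j.+1 then next (j, s j) else (a, c).
have sP k : inside k (s k) /\ I / 4 ^+ k <= `|RI k (s k)|.
  elim: k => [|k [ins big]]; last by have [] := nextP (k, s k) ins big.
  rewrite /inside /RI /q !expr0 !invr1 !mulr1 /= /w /h; split; last by rewrite addrC subrK addrC subrK.
  by split; rewrite ?lexx // addrC subrK.
have sS k := let: conj ins big := sP k in nextP (k, s k) ins big.
have [|||p1 p1P] := @nested_intervals (fun k => (s k).1) (fun k => (s k).1 + w * q k).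
- by move=> k; have [_ _ /andP[]] := sS k.
- move=> k; have [_ _ /andP[_ h1] _] := sS k; rewrite (qS k) mulrDr addrA.
  by rewrite lerD2r.
- by move=> k; rewrite lerDl mulr_ge0 // ltW.
have [|||p2 p2P] := @nested_intervals (fun k => (s k).2) (fun k => (s k).2 + h * q k).
- by move=> k; have [_ _ _ /andP[]] := sS k.
- move=> k; have [_ _ _ /andP[_ h1]] := sS k; rewrite (qS k) mulrDr addrA.
  by rewrite lerD2r.
- by move=> k; rewrite lerDl mulr_ge0 // ltW.
have Gp : differentiable G (p1 +i* p2).
  apply: Gd; have := p1P 0%N; have := p2P 0%N; rewrite /q expr0 invr1 !mulr1 /= /w /h.
  rewrite (addrC a) (addrC c) !subrK => /andP[? ?] /andP[? ?]; split=> //.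
have /differentiable_lineP[B GB] := Gp.
pose e := I / (4 * ((w + h) ^+ 2 + 1)).
have wh1 : 0 < (w + h) ^+ 2 + 1 by rewrite ltr_wpDl // sqr_ge0.
have e0 : 0 < e by rewrite divr_gt0 // mulr_gt0.
have [r r0 rG] := GB _ e0.
have [k kr] : exists k, (w + h) * q k < r.
  have wh0 : 0 <= (w + h) / r by apply: divr_ge0; [exact: addr_ge0|exact: ltW].
  exists (Num.bound ((w + h) / r)); set k := Num.bound _.
  have := archi_boundP wh0; rewrite -/k ltr_pdivrMr // => h1.
  rewrite /q ltr_pdivrMr ?exprn_gt0 // mulrC; apply: (lt_le_trans h1).
  by rewrite ler_pM2r // -natrX ler_nat ltnW // ltn_expl.
have [[i1 i2 i3 i4] big] := sP k.
have wq : 0 <= w * q k by rewrite mulr_ge0 // ltW.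
have hq : 0 <= h * q k by rewrite mulr_ge0 // ltW.
have : `|RI k (s k)| <= 2 * (e * ((w + h) * q k)) * ((w + h) * q k).
  have := @rect_int_near_affine _ G (s k).1 ((s k).1 + w * q k) (s k).2
    ((s k).2 + h * q k) B (G (p1 +i* p2) - B * (p1 +i* p2)) (e * ((w + h) * q k)).
  rewrite ![_ + _ * q k - _]addrAC !subrr !add0r -mulrDl; apply.
  - by rewrite lerDl.
  - by rewrite lerDl.
  - by apply: continuous_on_rect_edges; apply: differentiable_continuous_on_rect; apply: differentiable_on_subrect Gd.
  - move=> z [[z1 z2 z3 z4] _].
    have zp : rnorm (z - (p1 +i* p2)) <= (w + h) * q k.
      have := p1P k; have := p2P k => /andP[u1 u2] /andP[u3 u4].
      rewrite (le_trans (rnorm_le_ReIm _)) //= mulrDl.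
      case: z z1 z2 z3 z4 => x y /= z1 z2 z3 z4.
      by apply: lerD; [exact: (segment_dist u3 u4 z1 z2)|exact: (segment_dist u1 u2 z3 z4)].
    have := rG (z - (p1 +i* p2)); rewrite (le_lt_trans zp) // => /(_ isT).
    rewrite (addrC _ (z - _)) subrK => h1.
    rewrite (_ : G z - _ - _ = G z - G (p1 +i* p2) - B * (z - (p1 +i* p2))); last by ring.
    by rewrite (le_trans h1) // ler_wpM2l // ltW.
rewrite leNgt => /negP[]; apply: lt_le_trans big.
have -> : 2 * (e * ((w + h) * q k)) * ((w + h) * q k) = 2 * e * (w + h) ^+ 2 / 4 ^+ k.
  have -> : (4 ^- k : R) = q k * q k by rewrite /q -invfM -exprMn -natrM.
  by ring.
rewrite ltr_pM2r ?invr_gt0 ?exprn_gt0 //.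
rewrite /e; have := sqr_ge0 (w + h); move: wh1; set S := (w + h) ^+ 2 => S1 S0.
rewrite (_ : 2 * (I / (4 * (S + 1))) * S = I * (S / (2 * (S + 1)))); last first.
  by field; rewrite gt_eqF.
rewrite gtr_pMr // ltr_pdivrMr ?mulr_gt0 // mul1r; lra.
Qed.

End goursat.

(** * A Cauchy inequality for rectangles *)

Section cauchy.
Variable R : realType.
Local Notation mu := (@lebesgue_measure R).
Implicit Types (G F f : R[i] -> R[i]) (a b c d : R) (p z : R[i]).

(** A rectangle around the singularity can be cut down to a smaller one, since
    the four rectangles that are removed avoid the singularity. *)
Lemma rect_int_excise F a b c d p x1 x2 y1 y2 :
  (forall z, in_rect a b c d z -> z <> p -> differentiable F z) ->
  a <= x1 -> x1 < complex.Re p -> complex.Re p < x2 -> x2 <= b ->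
  c <= y1 -> y1 < complex.Im p -> complex.Im p < y2 -> y2 <= d ->
  rect_int F a b c d = rect_int F x1 x2 y1 y2.
Proof.
move=> Fd ax x1p px2 xb cy y1p py2 yd.
have x12 := lt_trans x1p px2; have y12 := lt_trans y1p py2.
have cd : c <= d by apply: le_trans cy (le_trans (ltW y12) yd).
have ab : a <= b by apply: le_trans ax (le_trans (ltW x12) xb).
have zero a' b' c' d' : a <= a' -> a' <= b' -> b' <= b -> c <= c' -> c' <= d' -> d' <= d ->
    ~ in_rect a' b' c' d' p -> continuous_on_edges F a' b' c' d' /\ rect_int F a' b' c' d' = 0.
  move=> aa ab' bb cc cd' dd np.
  have Fdr : differentiable_on_rect F a' b' c' d'.
    move=> z zr; apply: Fd; last by move=> zp; apply: np; rewrite -zp.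
    by case: zr => *; split; [apply: le_trans aa _|apply: le_trans bb|apply: le_trans cc _|apply: le_trans dd].
  split; last exact: goursat.
  by apply: continuous_on_rect_edges; exact: differentiable_continuous_on_rect.
have cont a' b' c' d' : a <= a' -> b' <= b -> c <= c' -> d' <= d ->
    ~ on_edges a' b' c' d' p -> continuous_on_edges F a' b' c' d'.
  move=> aa bb cc dd np z zr; apply: differentiable_continuous; apply: Fd.
    by case: zr => -[*]; split; [apply: le_trans aa _|apply: le_trans bb|apply: le_trans cc _|apply: le_trans dd].
  by move=> zp; apply: np; rewrite -zp.
have out (x y : R) : x < y -> ~ y <= x by move=> xy; rewrite leNgt xy.
have x2b : a <= x2 by rewrite (le_trans ax) // ltW.
have x1b : x1 <= b by rewrite (le_trans _ xb) // ltW.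
have y2d : c <= y2 by rewrite (le_trans cy) // ltW.
have y1d : y1 <= d by rewrite (le_trans _ yd) // ltW.
have [c1 r1] : continuous_on_edges F a x1 c d /\ rect_int F a x1 c d = 0.
  by apply: zero => // -[_ /(out _ _ x1p)].
have [c2 r2] : continuous_on_edges F x2 b c d /\ rect_int F x2 b c d = 0.
  by apply: zero => // -[/(out _ _ px2)].
have [c3 r3] : continuous_on_edges F x1 x2 c y1 /\ rect_int F x1 x2 c y1 = 0.
  by apply: zero => //; [exact: ltW|case=> _ _ _ /(out _ _ y1p)].
have [c4 r4] : continuous_on_edges F x1 x2 y2 d /\ rect_int F x1 x2 y2 d = 0.
  by apply: zero => //; [exact: ltW|case=> _ _ /(out _ _ py2)].
have ne (x y : R) : x < y -> x <> y by move=> /[swap] ->; rewrite ltxx.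
have ne' (x y : R) : x < y -> y <> x by move=> /[swap] ->; rewrite ltxx.
have cp : c < complex.Im p by exact: le_lt_trans cy y1p.
have pd : complex.Im p < d by exact: lt_le_trans yd.
have i1 : continuous_on_edges F x1 b c d.
  apply: cont => // -[_ []]; [exact: ne' x1p| |exact: ne' cp|exact: ne pd].
  by apply: ne; exact: lt_le_trans xb.
have i2 : continuous_on_edges F x1 x2 c d.
  by apply: cont => // -[_ []]; [exact: ne' x1p|exact: ne px2|exact: ne' cp|exact: ne pd].
have i3 : continuous_on_edges F x1 x2 y1 d.
  by apply: cont => // -[_ []]; [exact: ne' x1p|exact: ne px2|exact: ne' y1p|exact: ne pd].
have i4 : continuous_on_edges F x1 x2 y1 y2.
  by apply: cont => // -[_ []]; [exact: ne' x1p|exact: ne px2|exact: ne' y1p|exact: ne py2].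
rewrite (rect_int_splitx ax x1b cd c1 i1) r1 add0r.
rewrite (rect_int_splitx (ltW x12) xb cd i2 c2) r2 addr0.
rewrite (rect_int_splity cy y1d (ltW x12) c3 i3) r3 add0r.
by rewrite (rect_int_splity (ltW y12) yd (ltW x12) i4 c4) r4 addr0.
Qed.

Definition cauchy_kernel p z : R[i] := ('i * (z - p))^-1.

Lemma differentiable_cauchy_kernel p z : z <> p -> differentiable (cauchy_kernel p) z.
Proof.
move=> zp; apply: (@differentiableV R[i] _ (fun z => 'i * (z - p))).
  by apply: differentiableM => //; apply: differentiableB.
rewrite mulf_neq0 // ?subr_eq0; last exact/eqP.
by rewrite eq_complex /= oner_eq0 andbF.
Qed.

(** The bound 4 stands for the exact value 2 pi. *)
Lemma rect_int_cauchy_kernel p (w : R[i]) (e : R) : 0 < e ->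
  4 * `|complex.Re w| <= `|rect_int (fun z => w * cauchy_kernel p z)
    (complex.Re p - e) (complex.Re p + e) (complex.Im p - e) (complex.Im p + e)|.
Proof.
move=> e0; case: w => al be; case: p => p1 p2 /=.
pose k (q x : R) : R := 2 * e / ((x - q) ^+ 2 + e ^+ 2).
have den q x : 0 < (x - q) ^+ 2 + e ^+ 2 by rewrite ltr_wpDl ?sqr_ge0 // exprn_gt0.
have kc q : mu.-integrable `[q - e, q + e] (EFin \o k q).
  apply: integrable_itvcc => x _; apply: cvgMr.
  apply: cvgV; first by rewrite gt_eqF // den.
  apply: cvgD; last exact: cvg_cst.
  by apply: (@cvgM _ _ _ _ (fun x => x - q) (fun x => x - q)); apply: cvgB => //; exact: cvg_cst.
have kint q : 2 <= \int[mu]_(x in `[q - e, q + e]) k q x.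
  have -> : 2 = \int[mu]_(x in `[q - e, q + e]) cst e^-1 x.
    rewrite Rintegral_itv_cst; last by lra.
    by field; rewrite gt_eqF.
  apply: le_Rintegral => //.
    by apply: integrable_itvcc => x _; exact: cst_continuous.
  move=> x /=; rewrite in_itv /= => /andP[qx xq]; rewrite /k ler_pdivlMr //.
  have : (x - q) ^+ 2 <= e ^+ 2 by rewrite -subr_ge0 subr_sqr mulr_ge0 //; lra.
  move=> h; rewrite mulrDr [e^-1 * e ^+ 2](_ : _ = e); last by field; rewrite gt_eqF.
  rewrite mulr_natl mulr2n lerD2r mulrC ler_pdivrMr // -expr2 //.
have kern x y (u v : R) : x = p1 + u -> y = p2 + v -> u ^+ 2 + v ^+ 2 != 0 ->
    (al +i* be) * cauchy_kernel (p1 +i* p2) (x +i* y) =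
    ((be * u - al * v) / (u ^+ 2 + v ^+ 2)) +i* (- (al * u + be * v) / (u ^+ 2 + v ^+ 2)).
  move=> -> -> uv; rewrite /cauchy_kernel.
  have iE : 'i * ((p1 + u) +i* (p2 + v) - (p1 +i* p2)) = (- v) +i* u.
    by apply/eqP; rewrite eq_complex /=; apply/andP; split; apply/eqP; ring.
  rewrite iE; apply/eqP; rewrite eq_complex /= sqrrN addrC.
  by apply/andP; split; apply/eqP; field.
have RIE : rect_int (fun z => (al +i* be) * cauchy_kernel (p1 +i* p2) z)
    (p1 - e) (p1 + e) (p2 - e) (p2 + e) =
    al * (\int[mu]_(x in `[p1 - e, p1 + e]) k p1 x + \int[mu]_(x in `[p2 - e, p2 + e]) k p2 x).
  rewrite /rect_int mulrDr -!RintegralZl //; congr (_ + _).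
    apply: eq_Rintegral => x _.
    have d1 : (x - p1) ^+ 2 + (- e) ^+ 2 != 0 by rewrite sqrrN gt_eqF.
    have d2 : (x - p1) ^+ 2 + e ^+ 2 != 0 by rewrite gt_eqF.
    have ex : x = p1 + (x - p1) by rewrite addrC subrK.
    rewrite (kern _ _ _ _ ex (erefl _) d1) (kern _ _ _ _ ex (erefl _) d2) /k /= sqrrN.
    by field.
  rewrite -mulN1r -RintegralZl //; last first.
    apply: (@integrable_ver _ (fun z => (al +i* be) * cauchy_kernel (p1 +i* p2) z) (p1 - e) (p1 + e)).
      by lra.
    move=> z [_ ze]; apply: differentiable_continuous; apply: differentiableM => //.
    by apply: differentiable_cauchy_kernel => zp; move: ze; rewrite zp /= => -[]; lra.
  apply: eq_Rintegral => x _.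
  have d1 : (- e) ^+ 2 + (x - p2) ^+ 2 != 0 by rewrite sqrrN addrC gt_eqF.
  have d2 : e ^+ 2 + (x - p2) ^+ 2 != 0 by rewrite addrC gt_eqF.
  have d3 : (x - p2) ^+ 2 + e ^+ 2 != 0 by rewrite gt_eqF.
  have ex : x = p2 + (x - p2) by rewrite addrC subrK.
  rewrite (kern _ _ _ _ (erefl _) ex d1) (kern _ _ _ _ (erefl _) ex d2) /k /= sqrrN.
  by field; rewrite ?d2 ?d3.
rewrite RIE normrM mulrC ler_wpM2l // ger0_norm; first by have := kint p1; have := kint p2; lra.
by have := kint p1; have := kint p2; lra.
Qed.

End cauchy.

Section cauchy_inequality.
Variable R : realType.
Local Notation mu := (@lebesgue_measure R).
Implicit Types (G F f : R[i] -> R[i]) (a b c d : R) (p z : R[i]).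

Lemma rect_intD F G a b c d : a <= b -> c <= d ->
  continuous_on_edges F a b c d -> continuous_on_edges G a b c d ->
  rect_int (fun z => F z + G z) a b c d = rect_int F a b c d + rect_int G a b c d.
Proof.
move=> ab cd Fc Gc; rewrite /rect_int addrACA -opprD -!RintegralD //;
  try (by apply: integrable_hor); try by apply: integrable_ver.
by congr (_ - _); apply: eq_Rintegral => x _; rewrite /= !raddfD /=; ring.
Qed.

Lemma on_edges_neq a b c d p z : a < complex.Re p < b -> c < complex.Im p < d ->
  on_edges a b c d z -> z <> p.
Proof. by move=> /andP[? ?] /andP[? ?] [_ ze] zp; move: ze; rewrite zp => -[]; lra. Qed.

Lemma differentiable_mul_kernel f p z : z <> p -> differentiable f z ->
  differentiable (fun z => f z * cauchy_kernel p z) z.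
Proof.
by move=> zp fz; exact: (differentiableM fz (differentiable_cauchy_kernel zp)).
Qed.

Lemma rnorm_cauchy_kernel p z : rnorm (cauchy_kernel p z) = (rnorm (z - p))^-1.
Proof. by rewrite rnormV rnormM rnorm_i mul1r. Qed.

(** Shrinking the rectangle to the point replaces [f] by its value there, as the
    difference quotients of [f] are bounded. *)
Lemma cauchy_rect f a b c d p : a < complex.Re p < b -> c < complex.Im p < d ->
  differentiable_on_rect f a b c d ->
  4 * `|complex.Re (f p)| <= `|rect_int (fun z => f z * cauchy_kernel p z) a b c d|.
Proof.
move=> pab pcd fd.
have /andP[ap pb] := pab; have /andP[cp pd] := pcd.
have fp : differentiable f p by apply: fd; split; exact: ltW.
have /differentiable_lineP[D fD] := fp.
have [r r0 rf] := fD _ ltr01; set K : R := rnorm D + 1.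
have K0 : 0 < K by rewrite ltr_wpDl // rnorm_ge0.
have fK h : rnorm h < r -> rnorm (f (p + h) - f p) <= K * rnorm h.
  move=> /rf h1; have := rnormD (f (p + h) - f p - D * h) (D * h).
  rewrite subrK rnormM => /le_trans; apply.
  by rewrite /K mulrDl mul1r addrC lerD2l (le_trans h1) // mul1r.
apply/ler_addgt0Pr => e e0.
pose dl := Num.min (Num.min (Num.min (complex.Re p - a) (b - complex.Re p))
  (Num.min (complex.Im p - c) (d - complex.Im p)))
  (Num.min (r / 4) (e / (8 * K))).
have dl0 : 0 < dl by rewrite !lt_min !subr_gt0 ap pb cp pd !divr_gt0 // mulr_gt0.
have : dl <= dl by [].
rewrite {2}/dl !le_min => /andP[/andP[/andP[d1 d2] /andP[d3 d4]] /andP[d5 d6]].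
rewrite (@rect_int_excise _ _ a b c d p (complex.Re p - dl) (complex.Re p + dl)
  (complex.Im p - dl) (complex.Im p + dl)); try lra; last first.
  by move=> z zr zp; exact: (differentiable_mul_kernel zp (fd z zr)).
set Q := rect_int _ _ _ _ _.
have sq : complex.Re p - dl < complex.Re p < complex.Re p + dl by apply/andP; lra.
have sq' : complex.Im p - dl < complex.Im p < complex.Im p + dl by apply/andP; lra.
have sub z : on_edges (complex.Re p - dl) (complex.Re p + dl) (complex.Im p - dl)
    (complex.Im p + dl) z -> z <> p /\ in_rect a b c d z.
  by move=> ze; split; [exact: on_edges_neq ze|case: ze => -[*]; split; lra].
have dB z : in_rect a b c d z -> differentiable (fun z => f z - f p) z.
  by move=> zr; exact: (differentiableB (fd z zr) (differentiable_cst _ _)).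
have QE : Q = rect_int (fun z => f p * cauchy_kernel p z) (complex.Re p - dl)
    (complex.Re p + dl) (complex.Im p - dl) (complex.Im p + dl) +
    rect_int (fun z => (f z - f p) * cauchy_kernel p z) (complex.Re p - dl)
    (complex.Re p + dl) (complex.Im p - dl) (complex.Im p + dl).
  have fE : (fun z => f z * cauchy_kernel p z) =
      (fun z => f p * cauchy_kernel p z + (f z - f p) * cauchy_kernel p z).
    by apply/funext => z; rewrite -mulrDl (addrC (f p)) subrK.
  rewrite /Q fE rect_intD //; [lra|lra| |].
  - move=> z /sub[zp zr]; apply: differentiable_continuous.
    exact: (differentiable_mul_kernel zp (differentiable_cst (f p) z)).
  - move=> z /sub[zp zr]; apply: differentiable_continuous.
    exact: (differentiable_mul_kernel zp (dB z zr)).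
have := rect_int_cauchy_kernel p (f p) dl0.
have : `|rect_int (fun z => (f z - f p) * cauchy_kernel p z) (complex.Re p - dl)
    (complex.Re p + dl) (complex.Im p - dl) (complex.Im p + dl)| <= e.
  apply: le_trans (@rect_int_near_affine _ _ _ _ _ _ 0 0 K _ _ _ _) _; try lra.
  - move=> z /sub[zp zr]; apply: differentiable_continuous.
    exact: (differentiable_mul_kernel zp (dB z zr)).
  - move=> z ze; have [zp _] := sub z ze; rewrite mul0r !subr0 rnormM rnorm_cauchy_kernel.
    have zp0 : 0 < rnorm (z - p) by apply: rnorm_gt0; rewrite subr_eq0; exact/eqP.
    rewrite ler_pdivrMr //.
    apply: le_trans (fK (z - p) _); first by rewrite (addrC p) subrK.
    case: ze => -[z1 z2 z3 z4] _; apply: le_lt_trans (rnorm_le_ReIm _) _.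
    case: (z) (p) z1 z2 z3 z4 d5 => u v [u' v'] /= z1 z2 z3 z4 d5.
    have : `|u - u'| <= dl by rewrite ler_norml; apply/andP; lra.
    have : `|v - v'| <= dl by rewrite ler_norml; apply/andP; lra.
    by move=> h1 h2; apply: le_lt_trans (lerD h2 h1) _; lra.
  - move: d6; rewrite ler_pdivlMr ?mulr_gt0 // => d6; lra.
rewrite QE => V1 U1; apply: le_trans U1 _; apply: le_trans (lerD (lexx _) V1).
have norm_le (x y : R) : `|x| <= `|x + y| + `|y| by rewrite -{1}[x](addrK y) ler_normB.
exact: norm_le.
Qed.

End cauchy_inequality.

(** * The maximum principle and division by a zero *)

Section power_trick.
Variable R : realType.

Lemma bernoulli (y : R) m : 0 <= y -> 1 + m%:R * y <= (1 + y) ^+ m.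
Proof.
move=> y0; elim: m => [|m ih]; first by rewrite mul0r addr0 expr0.
rewrite exprS; apply: le_trans (ler_wpM2l _ ih); last by rewrite addr_ge0.
rewrite -natr1 mulrDl mul1r; have : 0 <= m%:R * y * y by rewrite !mulr_ge0.
rewrite mulrDr mulr1 mulrDl mul1r => h; lra.
Qed.

Lemma ler_power_trick (x A C : R) : 0 <= x -> 0 <= A ->
  (forall m, x ^+ m <= C * A ^+ m) -> x <= A.
Proof.
move=> x0 A0 h; rewrite leNgt; apply/negP => Ax.
have [A_eq0|An0] := eqVneq A 0.
  by have := h 1%N; rewrite !expr1 A_eq0 mulr0 leNgt -{1}A_eq0 Ax.
have Ap : 0 < A by rewrite lt0r An0.
pose y := x / A - 1.
have y0 : 0 < y by rewrite subr_gt0 ltr_pdivlMr // mul1r.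
have bd m : 1 + m%:R * y <= C.
  apply: le_trans (bernoulli m (ltW y0)) _.
  by rewrite /y addrC subrK expr_div_n ler_pdivrMr ?exprn_gt0.
have := bd (Num.bound (C / y)); have : C / y < (Num.bound (C / y))%:R.
  by apply: archi_boundP; rewrite divr_ge0 ?(ltW y0) // (le_trans _ (bd 0%N)) // mul0r addr0.
rewrite ltr_pdivrMr // => h1 h2.
lra.
Qed.

End power_trick.

Section maximum_principle.
Variable R : realType.
Implicit Types (G g : R[i] -> R[i]) (p s z : R[i]) (A B C M : R).

Lemma differentiable_pow G m z : differentiable G z ->
  differentiable (fun w => G w ^+ m) z.
Proof.
move=> Gz; elim: m => [|m ih].
  by under eq_fun do rewrite expr0; exact: differentiable_cst.
by under eq_fun do rewrite exprS; exact: (differentiableM Gz ih).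
Qed.

Definition in_square z := `|complex.Re z| < 1 /\ `|complex.Im z| < 1.

Definition on_square_edges z := on_edges (-1) 1 (-1) 1 z.

Lemma rnorm_square z : in_rect (-1) 1 (-1) 1 z -> rnorm z < 2.
Proof.
move=> [z1 z2 z3 z4]; have h : Num.sqrt (4 : R) = 2.
  by rewrite (_ : 4 = 2 ^+ 2) ?sqrtr_sqr ?ger0_norm //; ring.
rewrite rnormC -h ltr_sqrt //.
have : complex.Re z ^+ 2 <= 1 by rewrite -subr_ge0 -{1}(expr1n _ 2) subr_sqr mulr_ge0 //; lra.
have : complex.Im z ^+ 2 <= 1 by rewrite -subr_ge0 -{1}(expr1n _ 2) subr_sqr mulr_ge0 //; lra.
lra.
Qed.

Lemma in_square_lt2 z : in_square z -> rnorm z < 2.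
Proof.
move=> [/ltW + /ltW +]; rewrite !ler_norml => /andP[? ?] /andP[? ?].
by apply: rnorm_square; split.
Qed.

Lemma rnorm_lt1_square z : rnorm z < 1 -> in_square z.
Proof.
by move=> z1; split; [apply: le_lt_trans z1; exact: Re_le_rnorm|
  apply: le_lt_trans z1; exact: Im_le_rnorm].
Qed.

Lemma on_square_edges_ge1 z : on_square_edges z -> 1 <= rnorm z.
Proof.
move=> [_ [] h]; [apply: le_trans (Re_le_rnorm z)|apply: le_trans (Re_le_rnorm z)|
  apply: le_trans (Im_le_rnorm z)|apply: le_trans (Im_le_rnorm z)];
  by rewrite h ?normrN normr1.
Qed.

Definition edge_gap z : R := 1 - Num.max `|complex.Re z| `|complex.Im z|.

Lemma edge_gap_gt0 z : in_square z -> 0 < edge_gap z.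
Proof. by move=> [h1 h2]; rewrite subr_gt0 gt_max h1 h2. Qed.

Lemma edge_gap_le z w : on_square_edges w -> edge_gap z <= rnorm (w - z).
Proof.
have key (x y : R) : `|y| = 1 -> 1 - `|x| <= `|y - x|.
  by move=> <-; exact: lerB_dist.
move=> [_ h]; rewrite /edge_gap; set m := Num.max _ _.
have [m1 m2] : `|complex.Re z| <= m /\ `|complex.Im z| <= m.
  by split; rewrite le_max lexx ?orbT.
case: h => h.
- apply: le_trans (Re_le_rnorm _); rewrite raddfB /=.
  by apply: le_trans (key _ _ _); [rewrite lerD2l lerN2|rewrite h normrN normr1].
- apply: le_trans (Re_le_rnorm _); rewrite raddfB /=.
  by apply: le_trans (key _ _ _); [rewrite lerD2l lerN2|rewrite h normr1].
- apply: le_trans (Im_le_rnorm _); rewrite raddfB /=.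
  by apply: le_trans (key _ _ _); [rewrite lerD2l lerN2|rewrite h normrN normr1].
- apply: le_trans (Im_le_rnorm _); rewrite raddfB /=.
  by apply: le_trans (key _ _ _); [rewrite lerD2l lerN2|rewrite h normr1].
Qed.

Lemma edge_gap_near z w : edge_gap z - rnorm (z - w) <= edge_gap w.
Proof.
rewrite /edge_gap; have : Num.max `|complex.Re w| `|complex.Im w| <=
  Num.max `|complex.Re z| `|complex.Im z| + rnorm (z - w).
  rewrite ge_max; apply/andP; split.
    have := Re_le_rnorm (w - z); rewrite raddfB rnormB /= => h.
    rewrite -[complex.Re w](subrK (complex.Re z)) (le_trans (ler_normD _ _)) // addrC.
    by rewrite lerD // le_max lexx.
  have := Im_le_rnorm (w - z); rewrite raddfB rnormB /= => h.
  rewrite -[complex.Im w](subrK (complex.Im z)) (le_trans (ler_normD _ _)) // addrC.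
  by rewrite lerD // le_max lexx orbT.
lra.
Qed.

Lemma cauchy_square G A z : (forall w, rnorm w < 2 -> differentiable G w) -> 0 <= A ->
  (forall w, on_square_edges w -> rnorm (G w) <= A) -> in_square z ->
  rnorm (G z) <= 4 / edge_gap z * A.
Proof.
move=> Gd A0 GA zin; have gap0 := edge_gap_gt0 zin.
have [zr zi] : -1 < complex.Re z < 1 /\ -1 < complex.Im z < 1.
  by case: zin; rewrite !ltr_norml.
have half F : (forall w, rnorm w < 2 -> differentiable F w) ->
    (forall w, on_square_edges w -> rnorm (F w) <= A) ->
    `|complex.Re (F z)| <= 2 / edge_gap z * A.
  move=> Fd FA.
  have Fr : differentiable_on_rect F (-1) 1 (-1) 1.
    by move=> w /rnorm_square/Fd.
  have edge : `|rect_int (fun w => F w * cauchy_kernel z w) (-1) 1 (-1) 1|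
      <= 2 * (A / edge_gap z) * ((1 - -1) + (1 - -1)).
    apply: (@rect_int_near_affine _ _ _ _ _ _ 0 0); [lra|lra| |].
      move=> w we; apply: differentiable_continuous.
      have wz := on_edges_neq zr zi we.
      by exact: (differentiable_mul_kernel wz (Fr w (proj1 we))).
    move=> w we; rewrite mul0r !subr0 rnormM rnorm_cauchy_kernel.
    apply: ler_pM; rewrite ?rnorm_ge0 ?invr_ge0 ?rnorm_ge0 //; first exact: FA.
    rewrite lef_pV2 ?posrE //; first exact: edge_gap_le.
    exact: lt_le_trans gap0 (edge_gap_le _ we).
  have := le_trans (cauchy_rect zr zi Fr) edge; rewrite (mulrAC 2 _ A) -mulrA => h; lra.
have h1 := half G Gd GA.
have h2 : `|complex.Im (G z)| <= 2 / edge_gap z * A.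
  have : `|complex.Re (- 'i * G z)| <= 2 / edge_gap z * A.
    apply: (half (fun w => - 'i * G w)).
      by move=> w /Gd Gw; exact: (differentiableM (differentiable_cst _ _) Gw).
    by move=> w we; rewrite rnormM rnormN rnorm_i mul1r GA.
  by case: (G z) => u v /=; rewrite oppr0 mul0r mulN1r opprK add0r.
rewrite (le_trans (rnorm_le_ReIm _)) // (le_trans (lerD h1 h2)) //.
by rewrite -!mulrDl (_ : 2 + 2 = 4 :> R) //; ring.
Qed.

(** The constant in the Cauchy bound disappears when it is applied to large powers
    of [G]; the factor [D], which vanishes at the exceptional points, makes the
    product differentiable there and does not affect the limit. *)
Lemma max_square_factor G (D : R[i] -> R[i]) A B z :
  (forall m w, rnorm w < 2 -> differentiable (fun w => D w * G w ^+ m) w) ->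
  (forall w, on_square_edges w -> rnorm (G w) <= A) ->
  (forall w, rnorm w < 2 -> rnorm (D w) <= B) ->
  in_square z -> D z != 0 -> rnorm (G z) <= A.
Proof.
move=> DGd GA DB zin Dz0.
have A0 : 0 <= A.
  have e1 : on_square_edges (1 : R[i]).
    by split; [split => /=; lra|constructor 2].
  exact: le_trans (rnorm_ge0 _) (GA _ e1).
have B0 : 0 <= B.
  by apply: le_trans (rnorm_ge0 (D 0)) (DB _ _); rewrite rnorm0.
have Dz : 0 < rnorm (D z) by exact: rnorm_gt0.
have gap0 := edge_gap_gt0 zin.
apply: (@ler_power_trick _ _ _ (4 / edge_gap z * B / rnorm (D z))) => // [|m].
  exact: rnorm_ge0.
have := @cauchy_square _ (B * A ^+ m) z (DGd m).
rewrite rnormM rnormX => h.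
rewrite -(ler_pM2l Dz) (le_trans (h _ _ zin)) //.
- by rewrite mulr_ge0 ?exprn_ge0.
- move=> w we; rewrite rnormM rnormX ler_pM ?rnorm_ge0 ?exprn_ge0 ?rnorm_ge0 //.
    by apply: DB; apply: rnorm_square; case: we.
  by rewrite lerXn2r ?nnegrE ?rnorm_ge0 // GA.
- by rewrite le_eqVlt; apply/orP; left; apply/eqP; field; rewrite !gt_eqF.
Qed.

Lemma max_square G A z : (forall w, rnorm w < 2 -> differentiable G w) ->
  (forall w, on_square_edges w -> rnorm (G w) <= A) -> in_square z -> rnorm (G z) <= A.
Proof.
move=> Gd GA zin; apply: (@max_square_factor _ (cst 1) A 1) => //.
- move=> m w /Gd Gw; apply: differentiableM; first exact: differentiable_cst.
  exact: differentiable_pow.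
- by move=> w _; rewrite rnorm1.
- by rewrite oner_neq0.
Qed.

End maximum_principle.

Section completeness.
Variable R : realType.

Lemma real_cauchy_seq (x : nat -> R) :
  (forall e : R, 0 < e -> exists N, forall n, (N <= n)%N -> `|x N - x n| < e) ->
  exists l, forall e : R, 0 < e -> exists N, forall n, (N <= n)%N -> `|x n - l| < e.
Proof.
move=> xc; have cx : cvgn x.
  apply/cauchy_cvgP/cauchy_exP => e /xc[N NP].
  by exists (x N); exists N => // n /NP.
exists (limn x) => e e0; have /cvgrPdist_lt/(_ e e0)[N _ NP] := cx.
by exists N => n /NP; rewrite distrC.
Qed.

Lemma complex_cauchy_seq (u : nat -> R[i]) :
  (forall e : R, 0 < e -> exists N, forall n, (N <= n)%N -> rnorm (u N - u n) < e) ->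
  exists l, forall e : R, 0 < e -> exists N, forall n, (N <= n)%N -> rnorm (u n - l) < e.
Proof.
move=> uc.
have [|a aP] := @real_cauchy_seq (fun n => complex.Re (u n)).
  move=> e /uc[N NP]; exists N => n /NP; apply: le_lt_trans.
  by rewrite -raddfB Re_le_rnorm.
have [|b bP] := @real_cauchy_seq (fun n => complex.Im (u n)).
  move=> e /uc[N NP]; exists N => n /NP; apply: le_lt_trans.
  by rewrite -raddfB Im_le_rnorm.
exists (a +i* b) => e e0; have e2 : 0 < e / 2 by rewrite divr_gt0.
have [N1 h1] := aP _ e2; have [N2 h2] := bP _ e2.
exists (maxn N1 N2) => n; rewrite geq_max => /andP[/h1 + /h2].
case: (u n) => x y /= hx hy; rewrite (le_lt_trans (rnorm_le_ReIm _)) //=.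
by rewrite (splitr e) ltrD.
Qed.

End completeness.

Section removable.
Variable R : realType.
Implicit Types (G g : R[i] -> R[i]) (a p s t z w : R[i]) (A B C M : R).

Lemma differentiable_lipschitz g a : differentiable g a ->
  exists K r : R, 0 < r /\ forall w, rnorm (w - a) < r -> rnorm (g w - g a) <= K * rnorm (w - a).
Proof.
move=> /differentiable_lineP[D gD]; have [r r0 rg] := gD _ ltr01.
exists (rnorm D + 1), r; split=> // w /rg; rewrite (addrC a) subrK mul1r => h1.
have := rnormD (g w - g a - D * (w - a)) (D * (w - a)).
rewrite subrK rnormM => /le_trans; apply.
by rewrite mulrDl mul1r addrC lerD2l.
Qed.

Lemma differentiable_sqr_mul G t (r : R) B : 0 < r ->
  (forall w, rnorm (w - t) < r -> w <> t -> rnorm (G w) <= B) ->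
  differentiable (fun w => (w - t) ^+ 2 * G w) t.
Proof.
move=> r0 GB; apply/differentiable_lineP; exists 0 => e e0.
have B0 : 0 < `|B| + 1 by rewrite ltr_wpDl.
exists (Num.min r (e / (`|B| + 1))); first by rewrite lt_min r0 divr_gt0.
move=> h; rewrite lt_min ltr_pdivlMr // => /andP[hr he].
rewrite subrr expr0n mul0r subr0 mul0r subr0 (addrC t) addrK.
have [->|h0] := eqVneq h 0; first by rewrite expr0n mul0r rnorm0 mulr0.
have := GB (h + t); rewrite addrK => /(_ hr) GB'.
rewrite rnormM rnormX expr2 -mulrA mulrC ler_wpM2r ?rnorm_ge0 //.
apply: le_trans (ltW he); rewrite ler_wpM2l ?rnorm_ge0 //.
have ht : h + t <> t by move=> /eqP; rewrite -subr_eq0 addrK; exact/negP.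
apply: le_trans (GB' ht) _; apply: le_trans (ler_norm _) _.
by rewrite lerDl.
Qed.

Lemma edge_gap_square z : 0 < edge_gap z -> in_square z.
Proof. by rewrite /edge_gap subr_gt0 gt_max => /andP. Qed.

Lemma removable_lipschitz G s B : in_square s ->
  (forall w, rnorm w < 2 -> w <> s -> differentiable G w) ->
  (forall w, rnorm w < 2 -> w <> s -> rnorm (G w) <= B) ->
  exists L r : R, [/\ 0 <= L, 0 < r & forall z a, rnorm (z - s) < r -> rnorm (a - s) < r ->
    z <> s -> a <> s -> rnorm (G z - G a) <= L * rnorm (z - a)].
Proof.
move=> sin Gd GB; have gap0 := edge_gap_gt0 sin.
exists `|4 * B / edge_gap s|, (edge_gap s / 2); split; [by []|by rewrite divr_gt0|].
move=> z a zs as_ zns ans.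
have near_gap w : rnorm (w - s) < edge_gap s / 2 -> edge_gap s / 2 <= edge_gap w.
  by move=> ws; have := edge_gap_near s w; rewrite rnormB; lra.
have near_in w : rnorm (w - s) < edge_gap s / 2 -> in_square w.
  by move=> /near_gap h; apply: edge_gap_square; apply: lt_le_trans h; rewrite divr_gt0.
have a2 := in_square_lt2 (near_in _ as_).
apply: (@le_trans _ _ (4 * B / edge_gap s * rnorm (z - a))); last first.
  by rewrite ler_wpM2r ?rnorm_ge0 // ler_norm.
have [->|zna] := eqVneq z a; first by rewrite !subrr rnorm0 mulr0.
have za0 : 0 < rnorm (z - a) by rewrite rnorm_gt0 // subr_eq0.
have sa0 : 0 < rnorm (s - a) by rewrite rnorm_gt0 // subr_eq0; apply/eqP => h; apply: ans.
pose Ga w := (G w - G a) / (w - a).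
suff : rnorm (Ga z) <= 4 * B / edge_gap s.
  by rewrite rnormM rnormV ler_pdivrMr.
have dsub t w : differentiable (fun w => w - t) w.
  by apply: differentiableB => //; exact: differentiable_cst.
have dsub2 t w : differentiable (fun w => (w - t) ^+ 2) w.
  exact: differentiable_pow.
have Gad w : rnorm w < 2 -> w <> s -> w <> a -> differentiable Ga w.
  move=> w2 ws wa; apply: differentiableM.
    exact: (differentiableB (Gd w w2 ws) (differentiable_cst _ _)).
  by apply: (differentiableV (dsub _ _)); rewrite subr_eq0; exact/eqP.
have sub4 t w : rnorm t < 2 -> rnorm w < 2 -> rnorm ((w - t) ^+ 2) <= 16.
  move=> t2 w2; rewrite rnormX (_ : 16 = 4 ^+ 2); last by ring.
  rewrite lerXn2r ?nnegrE ?rnorm_ge0 //.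
  by rewrite (le_trans (rnormDB _ _)) //; lra.
have s2 := in_square_lt2 sin.
apply: (@max_square_factor _ Ga (fun w => (w - s) ^+ 2 * (w - a) ^+ 2) _ (16 * 16)).
- move=> m w w2; have [->|ws] := eqVneq w s.
    pose r := Num.min (rnorm (s - a) / 2) (2 - rnorm s).
    have r0 : 0 < r by rewrite lt_min divr_gt0 ?subr_gt0.
    under eq_fun do rewrite -mulrA.
    apply: (differentiable_sqr_mul (B := 16 * (4 * B / rnorm (s - a)) ^+ m) r0).
    move=> v; rewrite lt_min => /andP[vs1 vs2] vs.
    have v2 : rnorm v < 2.
      by have := rnormD (v - s) s; rewrite subrK; lra.
    have va : rnorm (s - a) / 2 <= rnorm (v - a).
      by have := rnorm_tri v s a; rewrite (rnormB s v); lra.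
    rewrite rnormM ler_pM ?rnorm_ge0 //; first exact: sub4.
    rewrite rnormX lerXn2r ?nnegrE ?rnorm_ge0 //.
      rewrite divr_ge0 ?rnorm_ge0 // mulr_ge0 //.
      by apply: le_trans (GB a a2 ans); exact: rnorm_ge0.
    rewrite rnormM rnormV ler_pdivrMr; last by rewrite (lt_le_trans _ va) ?divr_gt0.
    have h1 : rnorm (G v - G a) <= 2 * B.
      rewrite (le_trans (rnormDB _ _)) // mulr_natl mulr2n lerD //; [exact: GB|exact: GB].
    apply: le_trans h1 _; apply: (@le_trans _ _ (4 * B / rnorm (s - a) * (rnorm (s - a) / 2))).
      by rewrite le_eqVlt; apply/orP; left; apply/eqP; field; rewrite gt_eqF.
    rewrite ler_wpM2l // divr_ge0 ?rnorm_ge0 // mulr_ge0 //.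
    by apply: le_trans (GB a a2 ans); exact: rnorm_ge0.
  have [->|wa] := eqVneq w a.
    have [K [r [r0 Kr]]] := differentiable_lipschitz (Gd a a2 ans).
    pose r' := Num.min r (2 - rnorm a).
    have r'0 : 0 < r' by rewrite lt_min r0 subr_gt0.
    under eq_fun do rewrite (mulrC ((_ - s) ^+ 2)) -mulrA.
    apply: (differentiable_sqr_mul (B := 16 * K ^+ m) r'0).
    move=> v; rewrite lt_min => /andP[vs1 vs2] va.
    have v2 : rnorm v < 2.
      by have := rnormD (v - a) a; rewrite subrK; lra.
    have va0 : 0 < rnorm (v - a) by rewrite rnorm_gt0 // subr_eq0; apply/eqP.
    have hK : rnorm (Ga v) <= K by rewrite rnormM rnormV ler_pdivrMr // Kr.
    rewrite rnormM ler_pM ?rnorm_ge0 //; first exact: sub4.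
    by rewrite rnormX lerXn2r ?nnegrE ?rnorm_ge0 // (le_trans _ hK) ?rnorm_ge0.
  apply: differentiableM; first exact: differentiableM.
  by apply: differentiable_pow; apply: Gad => //; exact/eqP.
- move=> w we; have w2 : rnorm w < 2 by apply: rnorm_square; case: we.
  have wgap t : rnorm (t - s) < edge_gap s / 2 -> w <> t.
    move=> /near_gap h wt; have := edge_gap_le t we; rewrite wt subrr rnorm0; lra.
  have h1 : rnorm (G w - G a) <= 2 * B.
    rewrite (le_trans (rnormDB _ _)) // mulr_natl mulr2n lerD //; [|exact: GB].
    by apply: GB => //; apply: wgap; rewrite subrr rnorm0 divr_gt0.
  have h2 : edge_gap s / 2 <= rnorm (w - a).
    by apply: le_trans (near_gap _ as_) (edge_gap_le _ we).
  have B0 : 0 <= B by apply: le_trans (GB a a2 ans); exact: rnorm_ge0.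
  rewrite rnormM rnormV ler_pdivrMr; last by rewrite (lt_le_trans _ h2) ?divr_gt0.
  apply: le_trans h1 _; apply: (@le_trans _ _ (4 * B / edge_gap s * (edge_gap s / 2))).
    by rewrite le_eqVlt; apply/orP; left; apply/eqP; field; rewrite gt_eqF.
  by rewrite ler_wpM2l // divr_ge0 ?(ltW gap0) // mulr_ge0.
- by move=> w w2; rewrite rnormM ler_pM ?rnorm_ge0 ?sub4.
- exact: near_in.
- by rewrite mulf_neq0 // expf_neq0 // subr_eq0 //; exact/eqP.
Qed.

(** Lipschitz bounds give a limit at the exceptional point, by completeness. *)
Lemma removable_limit G s B : in_square s ->
  (forall w, rnorm w < 2 -> w <> s -> differentiable G w) ->
  (forall w, rnorm w < 2 -> w <> s -> rnorm (G w) <= B) ->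
  exists l (L r : R), 0 < r /\ forall z, rnorm (z - s) < r -> z <> s ->
    rnorm (G z - l) <= L * rnorm (z - s).
Proof.
move=> sin Gd GB; have [L [r [L_ge0 r0 GL]]] := removable_lipschitz sin Gd GB.
pose h k : R[i] := (r / k.+2%:R)%:C.
have rh k : rnorm (h k) = r / k.+2%:R by rewrite rnorm_real ger0_norm // divr_ge0 // ltW.
have hr k : rnorm (h k) < r.
  by rewrite rh ltr_pdivrMr // ltr_pMr // ltr1n.
have h0 k : s + h k <> s.
  move=> /eqP; rewrite -subr_eq0 addrC addKr => /eqP hk0.
  by have := rh k; rewrite hk0 rnorm0 => /eqP; rewrite eq_sym gt_eqF // divr_gt0.
have sh k : s + h k - s = h k by rewrite addrC addKr.
have small (e : R) : 0 < e -> exists N, forall n, (N <= n)%N -> rnorm (h n) < e.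
  move=> e0; exists (Num.bound (r / e)) => n Nn; rewrite rh ltr_pdivrMr // mulrC.
  have := archi_boundP (divr_ge0 (ltW r0) (ltW e0)); rewrite ltr_pdivrMr // => /lt_le_trans; apply.
  by rewrite ler_pM2r // ler_nat (leq_trans Nn) // -addn2 leq_addr.
have L0 : 0 < `|L| + 1 by rewrite ltr_wpDl.
have [|l lP] := @complex_cauchy_seq _ (fun k => G (s + h k)).
  move=> e e0; have [|N NP] := small (e / (`|L| + 1) / 2); first by rewrite !divr_gt0.
  exists N => n Nn; have [h1 h2] := (NP _ (leqnn N), NP _ Nn).
  apply: le_lt_trans (GL _ _ _ _ (h0 _) (h0 _)) _; rewrite ?sh //.
  rewrite opprD addrACA subrr add0r.
  apply: le_lt_trans (_ : (`|L| + 1) * rnorm (h N - h n) < e).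
    by rewrite ler_wpM2r ?rnorm_ge0 // (le_trans (ler_norm _)) // lerDl.
  rewrite mulrC -ltr_pdivlMr // (le_lt_trans (rnormDB _ _)) //.
  by rewrite (splitr (e / _)) ltrD.
exists l, L, r; split=> // z zr zs; apply/ler_addgt0Pr => e e0.
have e2 : 0 < e / 2 by rewrite divr_gt0.
have [N1 NP1] := lP _ e2; have [|N2 NP2] := small (e / 2 / (`|L| + 1)); first by rewrite divr_gt0.
set k := maxn N1 N2; have k1 := NP1 k (leq_maxl _ _); have k2 := NP2 k (leq_maxr _ _).
have := GL z (s + h k) zr; rewrite sh => /(_ (hr _) zs (h0 _)) g1.
apply: le_trans (rnorm_tri (G (s + h k)) _ _) _.
have g2 : L * rnorm (z - (s + h k)) <= L * rnorm (z - s) + e / 2.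
  have : rnorm (z - (s + h k)) <= rnorm (z - s) + rnorm (h k) by rewrite opprD addrA rnormDB.
  move=> /(ler_wpM2l L_ge0) /le_trans; apply; rewrite mulrDr lerD2l.
  apply: le_trans (_ : (`|L| + 1) * rnorm (h k) <= _).
    by rewrite ler_wpM2r ?rnorm_ge0 // (le_trans (ler_norm _)) // lerDl.
  by rewrite mulrC -ler_pdivlMr // ltW.
rewrite (splitr e) addrA lerD //; last exact: ltW.
exact: le_trans g1 g2.
Qed.

End removable.

Section division.
Variable R : realType.
Implicit Types (G g : R[i] -> R[i]) (a p s t z w : R[i]) (A B C M : R).

(** Bounded holomorphic functions on the disc of radius 2. *)
Definition hol_bounded g M := forall w, rnorm w < 2 ->
  differentiable g w /\ rnorm (g w) <= M.

Lemma hol_bounded_ge0 g M : hol_bounded g M -> 0 <= M.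
Proof.
by move=> gM; apply: le_trans (proj2 (gM 0 _)); rewrite ?rnorm_ge0 // rnorm0.
Qed.

Let quotient g s l z : R[i] := if z == s then l else (g z - g s) / (z - s).

Let differentiable_quotient g s l z : differentiable g z -> z <> s ->
  differentiable (quotient g s l) z.
Proof.
move=> gz zs.
have d1 : differentiable (fun w => (g w - g s) / (w - s)) z.
  apply: differentiableM; first exact: (differentiableB gz (differentiable_cst _ _)).
  apply: differentiableV; first by apply: differentiableB => //; exact: differentiable_cst.
  by rewrite subr_eq0; exact/eqP.
move/differentiable_lineP: d1 => [D dD]; apply/differentiable_lineP; exists D => e /dD[r r0 rh].
have zs0 : 0 < rnorm (z - s) by rewrite rnorm_gt0 // subr_eq0; exact/eqP.
exists (Num.min r (rnorm (z - s))); first by rewrite lt_min r0.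
move=> h; rewrite lt_min => /andP[/rh hr hzs]; rewrite /quotient.
case: eqP => [zhs|_]; last by rewrite (introF eqP zs).
by move: hzs; rewrite -zhs opprD addrA subrr add0r rnormN ltxx.
Qed.

(** Applying the removable singularity lemma first to the difference quotient at
    [s] and then to the difference quotient of its extension shows that the
    extension is differentiable at [s] as well. *)
Lemma division g M s : hol_bounded g M -> in_square s ->
  exists g1 B, hol_bounded g1 B /\ forall z, g z = g s + (z - s) * g1 z.
Proof.
move=> gM sin; have s2 := in_square_lt2 sin.
have M0 := hol_bounded_ge0 gM.
have bounded_off G l (L r : R) K : 0 < r -> (forall z, rnorm (z - s) < r -> z <> s ->
      rnorm (G z - l) <= L * rnorm (z - s)) -> (forall z, rnorm z < 2 -> rnorm (G z) <= K) ->
    exists B, forall z, rnorm z < 2 -> z <> s -> rnorm ((G z - l) / (z - s)) <= B.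
  move=> r0 GL GK; exists (`|L| + (`|K| + rnorm l) / r) => z z2 zs.
  have zs0 : 0 < rnorm (z - s) by rewrite rnorm_gt0 // subr_eq0; exact/eqP.
  rewrite rnormM rnormV; have [zr|zr] := ltP (rnorm (z - s)) r.
    rewrite ler_pdivrMr // (le_trans (GL z zr zs)) // ler_wpM2r ?rnorm_ge0 //.
    by rewrite (le_trans (ler_norm _)) // lerDl divr_ge0 ?addr_ge0 ?rnorm_ge0 // ltW.
  apply: (@le_trans _ _ ((`|K| + rnorm l) / r)); last by rewrite lerDr.
  apply: ler_pM; rewrite ?rnorm_ge0 ?invr_ge0 ?rnorm_ge0 //.
    by rewrite (le_trans (rnormDB _ _)) // lerD2r (le_trans (GK z z2)) // ler_norm.
  by rewrite lef_pV2.
have [K [r [r0 gK]]] := differentiable_lipschitz (proj1 (gM s s2)).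
have gM2 z : rnorm z < 2 -> rnorm (g z) <= M by move=> /gM[].
have [B1 q1B] := bounded_off g (g s) K r M r0 (fun z zr _ => gK z zr) gM2.
have [||l [L [r1 [r10 q1L]]]] := @removable_limit _ (quotient g s 0) s B1 sin.
- by move=> w w2 ws; apply: differentiable_quotient ws; exact: (proj1 (gM w w2)).
- by move=> w w2 ws; rewrite /quotient (introF eqP ws); exact: q1B.
pose g1 := quotient g s l.
have g1s : g1 s = l by rewrite /g1 /quotient eqxx.
have g1E z : z <> s -> g1 z = quotient g s 0 z.
  by move=> zs; rewrite /g1 /quotient (introF eqP zs).
have g1B z : rnorm z < 2 -> rnorm (g1 z) <= `|B1| + rnorm l.
  move=> z2; have [->|/eqP zs] := eqVneq z s; first by rewrite g1s lerDr.
  rewrite g1E // /quotient (introF eqP zs) (le_trans (q1B z z2 zs)) //.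
  by rewrite (le_trans (ler_norm _)) // lerDl rnorm_ge0.
have g1L z : rnorm (z - s) < r1 -> z <> s -> rnorm (g1 z - l) <= L * rnorm (z - s).
  by move=> zr zs; rewrite g1E //; exact: q1L.
have g1d z : rnorm z < 2 -> z <> s -> differentiable g1 z.
  by move=> z2 zs; apply: differentiable_quotient zs; exact: (proj1 (gM z z2)).
have [B2 q2B] := bounded_off g1 l L r1 _ r10 g1L g1B.
have [||l2 [L2 [r2 [r20 q2L]]]] := @removable_limit _ (quotient g1 s 0) s B2 sin.
- by move=> w w2 ws; apply: differentiable_quotient (ws); exact: g1d.
- by move=> w w2 ws; rewrite /quotient (introF eqP ws) g1s; exact: q2B.
exists g1, (`|B1| + rnorm l); split; last first.
  move=> z; rewrite /g1 /quotient; case: eqP => [->|/eqP zs].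
    by rewrite subrr mul0r addr0.
  by rewrite mulrC divfK ?subr_eq0 // addrC subrK.
move=> w w2; split; last exact: g1B.
have [->|/eqP ws] := eqVneq w s; last exact: g1d.
apply/differentiable_lineP; exists l2 => e e0.
have L20 : 0 < `|L2| + 1 by rewrite ltr_wpDl.
exists (Num.min r2 (e / (`|L2| + 1))); first by rewrite lt_min r20 divr_gt0.
move=> h; rewrite lt_min ltr_pdivlMr // => /andP[hr he].
have [->|h0] := eqVneq h 0; first by rewrite addr0 mulr0 subrr subr0 rnorm0 mulr0.
have shs : s + h <> s by move=> /eqP; rewrite -subr_eq0 addrC addKr; exact/negP.
have shE : s + h - s = h by rewrite addrC addKr.
have := q2L (s + h); rewrite shE /quotient (introF eqP shs) g1s shE => /(_ hr shs) H.
have -> : g1 (s + h) - l - l2 * h = h * ((g1 (s + h) - l) / h - l2).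
  by rewrite mulrBr mulrCA divff // mulr1 (mulrC h).
rewrite rnormM mulrC ler_wpM2r ?rnorm_ge0 // (le_trans H) //.
apply: le_trans (ltW he); rewrite mulrC ler_wpM2l ?rnorm_ge0 //.
by rewrite (le_trans (ler_norm _)) // lerDl.
Qed.

Lemma division_bound g M s g1 : in_square s -> (forall z, g z = g s + (z - s) * g1 z) ->
  hol_bounded g M -> (forall w, rnorm w < 2 -> differentiable g1 w) -> s = 0 ->
  forall z, in_square z -> rnorm (g1 z) <= 2 * M.
Proof.
move=> sin gE gM g1d s0 z zin; apply: max_square zin => // w we.
have w1 := on_square_edges_ge1 we.
have w2 : rnorm w < 2 by apply: rnorm_square; case: we.
have : rnorm (g w - g s) <= 2 * M.
  rewrite (le_trans (rnormDB _ _)) // mulr_natl mulr2n lerD //; first exact: (proj2 (gM w w2)).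
  by apply: (proj2 (gM s _)); exact: in_square_lt2.
rewrite gE addrC addKr rnormM s0 subr0; apply: le_trans.
by rewrite ler_peMl ?rnorm_ge0.
Qed.

Lemma in_square0 : in_square (0 : R[i]).
Proof. by apply: rnorm_lt1_square; rewrite rnorm0. Qed.

(** Second order Taylor estimate at the centre of a disc. *)
Lemma taylor2_unit g M : hol_bounded g M -> exists D : R[i],
  [/\ rnorm D <= 2 * M,
    forall z, rnorm z < 1 -> rnorm (g z - g 0) <= 2 * M * rnorm z &
    forall z, rnorm z < 2^-1 -> rnorm (g z - g 0 - D * z) <= 16 * M * rnorm z ^+ 2].
Proof.
move=> gM; have [g1 [B1 [g1B g1E]]] := division gM in_square0.
have M0 := hol_bounded_ge0 gM.
have g1d w : rnorm w < 2 -> differentiable g1 w by move=> /g1B[].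
have g1M := division_bound in_square0 g1E gM g1d (erefl _).
pose k z := g1 (2^-1 * z).
have half2 : rnorm (2^-1 : R[i]) = 2^-1.
  by rewrite rnormV rnorm_nat.
have kM : hol_bounded k (2 * M).
  move=> w w2; have w1 : rnorm (2^-1 * w) < 1 by rewrite rnormM half2; lra.
  split; last by apply: g1M; exact: rnorm_lt1_square.
  apply: (@differentiable_comp _ _ _ _ (fun w => 2^-1 * w) g1).
    by apply: differentiableM => //; exact: differentiable_cst.
  by apply: (proj1 (g1B _ _)); lra.
have [k1 [B2 [k1B k1E]]] := division kM in_square0.
have k1d w : rnorm w < 2 -> differentiable k1 w by move=> /k1B[].
have k1M := division_bound in_square0 k1E kM k1d (erefl _).
exists (g1 0); split.
- exact: g1M in_square0.
- move=> z z1; rewrite g1E addrC addKr subr0 rnormM mulrC ler_wpM2r ?rnorm_ge0 //.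
  by apply: g1M; exact: rnorm_lt1_square.
- move=> z zh; have -> : g z - g 0 - g1 0 * z = 2 * z ^+ 2 * k1 (2 * z).
    have e1 : g1 z = g1 0 + 2 * z * k1 (2 * z).
      by have := k1E (2 * z); rewrite subr0 /k mulr0 mulrA mulVf ?mul1r // pnatr_eq0.
    by rewrite (g1E z) subr0 e1; ring.
  have r2 : rnorm (2 : R[i]) = 2.
    exact: rnorm_nat.
  rewrite rnormM (rnormM 2) rnormX r2 mulrAC ler_wpM2r ?exprn_ge0 ?rnorm_ge0 //.
  have : rnorm (k1 (2 * z)) <= 2 * (2 * M).
    by apply: k1M; apply: rnorm_lt1_square; rewrite rnormM r2; lra.
  by lra.
Qed.

(** The quotients [(g z - g 0) / z] form a Lipschitz family, a property that passes
    to pointwise limits and to integrals. *)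
Lemma three_point_unit g M : hol_bounded g M ->
  forall z w, rnorm z < 2^-1 -> rnorm w < 2^-1 -> z != 0 -> w != 0 ->
  rnorm ((g z - g 0) / z - (g w - g 0) / w) <= 16 * M * (rnorm z + rnorm w).
Proof.
move=> gM z w zh wh z0 w0; have [D [_ _ DP]] := taylor2_unit gM.
have key v : rnorm v < 2^-1 -> v != 0 -> rnorm ((g v - g 0) / v - D) <= 16 * M * rnorm v.
  move=> vh v0; have vp : 0 < rnorm v by exact: rnorm_gt0.
  rewrite -(ler_pM2r vp) -rnormM mulrBl divfK // -(mulrA (16 * M)) -expr2; exact: DP.
apply: le_trans (rnorm_tri D _ _) _; rewrite mulrDr lerD ?key //.
by rewrite rnormB key.
Qed.

End division.

(** * Interpolation at roots of unity *)

Section seq_bounds.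
Variables (R : realType) (T : eqType).
Implicit Types (s : seq T) (F : T -> R) (c : R).

Lemma sum_le_size s F c : (forall t, t \in s -> F t <= c) ->
  \sum_(t <- s) F t <= (size s)%:R * c.
Proof.
elim: s => [|t s ih] h; first by rewrite big_nil mul0r.
rewrite big_cons /= -natr1 addrC mulrDl mul1r lerD //; last by apply: h; rewrite mem_head.
by apply: ih => u us; apply: h; rewrite in_cons us orbT.
Qed.

Lemma prod_le_exp s F c : (forall t, t \in s -> 0 <= F t <= c) ->
  \prod_(t <- s) F t <= c ^+ size s.
Proof.
elim: s => [|t s ih] h; first by rewrite big_nil expr0.
have /andP[Ft0 Ftc] : 0 <= F t <= c by apply: h; rewrite mem_head.
have h' u : u \in s -> 0 <= F u <= c by move=> us; apply: h; rewrite in_cons us orbT.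
rewrite big_cons /= exprS ler_pM //; last exact: ih.
by rewrite big_seq prodr_ge0 // => u /h' /andP[].
Qed.

Lemma exp_le_prod s F c : 0 <= c -> (forall t, t \in s -> c <= F t) ->
  c ^+ size s <= \prod_(t <- s) F t.
Proof.
move=> c0; elim: s => [|t s ih] h; first by rewrite big_nil expr0.
rewrite big_cons /= exprS ler_pM ?exprn_ge0 //; first by apply: h; rewrite mem_head.
by apply: ih => u us; apply: h; rewrite in_cons us orbT.
Qed.

End seq_bounds.

Section differentiable_big.
Variables (R : realType) (V : normedModType R[i]) (I : Type).
Implicit Types (s : seq I) (F : I -> V -> R[i]).

Lemma differentiable_bigsum s F x : (forall i, differentiable (F i) x) ->
  differentiable (fun w => \sum_(i <- s) F i w) x.
Proof.
move=> Fx; elim: s => [|i s ih].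
  by under eq_fun do rewrite big_nil; exact: differentiable_cst.
by under eq_fun do rewrite big_cons; exact: (differentiableD (Fx i) ih).
Qed.

Lemma differentiable_bigprod s F x : (forall i, differentiable (F i) x) ->
  differentiable (fun w => \prod_(i <- s) F i w) x.
Proof.
move=> Fx; elim: s => [|i s ih].
  by under eq_fun do rewrite big_nil; exact: differentiable_cst.
by under eq_fun do rewrite big_cons; exact: (differentiableM (Fx i) ih).
Qed.

End differentiable_big.

Section interpolation.
Variable R : realType.
Implicit Types (g h : R[i] -> R[i]) (t z w : R[i]) (s : seq R[i]) (M e rho : R).

Lemma rnorm_prod (I : Type) (s : seq I) (F : I -> R[i]) :
  rnorm (\prod_(t <- s) F t) = \prod_(t <- s) rnorm (F t).
Proof. by elim/big_rec2: _ => [|i x y _ <-]; rewrite ?rnorm1 ?rnormM. Qed.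

Lemma divide_by_nodes s : uniq s -> (forall t, t \in s -> in_square t) ->
  forall h M, hol_bounded h M -> (forall t, t \in s -> h t = 0) ->
  exists h1 B, hol_bounded h1 B /\ forall z, h z = \prod_(t <- s) (z - t) * h1 z.
Proof.
elim: s => [|t s ih] /=.
  by move=> _ _ h M hM _; exists h, M; split=> // z; rewrite big_nil mul1r.
move=> /andP[ts us] sin h M hM h0.
have tin : in_square t by apply: sin; rewrite mem_head.
have [k [B [kB kE]]] := division hM tin.
have ht : h t = 0 by apply: h0; rewrite mem_head.
have [| |h1 [B1 [h1B h1E]]] := ih us _ k B kB.
- by move=> u us'; apply: sin; rewrite in_cons us' orbT.
- move=> u us'; have := kE u; rewrite h0 ?in_cons ?us' ?orbT // ht add0r => /esym/eqP.
  rewrite mulf_eq0 subr_eq0 => /orP[/eqP ut|/eqP //].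
  by move: ts; rewrite -ut us'.
by exists h1, B1; split=> // z; rewrite kE ht add0r h1E big_cons mulrA.
Qed.

(** The derivative of X^N - rho^N at a root [t] is the product of the distances from
    [t] to the other roots, which is therefore N rho^(N-1) in modulus. *)
Lemma roots_of_rho m rho : 0 < rho -> exists s : seq R[i],
  [/\ size s = m.+1, uniq s, forall t, t \in s -> rnorm t = rho &
    forall t, t \in s -> rnorm (\prod_(u <- rem t s) (t - u)) = m.+1%:R * rho ^+ m].
Proof.
move=> rho0; pose a : R[i] := rho%:C ^+ m.+1; pose P : {poly R[i]} := 'X^(m.+1) - a%:P.
have P_monic : P \is monic by exact: monicXnsubC.
have [s sE] := closed_field_poly_normal P.
rewrite (eqP P_monic) scale1r in sE.
have roots t : t \in s -> t ^+ m.+1 = a.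
  move=> ts; have : root P t by rewrite sE root_prod_XsubC.
  by rewrite /root /P !hornerE subr_eq0 => /eqP.
have rt t : t \in s -> rnorm t = rho.
  move=> /roots /(congr1 (@rnorm _ _)); rewrite /a !rnormX rnorm_real gtr0_norm // => h.
  by apply/eqP; rewrite -(@eqrXn2 _ m.+1) ?rnorm_ge0 ?h // ltW.
have dt t : t \in s -> rnorm (\prod_(u <- rem t s) (t - u)) = m.+1%:R * rho ^+ m.
  move=> ts; have PE : P = ('X - t%:P) * \prod_(u <- rem t s) ('X - u%:P).
    by rewrite sE (perm_big _ (perm_to_rem ts)) big_cons.
  have : P^`().[t] = \prod_(u <- rem t s) (t - u).
    rewrite PE derivM derivXsubC mul1r !hornerE subrr mul0r addr0 horner_prod.
    by apply: eq_bigr => u _; rewrite !hornerE.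
  move=> <-; rewrite /P derivB derivC subr0 derivXn hornerMn hornerXn -mulr_natl.
  by rewrite rnormM rnormX (rt t ts) rnorm_nat.
have mrho0 : 0 < m.+1%:R * rho ^+ m :> R by rewrite mulr_gt0 ?exprn_gt0.
exists s; split=> //.
  by apply: succn_inj; rewrite -(size_prod_XsubC s id) -sE size_XnsubC.
apply: count_mem_uniq => t; have [ts|ts] := boolP (t \in s); last by apply/count_memPn.
rewrite (permP (perm_to_rem ts)) /= eqxx; apply/eqP; rewrite eqSS; apply/eqP/count_memPn.
apply/negP => tr; have := dt t ts; rewrite (perm_big _ (perm_to_rem tr)) big_cons.
rewrite subrr rnormM rnorm0 mul0r.
by move=> h0; move: mrho0; rewrite -h0 ltxx.
Qed.

(** Subtracting the Lagrange interpolation polynomial reduces the claim to a function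
    that vanishes at all nodes; dividing it by the node polynomial and applying the
    maximum principle to the quotient gives the factor (4 rho)^N. *)
Lemma interpolation N rho : 0 < rho -> rho <= 2^-1 -> exists s : seq R[i],
  [/\ size s = N, forall t, t \in s -> rnorm t <= rho &
  forall g M e, hol_bounded g M -> 0 <= e -> (forall t, t \in s -> rnorm (g t) <= e) ->
  forall z, rnorm z <= rho -> rnorm (g z) <= (4 * rho) ^+ N * M + 16 ^+ N * e].
Proof.
move=> rho0 rhoh; case: N => [|m].
  exists [::]; split=> // g M e gM e0 _ z zr; rewrite !expr0 !mul1r.
  by rewrite (le_trans (proj2 (gM z _))) ?lerDl //; lra.
have [s [ss us rs ds]] := roots_of_rho m rho0.
exists s; split=> // [t /rs -> //|g M e gM e0 ge z zr].
pose c t := \prod_(u <- rem t s) (t - u).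
pose E t w := \prod_(u <- rem t s) (w - u).
pose h w := g w - \sum_(t <- s) g t * (E t w / c t).
have m0 : 0 < m.+1%:R * rho ^+ m :> R by rewrite mulr_gt0 ?exprn_gt0.
have c0 t : t \in s -> c t != 0.
  by move=> ts; apply/eqP => ct0; have := ds t ts; rewrite -/(c t) ct0 rnorm0 => h0; rewrite h0 ltxx in m0.
have sin t : t \in s -> in_square t.
  by move=> /rs tr; apply: rnorm_lt1_square; rewrite tr; lra.
have sr t : t \in s -> size (rem t s) = m by move=> ts; rewrite size_rem // ss.
have Lagr C w : 0 <= C -> (forall u, u \in s -> rnorm (w - u) <= C) ->
    rnorm (\sum_(t <- s) g t * (E t w / c t)) <= e * (C / rho) ^+ m.
  move=> C0 wC; apply: le_trans (rnorm_sum _ _ _) _.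
  apply: le_trans (@sum_le_size _ _ s _ (e * (C ^+ m / (m.+1%:R * rho ^+ m))) _) _.
    move=> t ts; rewrite rnormM ler_pM ?rnorm_ge0 //; first exact: ge.
    rewrite rnormM rnormV ds //.
    rewrite ler_wpM2r ?invr_ge0 ?(ltW m0) // /E rnorm_prod -(sr t ts).
    by apply: prod_le_exp => u /mem_rem us'; rewrite rnorm_ge0 wC.
  rewrite ss expr_div_n le_eqVlt; apply/orP; left; apply/eqP; field.
  by rewrite expf_neq0 ?gt_eqF //= addrC natr1 pnatr_eq0.
have hB C : 0 <= C -> (forall w, rnorm w < 2 -> forall u, u \in s -> rnorm (w - u) <= C) ->
   hol_bounded h (M + e * (C / rho) ^+ m).
  move=> C0 wC w w2; split; last first.
    by rewrite (le_trans (rnormDB _ _)) // lerD ?Lagr // ?(proj2 (gM w w2)) // => u; exact: wC.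
  apply: differentiableB; first exact: (proj1 (gM w w2)).
  apply: differentiable_bigsum => t.
  apply: differentiableM; first exact: differentiable_cst.
  apply: differentiableM; last exact: differentiable_cst.
  apply: differentiable_bigprod => u.
  by apply: differentiableB => //; exact: differentiable_cst.
have s4 w u : rnorm w < 2 -> u \in s -> rnorm (w - u) <= 4.
  by move=> w2 /rs ur; rewrite (le_trans (rnormDB _ _)) // ur; lra.
have h4 : hol_bounded h (M + e * (4 / rho) ^+ m).
  by apply: hB => // w w2 u; exact: s4.
have hs t : t \in s -> h t = 0.
  move=> ts; rewrite /h (perm_big _ (perm_to_rem ts)) big_cons /= -/(E t t) /E divff ?c0 //.
  rewrite mulr1 big_seq big1 ?addr0 ?subrr // => u ur.
  have ut : t \in rem u s.
    rewrite mem_rem_uniq // inE ts andbT; apply: contraTneq ur => ->.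
    by rewrite mem_rem_uniq // inE eqxx.
  have Eut : E u t = 0 by rewrite /E (perm_big _ (perm_to_rem ut)) big_cons /= subrr mul0r.
  by rewrite -/(E u t) Eut mul0r mulr0.
have [h1 [B [h1B h1E]]] := divide_by_nodes us sin h4 hs.
have A0 : 0 <= M + e * (4 / rho) ^+ m.
  by apply: (@hol_bounded_ge0 _ h); exact: h4.
have h1z : rnorm (h1 z) <= (M + e * (4 / rho) ^+ m) * 2 ^+ m.+1.
  apply: max_square => [w /h1B[//]|w we|]; last by apply: rnorm_lt1_square; lra.
  have w1 := on_square_edges_ge1 we; have w2 : rnorm w < 2 by apply: rnorm_square; case: we.
  have [_] := h4 w w2; rewrite h1E rnormM => hw.
  have : 2^-1 ^+ m.+1 <= rnorm (\prod_(t <- s) (w - t)).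
    rewrite rnorm_prod -ss; apply: exp_le_prod => // t /rs tr.
    by have := rnormD (w - t) t; rewrite subrK tr; lra.
  move=> /(ler_wpM2r (rnorm_ge0 (h1 w))) /le_trans /(_ hw).
  by rewrite exprVn mulrC ler_pdivrMr ?exprn_gt0.
have hz : rnorm (h z) <= (4 * rho) ^+ m.+1 * (M + e * (4 / rho) ^+ m).
  rewrite h1E rnormM.
  apply: (@le_trans _ _ ((2 * rho) ^+ m.+1 * ((M + e * (4 / rho) ^+ m) * 2 ^+ m.+1))).
    rewrite ler_pM ?rnorm_ge0 // rnorm_prod -ss; apply: prod_le_exp => t /rs tr.
    by rewrite rnorm_ge0 (le_trans (rnormDB _ _)) // tr; lra.
  by rewrite mulrCA mulrC -exprMn (_ : 2 * rho * 2 = 4 * rho) //; ring.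
have gz : g z = h z + \sum_(t <- s) g t * (E t z / c t) by rewrite /h subrK.
have lz : rnorm (\sum_(t <- s) g t * (E t z / c t)) <= e * (2 * rho / rho) ^+ m.
  apply: Lagr; first by rewrite mulr_ge0 // ltW.
  by move=> u /rs ur; rewrite (le_trans (rnormDB _ _)) // ur; lra.
rewrite gz (le_trans (rnormD _ _)) // (le_trans (lerD hz lz)) //.
rewrite mulrDr -addrA lerD2l mulrCA -mulrDr mulrC ler_wpM2r //.
rewrite mulfK ?gt_eqF //.
have -> : (4 * rho) ^+ m.+1 * (4 / rho) ^+ m = 4 * rho * 16 ^+ m.
  rewrite exprS -mulrA -exprMn (_ : 4 * rho * (4 / rho) = 16) //.
  by field; rewrite gt_eqF.
have h16 : 2 ^+ m <= 16 ^+ m :> R by rewrite lerXn2r ?nnegrE //; lra.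
have h160 : 0 <= 16 ^+ m :> R by rewrite exprn_ge0.
have : 4 * rho * 16 ^+ m <= 2 * 16 ^+ m by rewrite ler_wpM2r //; lra.
rewrite exprS => h3; lra.
Qed.

End interpolation.

(** * Holomorphic functions of several variables *)

Section several_variables.
Variables (R : realType) (V : normedModType R[i]).
Implicit Types (f F : V -> R[i]) (a x v w : V) (r M : R).

(** Being complex differentiable on every complex line and bounded, on a ball. *)
Definition line_hol f a r M := forall w, rnorm (w - a) < r ->
  rnorm (f w) <= M /\ forall v, differentiable (fun t : R[i] => f (w + t *: v)) 0.

Lemma line_hol_sub f a r M x s : line_hol f a r M -> rnorm (x - a) + s <= r ->
  line_hol f x s M.
Proof.
move=> fa xs w wx; apply: fa; apply: le_lt_trans (rnorm_tri x _ _) _.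
by rewrite addrC; apply: lt_le_trans xs; rewrite ltrD2l.
Qed.

Lemma line_hol_ge0 f a r M : 0 < r -> line_hol f a r M -> 0 <= M.
Proof.
move=> r0 /(_ a); rewrite subrr rnorm0 => /(_ r0)[h _].
exact: le_trans (rnorm_ge0 _) h.
Qed.

Lemma differentiable_shift_scale (g : R[i] -> R[i]) (c z : R[i]) :
  differentiable g 0 -> differentiable (fun t => g (c * (t - z))) z.
Proof.
move=> g0; apply: (@differentiable_comp _ _ _ _ (fun t => c * (t - z)) g).
  exact: (differentiableM (differentiable_cst c z) (differentiable_subr z z)).
by rewrite subrr mulr0.
Qed.

Lemma line_hol_unit f a r M u : 0 < r -> line_hol f a r M -> rnorm u <= 1 ->
  hol_bounded (fun t => f (a + ((r / 2)%:C * t) *: u)) M.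
Proof.
move=> r0 fa u1 t t2.
have r2 : 0 < r / 2 by rewrite divr_gt0.
have inball : rnorm (a + ((r / 2)%:C * t) *: u - a) < r.
  rewrite addrC addKr rnormZ rnormM rnorm_real gtr0_norm //.
  apply: (@le_lt_trans _ _ (r / 2 * rnorm t)).
    by rewrite ler_piMr // mulr_ge0 ?rnorm_ge0 // ltW.
  by rewrite mulrAC ltr_pdivrMr // ltr_pM2l.
have [fM fd] := fa _ inball; split; last exact: fM.
have := differentiable_shift_scale (r / 2)%:C t (fd u).
set F := (X in differentiable X t); set G := (X in _ -> differentiable X t).
suff -> : F = G by [].
apply/funext => s; rewrite /F /G; congr f.
by rewrite -addrA -scalerDl mulrBr addrCA subrr addr0.
Qed.

Lemma taylor2 f a r M v : 0 < r -> line_hol f a r M -> exists D : R[i],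
  [/\ rnorm D <= 4 * M / r * rnorm v,
   forall t : R[i], rnorm t * rnorm v < r / 2 ->
     rnorm (f (a + t *: v) - f a) <= 4 * M / r * rnorm v * rnorm t &
   forall t : R[i], rnorm t * rnorm v < r / 4 ->
     rnorm (f (a + t *: v) - f a - D * t) <= 64 * M / r ^+ 2 * rnorm v ^+ 2 * rnorm t ^+ 2].
Proof.
move=> r0 fa; have M0 := line_hol_ge0 r0 fa.
have r2 : 0 < r / 2 by rewrite divr_gt0.
have [->|v0] := eqVneq v 0.
  exists 0; rewrite (@rnorm0 _ V) !mulr0; split=> [|t _|t _]; first by rewrite rnorm0.
    by rewrite scaler0 addr0 subrr rnorm0 mul0r.
  by rewrite scaler0 addr0 subrr mul0r subr0 rnorm0 expr0n /= !mulr0 mul0r.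
have vp : 0 < rnorm v by exact: rnorm_gt0.
have vC0 : (rnorm v)%:C != 0 :> R[i] by rewrite eq_complex /= eqxx andbT gt_eqF.
have rC0 : (r / 2)%:C != 0 :> R[i] by rewrite eq_complex /= eqxx andbT gt_eqF.
pose u := (rnorm v)%:C^-1 *: v.
have u1 : rnorm u <= 1.
  by rewrite rnormZ rnormV rnorm_real gtr0_norm // mulVf // gt_eqF.
have [D [D1 D2 D3]] := taylor2_unit (line_hol_unit r0 fa u1).
pose k : R[i] := (rnorm v)%:C / (r / 2)%:C.
have kE : rnorm k = 2 / r * rnorm v.
  rewrite rnormM rnormV !rnorm_real !gtr0_norm //.
  by field; rewrite gt_eqF.
have line (t : R[i]) : a + t *: v = a + ((r / 2)%:C * (k * t)) *: u.
  congr (a + _); rewrite /u /k scalerA; congr (_ *: v).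
  rewrite [RHS](_ : _ = ((r / 2)%:C / (r / 2)%:C) * ((rnorm v)%:C / (rnorm v)%:C) * t).
    by rewrite !divff // !mul1r.
  by ring.
have base : a + ((r / 2)%:C * 0) *: u = a by rewrite mulr0 scale0r addr0.
have ktE (t : R[i]) : 2 / r * rnorm v * rnorm t = rnorm t * rnorm v / (r / 2).
  by field; rewrite gt_eqF.
exists (D * k); split.
- rewrite rnormM kE (_ : _ * rnorm v = 2 * M * (2 / r * rnorm v)).
    by rewrite ler_wpM2r // mulr_ge0 ?rnorm_ge0 // divr_ge0 // ltW.
  by field; rewrite gt_eqF.
- move=> t tv; have := D2 (k * t); rewrite -line base rnormM kE => /(_ _) h.
  apply: le_trans (h _) _.
    by rewrite ktE ltr_pdivrMr // mul1r.
  by rewrite le_eqVlt; apply/orP; left; apply/eqP; field; rewrite gt_eqF.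
- move=> t tv; have := D3 (k * t); rewrite -line base mulrA rnormM kE => /(_ _) h.
  apply: le_trans (h _) _.
    by rewrite ktE ltr_pdivrMr //; lra.
  by rewrite le_eqVlt; apply/orP; left; apply/eqP; field; rewrite gt_eqF.
Qed.

Lemma line_hol_lipschitz f a r M v : 0 < r -> line_hol f a r M -> rnorm v < r / 2 ->
  rnorm (f (a + v) - f a) <= 4 * M / r * rnorm v.
Proof.
move=> r0 fa vr; have [D [_ h _]] := taylor2 v r0 fa.
by have := h 1; rewrite rnorm1 mul1r mulr1 scale1r; apply.
Qed.

(** Difference quotients at [x] in direction [v]. *)
Definition dquot f x v (t : R[i]) : R[i] := (f (x + t *: v) - f x) / t.

Definition three_point f a r M :=
  (forall w, rnorm (w - a) < r -> rnorm (f w) <= M) /\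
  forall x s v (t t' : R[i]), 0 < s -> rnorm (x - a) + s <= r -> t != 0 -> t' != 0 ->
    rnorm t * rnorm v < s / 4 -> rnorm t' * rnorm v < s / 4 ->
    rnorm (dquot f x v t - dquot f x v t') <=
      64 * M / s ^+ 2 * rnorm v ^+ 2 * (rnorm t + rnorm t').

Lemma dquot_near f x v (D t : R[i]) (C : R) : t != 0 ->
  rnorm (f (x + t *: v) - f x - D * t) <= C * rnorm t ^+ 2 <->
  rnorm (dquot f x v t - D) <= C * rnorm t.
Proof.
move=> t0; have tp : 0 < rnorm t by exact: rnorm_gt0.
by rewrite -(ler_pM2r tp (rnorm (dquot _ _ _ _ - _))) -rnormM mulrBl divfK // -(mulrA C) -expr2.
Qed.

Lemma line_hol_three_point f a r M : line_hol f a r M -> three_point f a r M.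
Proof.
move=> fa; split=> [w /fa[]//|x s v t t' s0 xs t0 t'0 ts t's].
have [D [_ _ h]] := taylor2 v s0 (line_hol_sub fa xs).
have h1 := (dquot_near f x v D _ t0).1 (h _ ts).
have h2 := (dquot_near f x v D _ t'0).1 (h _ t's).
by rewrite (le_trans (rnorm_tri D _ _)) // mulrDr lerD // rnormB.
Qed.

Lemma three_point_line_hol f a r M : three_point f a r M -> line_hol f a r M.
Proof.
move=> [fM f3] w wa; split=> [|v]; first exact: fM.
pose s := r - rnorm (w - a); have s0 : 0 < s by rewrite subr_gt0.
have ws : rnorm (w - a) + s <= r by rewrite addrC subrK.
have M0 : 0 <= M by exact: le_trans (rnorm_ge0 _) (fM _ wa).
set C := 64 * M / s ^+ 2 * rnorm v ^+ 2.
have C0 : 0 <= C by rewrite !mulr_ge0 ?invr_ge0 ?exprn_ge0 ?rnorm_ge0 // ltW.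
pose d := s / 4 / (rnorm v + 1).
have v1 : 0 < rnorm v + 1 by rewrite ltr_wpDl // rnorm_ge0.
have d0 : 0 < d by rewrite !divr_gt0.
have dP (t : R[i]) : rnorm t < d -> rnorm t * rnorm v < s / 4.
  rewrite ltr_pdivlMr // => h; apply: le_lt_trans h.
  by rewrite ler_wpM2l ?rnorm_ge0 // lerDl.
have q3 (t t' : R[i]) : t != 0 -> t' != 0 -> rnorm t < d -> rnorm t' < d ->
    rnorm (dquot f w v t - dquot f w v t') <= C * (rnorm t + rnorm t').
  by move=> t0 t'0 /dP td /dP t'd; exact: f3.
pose h k : R[i] := (d / k.+2%:R)%:C.
have rh k : rnorm (h k) = d / k.+2%:R by rewrite rnorm_real ger0_norm // divr_ge0 // ltW.
have hd k : rnorm (h k) < d by rewrite rh ltr_pdivrMr // ltr_pMr // ltr1n.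
have h0 k : h k != 0 by rewrite eq_complex /= eqxx andbT gt_eqF // divr_gt0.
have small (e : R) : 0 < e -> exists N, forall n, (N <= n)%N -> C * rnorm (h n) < e.
  move=> e0; have C1 : 0 < C + 1 by rewrite ltr_wpDl.
  exists (Num.bound ((C + 1) * d / e)) => n Nn.
  apply: (@le_lt_trans _ _ ((C + 1) * rnorm (h n))).
    by rewrite ler_wpM2r ?rnorm_ge0 // lerDl.
  rewrite rh mulrA ltr_pdivrMr // (mulrC e) -ltr_pdivrMr //.
  apply: lt_le_trans (archi_boundP _) _; first by apply: divr_ge0; [apply: mulr_ge0|]; exact: ltW.
  by rewrite ler_nat (leq_trans Nn) // -addn2 leq_addr.
have [|D DP] := @complex_cauchy_seq _ (fun k => dquot f w v (h k)).
  move=> e e0; have [|N NP] := small (e / 2); first by rewrite divr_gt0.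
  exists N => n Nn; apply: le_lt_trans (q3 _ _ (h0 _) (h0 _) (hd _) (hd _)) _.
  by rewrite mulrDr (splitr e) ltrD // NP.
have qD (t : R[i]) : t != 0 -> rnorm t < d -> rnorm (dquot f w v t - D) <= C * rnorm t.
  move=> t0 td; apply/ler_addgt0Pr => e e0; have e2 : 0 < e / 2 by rewrite divr_gt0.
  have [N1 P1] := DP _ e2; have [N2 P2] := small _ e2; set k := maxn N1 N2.
  have p1 := P1 k (leq_maxl _ _); have p2 := P2 k (leq_maxr _ _).
  rewrite (le_trans (rnorm_tri (dquot f w v (h k)) _ _)) // (splitr e) addrA lerD ?(ltW p1) //.
  by rewrite (le_trans (q3 _ _ t0 (h0 _) td (hd _))) // mulrDr lerD2l ltW.
apply/differentiable_lineP; exists D => e e0.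
have C1 : 0 < C + 1 by rewrite ltr_wpDl.
exists (Num.min d (e / (C + 1))); first by rewrite lt_min d0 divr_gt0.
move=> t; rewrite lt_min => /andP[td]; rewrite ltr_pdivlMr // => te; rewrite add0r scale0r addr0.
have [->|t0] := eqVneq t 0; first by rewrite scale0r addr0 mulr0 subrr subr0 rnorm0 mulr0.
have /le_trans := (dquot_near f w v D C t0).2 (qD t t0 td); apply.
rewrite expr2 mulrA ler_wpM2r ?rnorm_ge0 // (le_trans _ (ltW te)) // mulrC.
by rewrite ler_wpM2l ?rnorm_ge0 // lerDl.
Qed.

End several_variables.

Section gateaux_frechet.
Variables (R : realType) (V : normedModType R[i]).
Implicit Types (f F : V -> R[i]) (a x v w : V) (r M : R).

Lemma differentiable_line f w v : differentiable f w ->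
  differentiable (fun t : R[i] => f (w + t *: v)) 0.
Proof.
move=> fw; apply: (@differentiable_comp _ _ _ _ (fun t : R[i] => w + t *: v) f).
  apply: differentiableD; first exact: differentiable_cst.
  apply: differentiableZl; exact: differentiable_idC.
by rewrite scale0r addr0.
Qed.

Lemma differentiable_line_hol f a r M :
  (forall w, rnorm (w - a) < r -> rnorm (f w) <= M /\ differentiable f w) ->
  line_hol f a r M.
Proof.
move=> h w /h[fM fd]; split; first exact: fM.
by move=> v; exact: differentiable_line.
Qed.

Lemma derive_eq f a v (D : R[i]) :
  (forall e : R, 0 < e -> exists2 s : R, 0 < s & forall t : R[i], rnorm t < s ->
    rnorm (f (a + t *: v) - f a - D * t) <= e * rnorm t) -> 'D_v f a = D.
Proof.
move=> h; apply: cvg_lim => // A /nbhs_rnormP[e e0 eA].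
have e2 : 0 < e / 2 by rewrite divr_gt0.
have [s s0 hs] := h _ e2; apply/nbhs_rnormP; exists s => // t; rewrite subr0 => ts t0.
apply: eA; have tp : 0 < rnorm t by exact: rnorm_gt0.
rewrite /= (_ : _ - D = (f (a + t *: v) - f a - D * t) / t).
  by rewrite rnormM rnormV ltr_pdivrMr // (le_lt_trans (hs t ts)) // ltr_pM2r //; lra.
rewrite [in RHS]mulrBl mulfK // (addrC a) mulrC; congr (_ - _).
Qed.

Lemma derive_eq_quadratic f a v (D : R[i]) (C s : R) : 0 < s ->
  (forall t : R[i], rnorm t < s ->
    rnorm (f (a + t *: v) - f a - D * t) <= C * rnorm t ^+ 2) -> 'D_v f a = D.
Proof.
move=> s0 h; apply: derive_eq => e e0; have C1 : 0 < `|C| + 1 by rewrite ltr_wpDl.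
exists (Num.min s (e / (`|C| + 1))); first by rewrite lt_min s0 divr_gt0.
move=> t; rewrite lt_min => /andP[ts]; rewrite ltr_pdivlMr // => te.
apply: le_trans (h t ts) _.
rewrite expr2 mulrA ler_wpM2r ?rnorm_ge0 // (le_trans _ (ltW te)) // mulrC.
by rewrite ler_wpM2l ?rnorm_ge0 // (le_trans (ler_norm _)) // lerDl.
Qed.

Lemma taylor2_derive f a r M v : 0 < r -> line_hol f a r M ->
  [/\ rnorm ('D_v f a) <= 4 * M / r * rnorm v &
   forall t : R[i], rnorm t * rnorm v < r / 4 ->
     rnorm (f (a + t *: v) - f a - 'D_v f a * t) <= 64 * M / r ^+ 2 * rnorm v ^+ 2 * rnorm t ^+ 2].
Proof.
move=> r0 fa; have [D [D1 D2 D3]] := taylor2 v r0 fa.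
have M0 := line_hol_ge0 r0 fa.
have -> : 'D_v f a = D; last by split.
have v1 : 0 < rnorm v + 1 by rewrite ltr_wpDl // rnorm_ge0.
apply: (@derive_eq_quadratic _ _ _ _ _ (r / 4 / (rnorm v + 1))) => [|t].
  by rewrite !divr_gt0.
rewrite ltr_pdivlMr // => tv; apply: D3; apply: le_lt_trans tv.
by rewrite ler_wpM2l ?rnorm_ge0 // lerDl.
Qed.

Lemma line_derivable f a v : differentiable (fun t : R[i] => f (a + t *: v)) 0 ->
  derivable f a v.
Proof.
move=> h; apply/derivable1P/derivable1_diffP; move: h.
rewrite (_ : (fun t : R[i] => f (a + t *: v)) = (fun t : R[i] => f (t *: v + a))) //.
by apply/funext => t; rewrite addrC.
Qed.

Lemma derive_translate f a v b : 'D_v (fun x => f (x + b)) a = 'D_v f (a + b).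
Proof. by rewrite /derive; under eq_fun do rewrite /= -addrA. Qed.

Lemma line_holB f g a r M N : line_hol f a r M -> line_hol g a r N ->
  line_hol (fun x => f x - g x) a r (M + N).
Proof.
move=> fa ga w wa; have [fM fd] := fa w wa; have [gN gd] := ga w wa.
split; first by rewrite (le_trans (rnormDB _ _)) // lerD.
by move=> v; exact: (differentiableB (fd v) (gd v)).
Qed.

Lemma line_hol_translate f a r M b : line_hol f (a + b) r M ->
  line_hol (fun x => f (x + b)) a r M.
Proof.
move=> fa w wa; have [|fM fd] := fa (w + b); first by rewrite opprD addrACA subrr addr0.
split; first exact: fM.
move=> v; have := fd v.
rewrite (_ : (fun t : R[i] => f (w + b + t *: v)) = (fun t : R[i] => f (w + t *: v + b))) //.
by apply/funext => t; rewrite addrAC.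
Qed.

(** The Gateaux derivative is Lipschitz in the base point: it is the derivative of
    the difference of two translates of [f], which is small. *)
Lemma derive_lipschitz f a r M v b : 0 < r -> line_hol f a r M -> rnorm b < r / 4 ->
  rnorm ('D_v f (a + b) - 'D_v f a) <= 128 * M / r ^+ 2 * rnorm v * rnorm b.
Proof.
move=> r0 fa br; have M0 := line_hol_ge0 r0 fa.
have r4 : 0 < r / 4 by rewrite divr_gt0.
have r2 : 0 < r / 2 by rewrite divr_gt0.
have abE : a + b - a = b by rewrite addrC addKr.
pose N := 8 * M / r * rnorm b.
have hN : line_hol (fun x => f (x + b) - f x) a (r / 4) N.
  move=> w wa; split.
    have fw : line_hol f w (r / 2) M by apply: line_hol_sub fa _; lra.
    apply: le_trans (line_hol_lipschitz r2 fw _) _; first by lra.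
    by rewrite le_eqVlt; apply/orP; left; apply/eqP; rewrite /N; field; rewrite gt_eqF.
  have h1 : line_hol f (a + b) (r / 4) M.
    by apply: line_hol_sub fa _; rewrite abE; lra.
  have h2 : line_hol f a (r / 4) M.
    by apply: line_hol_sub fa _; rewrite subrr rnorm0; lra.
  by have [] := line_holB (line_hol_translate h1) h2 wa.
have [dN _] := taylor2_derive v r4 hN.
have da x : rnorm (x - a) < r -> derivable f x v.
  by move=> /fa[_ h]; exact: line_derivable.
have dab : derivable (fun x => f (x + b)) a v.
  have h1 : line_hol f (a + b) (r / 4) M by apply: line_hol_sub fa _; rewrite abE; lra.
  have h2 := line_hol_translate h1; have [|_ dv] := h2 a; first by rewrite subrr rnorm0.
  exact: line_derivable.
have daa : derivable f a v by apply: da; rewrite subrr rnorm0.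
have E : 'D_v f (a + b) - 'D_v f a = 'D_v (fun x => f (x + b) - f x) a.
  by rewrite -(derive_translate f a v b); exact: (esym (deriveB dab daa)).
rewrite E (le_trans dN) // /N le_eqVlt; apply/orP; left; apply/eqP.
by field; rewrite gt_eqF.
Qed.

(** On a ball, boundedness and complex differentiability along lines give complex
    differentiability: the Gateaux derivative is additive in the direction because it
    is continuous in the base point. *)
Lemma line_hol_differentiable f a r M : 0 < r -> line_hol f a r M -> differentiable f a.
Proof.
move=> r0 fa; have M0 := line_hol_ge0 r0 fa.
have near_t v : 0 < r / 8 / (rnorm v + 1) /\ forall t : R[i],
    rnorm t < r / 8 / (rnorm v + 1) -> rnorm t * rnorm v < r / 8.
  have v1 : 0 < rnorm v + 1 by rewrite ltr_wpDl // rnorm_ge0.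
  split=> [|t]; first by rewrite !divr_gt0.
  rewrite ltr_pdivlMr // => tv; apply: le_lt_trans tv.
  by rewrite ler_wpM2l ?rnorm_ge0 // lerDl.
have LZ (c : R[i]) v : 'D_(c *: v) f a = c * 'D_v f a.
  have [_ h] := taylor2_derive v r0 fa; have [s0 sP] := near_t (c *: v).
  apply: (derive_eq_quadratic (C := 64 * M / r ^+ 2 * rnorm v ^+ 2 * rnorm c ^+ 2) s0).
  move=> t /sP; rewrite rnormZ mulrA -rnormM => tv.
  rewrite (_ : c * 'D_v f a * t = 'D_v f a * (t * c)); last by ring.
  rewrite scalerA (le_trans (h _ _)) //; first by lra.
  by rewrite rnormM exprMn (mulrC (rnorm t ^+ 2)) mulrA.
have LD v w : 'D_(v + w) f a = 'D_v f a + 'D_w f a.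
  have [sv0 svP] := near_t v; have [sw0 swP] := near_t w.
  apply: (derive_eq_quadratic (s := Num.min (r / 8 / (rnorm v + 1)) (r / 8 / (rnorm w + 1)))
    (C := 64 * M / (r / 2) ^+ 2 * rnorm w ^+ 2 + 64 * M / r ^+ 2 * rnorm v ^+ 2 +
      128 * M / r ^+ 2 * rnorm w * rnorm v)); first by rewrite lt_min sv0.
  move=> t; rewrite lt_min => /andP[/svP tv /swP tw].
  have atv : line_hol f (a + t *: v) (r / 2) M.
    have atE : a + t *: v - a = t *: v by rewrite addrC addKr.
    by apply: line_hol_sub fa _; rewrite atE rnormZ; lra.
  have r2 : 0 < r / 2 by rewrite divr_gt0.
  have [_ h1] := taylor2_derive w r2 atv.
  have [_ h2] := taylor2_derive v r0 fa.
  have h3 : rnorm ('D_w f (a + t *: v) - 'D_w f a) <= 128 * M / r ^+ 2 * rnorm w * rnorm (t *: v).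
    by apply: derive_lipschitz => //; rewrite rnormZ; lra.
  have {}h1 := h1 t; have {}h2 := h2 t.
  rewrite (_ : _ - _ - _ * t = (f (a + t *: v + t *: w) - f (a + t *: v) - 'D_w f (a + t *: v) * t) +
    (f (a + t *: v) - f a - 'D_v f a * t) + ('D_w f (a + t *: v) - 'D_w f a) * t); last first.
    rewrite scalerDr addrA.
    have alg (A B C L1 L2 L3 u : R[i]) :
      A - C - (L1 + L2) * u = (A - B - L3 * u) + (B - C - L1 * u) + (L3 - L2) * u by ring.
    exact: alg.
  apply: le_trans (rnormD _ _) _; rewrite [leRHS]mulrDl; apply: lerD.
    apply: le_trans (rnormD _ _) _; rewrite [leRHS]mulrDl; apply: lerD.
      by apply: h1; lra.
    by apply: h2; lra.
  rewrite rnormM (le_trans (ler_wpM2r (rnorm_ge0 t) h3)) // rnormZ.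
  by rewrite le_eqVlt; apply/orP; left; apply/eqP; ring.
pose L v : R[i] := 'D_v f a.
have lL : linear L by move=> c u v; rewrite /L LD LZ.
pose LM := GRing.isLinear.Build _ _ _ _ L lL.
pose Llin : {linear V -> R[i]} := HB.pack L LM.
apply/differentiable_rnormP; exists Llin; split.
  apply: (@lipschitz_linear_continuous _ _ _ Llin (4 * M / r)) => v.
  by have [] := taylor2_derive v r0 fa.
move=> e e0; set C := 64 * M / r ^+ 2.
have C0 : 0 <= C by rewrite !mulr_ge0 ?invr_ge0 ?exprn_ge0 ?rnorm_ge0 // ltW.
have C1 : 0 < C + 1 by rewrite ltr_wpDl.
exists (Num.min (r / 4) (e / (C + 1))); first by rewrite lt_min !divr_gt0.
move=> h; rewrite lt_min => /andP[hr]; rewrite ltr_pdivlMr // => he.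
have [_ /(_ 1)] := taylor2_derive h r0 fa.
rewrite rnorm1 mul1r scale1r expr1n !mulr1 => /(_ hr) /le_trans; apply.
rewrite -/C expr2 mulrA ler_wpM2r ?rnorm_ge0 // (le_trans _ (ltW he)) // mulrC.
by rewrite ler_wpM2l ?rnorm_ge0 // lerDl.
Qed.

End gateaux_frechet.

Section coordinates.
Variables (R : realType) (n : nat).
Local Notation Cn := 'rV[R[i]]_n.
Implicit Types (v w : Cn) (c : R).

Lemma coord_le_rnorm v k : rnorm (v ord0 k) <= rnorm v.
Proof.
rewrite -lecR -!rnormE (_ : `|v| = mx_norm v) // mx_normE.
have : (`|v ord0 k|%:nng <= \big[Num.max/0%:nng]_(i : 'I_1 * 'I_n) `|v i.1 i.2|%:nng)%R.
  by apply/bigmax_geP; right => /=; exists (ord0, k).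
by rewrite -num_le.
Qed.

Lemma rnorm_le_coord v c : 0 <= c -> (forall k, rnorm (v ord0 k) <= c) -> rnorm v <= c.
Proof.
move=> c0 h; rewrite -lecR -rnormE.
have [->|v0] := eqVneq `|v| 0; first by rewrite ler0c.
have [[i k] vE] := @mx_norm_neq0 _ _ _ v v0; rewrite (_ : `|v| = mx_norm v) // vE.
by rewrite /= (ord1 i) rnormE lecR.
Qed.

End coordinates.

Section open_sets.
Variables (R : realType) (n : nat).
Local Notation V := 'rV[R[i]]_n.
Implicit Types (f F : V -> R[i]) (a x v w : V) (r M : R) (U : set V).

Lemma open_ball U a : open U -> U a ->
  exists r : R, 0 < r /\ forall w, rnorm (w - a) < r -> U w.
Proof.
move=> oU Ua; have /nbhs_rnormP[r r0 rU] : nbhs a U by exact: open_nbhs_nbhs.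
by exists r.
Qed.

(** A holomorphic function is bounded near each point, by continuity. *)
Lemma holomorphic_line_hol U f a : open U -> holomorphic_on U f -> U a ->
  exists r M : R, [/\ 0 < r, forall w, rnorm (w - a) < r -> U w & line_hol f a r M].
Proof.
move=> oU fU Ua; have [r [r0 rU]] := open_ball oU Ua.
have /continuous_rnormP/(_ 1 ltr01)[s s0 sf] := differentiable_continuous (fU a Ua).
exists (Num.min r s), (rnorm (f a) + 1); split.
- by rewrite lt_min r0.
- by move=> w; rewrite lt_min => /andP[/rU].
- apply: differentiable_line_hol => w; rewrite lt_min => /andP[/rU Uw /sf h]; split.
    have := rnormD (f w - f a) (f a); rewrite subrK => /le_trans; apply.
    by rewrite addrC lerD2l ltW.
  exact: fU.
Qed.

Lemma line_hol_holomorphic U f :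
  (forall a, U a -> exists r M : R, 0 < r /\ line_hol f a r M) -> holomorphic_on U f.
Proof. by move=> h a /h[r [M [r0 fa]]]; exact: line_hol_differentiable fa. Qed.

Lemma three_point_limit (F : nat -> V -> R[i]) f a r M :
  (forall k, three_point (F k) a r M) ->
  (forall w, rnorm (w - a) < r -> forall e : R, 0 < e ->
     exists N, forall k, (N <= k)%N -> rnorm (F k w - f w) < e) ->
  three_point f a r M.
Proof.
move=> Fa Ff; split.
  move=> w wa; apply/ler_addgt0Pr => e e0; have [N NP] := Ff w wa e e0.
  have := rnormD (F N w) (f w - F N w); rewrite addrC subrK => /le_trans; apply.
  by rewrite lerD //; [exact: (proj1 (Fa N))|rewrite rnormB ltW // NP].
move=> x s v t t' s0 xs t0 t'0 ts t's; apply/ler_addgt0Pr => e e0.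
have inb (u : R[i]) : rnorm u * rnorm v < s / 4 -> rnorm (x + u *: v - a) < r.
  move=> us; rewrite addrAC (le_lt_trans (rnormD _ _)) // rnormZ; lra.
have xa : rnorm (x - a) < r by lra.
pose d := e / (2 * (rnorm t^-1 + rnorm t'^-1)).
have tp : 0 < rnorm t^-1 by rewrite rnormV invr_gt0 rnorm_gt0.
have t'p : 0 < rnorm t'^-1 by rewrite rnormV invr_gt0 rnorm_gt0.
have d0 : 0 < d by rewrite divr_gt0 // mulr_gt0 // addr_gt0.
have [N1 P1] := Ff _ (inb t ts) d d0; have [N2 P2] := Ff _ (inb t' t's) d d0.
have [N3 P3] := Ff _ xa d d0; pose k := maxn N1 (maxn N2 N3).
have p1 := P1 k (leq_maxl _ _).
have p2 : rnorm (F k (x + t' *: v) - f (x + t' *: v)) < d.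
  by apply: P2; rewrite leq_max leq_maxl orbT.
have p3 : rnorm (F k x - f x) < d by apply: P3; rewrite leq_max leq_maxr orbT.
have [_ /(_ x s v t t' s0 xs t0 t'0 ts t's) h] := Fa k.
have near (u : R[i]) : rnorm (F k (x + u *: v) - f (x + u *: v)) < d ->
    rnorm (dquot f x v u - dquot (F k) x v u) <= 2 * d * rnorm u^-1.
  move=> pu; rewrite /dquot -mulrBl rnormM ler_wpM2r ?rnorm_ge0 //.
  have alg (A B C D : R[i]) : A - B - (C - D) = (D - B) - (C - A) by ring.
  rewrite alg (le_trans (rnormDB _ _)) // mulr_natl mulr2n lerD //; exact: ltW.
have n1 := near t p1; have n2 := near t' p2.
apply: le_trans (rnorm_tri (dquot (F k) x v t) _ _) _.
have := rnorm_tri (dquot (F k) x v t') (dquot (F k) x v t) (dquot f x v t').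
rewrite [rnorm (dquot (F k) x v t' - _)]rnormB => m1.
have de : 2 * d * rnorm t^-1 + 2 * d * rnorm t'^-1 = e.
  by rewrite -mulrDr /d; field; rewrite gt_eqF // addr_gt0.
by apply: le_trans (lerD n1 m1) _; lra.
Qed.

Lemma holomorphic_limit U (F : nat -> V -> R[i]) f M : open U ->
  (forall k, holomorphic_on U (F k)) ->
  (forall k w, U w -> rnorm (F k w) <= M) ->
  (forall w, U w -> forall e : R, 0 < e ->
     exists N, forall k, (N <= k)%N -> rnorm (F k w - f w) < e) ->
  holomorphic_on U f.
Proof.
move=> oU FU FM Ff; apply: line_hol_holomorphic => a Ua.
have [r [r0 rU]] := open_ball oU Ua; exists r, M; split=> //.
apply: three_point_line_hol; apply: (@three_point_limit F).
  move=> k; apply: line_hol_three_point; apply: differentiable_line_hol => w /rU Uw.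
  by split; [exact: FM|exact: FU].
by move=> w /rU; exact: Ff.
Qed.

Lemma line_hol_scale f a r M (c : R[i]) : line_hol f a r M ->
  line_hol (fun x => f x * c) a r (M * rnorm c).
Proof.
move=> fa w wa; have [fM fd] := fa w wa; split.
  by rewrite rnormM ler_wpM2r ?rnorm_ge0.
by move=> v; exact: (differentiableM (fd v) (differentiable_cst c 0)).
Qed.

(** A directional derivative is a locally uniform limit of difference quotients. *)
Lemma line_hol_derive f a r M v : 0 < r -> line_hol f a r M ->
  line_hol (fun x => 'D_v f x) a (r / 2) (8 * M / r * rnorm v).
Proof.
move=> r0 fa; have M0 := line_hol_ge0 r0 fa.
have r2 : 0 < r / 2 by rewrite divr_gt0.
have v1 : 0 < rnorm v + 1 by rewrite ltr_wpDl // rnorm_ge0.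
pose d := r / 8 / (rnorm v + 1).
have d0 : 0 < d by rewrite !divr_gt0.
pose h k : R[i] := (d / k.+2%:R)%:C.
have rh k : rnorm (h k) = d / k.+2%:R by rewrite rnorm_real ger0_norm // divr_ge0 // ltW.
have hd k : rnorm (h k) < d by rewrite rh ltr_pdivrMr // ltr_pMr // ltr1n.
have h0 k : h k != 0 by rewrite eq_complex /= eqxx andbT gt_eqF // divr_gt0.
have hv k : rnorm (h k) * rnorm v < r / 8.
  have := hd k; rewrite ltr_pdivlMr // => h1; apply: le_lt_trans h1.
  by rewrite ler_wpM2l ?rnorm_ge0 // lerDl.
apply: three_point_line_hol.
have sub w : rnorm (w - a) < r / 2 -> line_hol f w (r / 2) M.
  by move=> wa; apply: line_hol_sub fa _; lra.
apply: (@three_point_limit (fun k x => dquot f x v (h k))) => [k|w wa e e0].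
  apply: line_hol_three_point => w wa; split.
    have [D [_ h1 _]] := taylor2 v r2 (sub w wa).
    rewrite rnormM rnormV ler_pdivrMr ?rnorm_gt0 //.
    apply: le_trans (h1 _ _) _; first by have := hv k; lra.
    by rewrite le_eqVlt; apply/orP; left; apply/eqP; field; rewrite gt_eqF.
  move=> u; have hw : rnorm (w + h k *: v - a) < r.
    rewrite addrAC (le_lt_trans (rnormD _ _)) // rnormZ; have := hv k; lra.
  have w1 : rnorm (w - a) < r by lra.
  have [_ /(_ u) d1] := fa _ hw; have [_ /(_ u) d2] := fa _ w1.
  have dd := differentiableM (differentiableB d1 d2) (differentiable_cst (h k)^-1 0).
  rewrite (_ : (fun t : R[i] => _) = (fun t : R[i] =>
    (f (w + h k *: v + t *: u) - f (w + t *: u)) * (h k)^-1)) //.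
  by apply/funext => t; rewrite /dquot addrAC.
have [_ T] := taylor2_derive v r2 (sub w wa).
set C := 64 * M / (r / 2) ^+ 2 * rnorm v ^+ 2.
have C0 : 0 <= C by rewrite !mulr_ge0 ?invr_ge0 ?exprn_ge0 ?rnorm_ge0 // ltW.
have C1 : 0 < C + 1 by rewrite ltr_wpDl.
exists (Num.bound ((C + 1) * d / e)) => k kN.
have hk : rnorm (h k) * rnorm v < r / 2 / 4 by have := hv k; lra.
apply: le_lt_trans ((dquot_near f w v _ C (h0 k)).1 (T _ hk)) _.
apply: (@le_lt_trans _ _ ((C + 1) * rnorm (h k))).
  by rewrite ler_wpM2r ?rnorm_ge0 // lerDl.
rewrite rh mulrA ltr_pdivrMr // (mulrC e) -ltr_pdivrMr //.
apply: lt_le_trans (archi_boundP _) _; first by apply: divr_ge0; [apply: mulr_ge0|]; exact: ltW.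
by rewrite ler_nat (leq_trans kN) // -addn2 leq_addr.
Qed.

Lemma holomorphic_derive U f v : open U -> holomorphic_on U f ->
  holomorphic_on U (fun x => 'D_v f x).
Proof.
move=> oU fU; apply: line_hol_holomorphic => a Ua.
have [r [M [r0 _ fa]]] := holomorphic_line_hol oU fU Ua.
exists (r / 2), (8 * M / r * rnorm v); split; first by rewrite divr_gt0.
exact: line_hol_derive.
Qed.

End open_sets.

Section radial.
Variables (R : realType) (n : nat).
Local Notation V := 'rV[R[i]]_n.
Implicit Types (f : V -> R[i]) (a v w : V) (r M : R) (U : set V).

Lemma rnorm_delta (k : 'I_n) : rnorm (delta_mx ord0 k : V) <= 1.
Proof.
apply: rnorm_le_coord => // j; rewrite mxE eqxx /=.
by case: eqP => _; rewrite ?rnorm1 ?rnorm0.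
Qed.

Lemma holomorphic_radial_deriv U f : open U -> holomorphic_on U f ->
  holomorphic_on U (radial_deriv f).
Proof.
move=> oU fU z Uz; apply: differentiable_bigsum => k.
apply: differentiableM; first exact: differentiable_coord.
exact: (@holomorphic_derive _ _ U f (delta_mx ord0 k) oU fU z Uz).
Qed.

Lemma radial_deriv_bound f w r M : 0 < r -> line_hol f w r M ->
  rnorm (radial_deriv f w) <= n%:R * (rnorm w * (4 * M / r)).
Proof.
move=> r0 fw; have M0 := line_hol_ge0 r0 fw.
rewrite (le_trans (rnorm_sum _ _ _)) //.
rewrite -[n in n%:R](card_ord n) mulr_natl -sumr_const ler_sum // => k _.
rewrite rnormM ler_pM ?rnorm_ge0 ?coord_le_rnorm //.
have [h _] := taylor2_derive (delta_mx ord0 k) r0 fw; apply: le_trans h _.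
by rewrite ler_piMr ?rnorm_delta // divr_ge0 ?mulr_ge0 // ltW.
Qed.

End radial.

(** * Smallness from values on a grid *)

Section grid.
Variables (R : realType) (n : nat).
Local Notation V := 'rV[R[i]]_n.
Implicit Types (f : V -> R[i]) (a v w : V) (r M e : R).

Definition grid_radius : R := 8^-1 / 16 ^+ n.

Lemma grid_radius_gt0 : 0 < grid_radius.
Proof. by rewrite divr_gt0 ?exprn_gt0 ?invr_gt0. Qed.

Lemma grid_radius_le : grid_radius <= 8^-1.
Proof.
rewrite /grid_radius ler_pdivrMr ?exprn_gt0 // ler_peMr ?invr_ge0 //.
by rewrite exprn_ege1 //; lra.
Qed.

(** The interpolation lemma is applied in one coordinate after the other; each step
    costs a factor 16^N, and the radius is so small that (4 rho)^N makes up for it. *)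
Lemma grid_smallness a r N : 0 < r -> exists P : {ffun 'I_n -> 'I_N} -> V,
  (forall h, rnorm (P h - a) < r) /\
  forall f M e, line_hol f a r M -> 0 <= e -> (forall h, rnorm (f (P h)) <= e) ->
  forall w, rnorm (w - a) <= r / 4 * grid_radius ->
    rnorm (f w) <= n%:R * 2^-1 ^+ N * M + 16 ^+ (n * N) * e.
Proof.
move=> r0; have g0 := grid_radius_gt0; have g8 := grid_radius_le.
have [|s [ss sr sP]] := @interpolation R N _ g0; first by lra.
have r4 : 0 < r / 4 by rewrite divr_gt0.
have r4C : (r / 4)%:C != 0 :> R[i] by rewrite eq_complex /= eqxx andbT gt_eqF.
pose P (h : {ffun 'I_n -> 'I_N}) : V := \row_k (a ord0 k + (r / 4)%:C * nth 0 s (h k)).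
have Pcoord h k : rnorm ((P h - a) ord0 k) <= r / 4 * grid_radius.
  rewrite !mxE addrC addKr rnormM rnorm_real gtr0_norm // ler_wpM2l ?(ltW r4) //.
  by apply: sr; apply: mem_nth; rewrite ss.
exists P; split=> [h|f M e fa e0 fe w wa].
  apply: le_lt_trans (rnorm_le_coord _ (Pcoord h)) _; first by rewrite mulr_ge0 // ltW.
  apply: (@le_lt_trans _ _ (r / 4 * 8^-1)); first by rewrite ler_wpM2l // ltW.
  by lra.
have M0 := line_hol_ge0 r0 fa.
pose rho := grid_radius.
have step m : (m <= n)%N -> forall w, (forall k, rnorm ((w - a) ord0 k) <= r / 4 * rho) ->
    (forall k : 'I_n, (m <= k)%N -> exists2 t, t \in s & w ord0 k = a ord0 k + (r / 4)%:C * t) ->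
    rnorm (f w) <= 16 ^+ (m * N) * (m%:R * (4 * rho) ^+ N * M + e).
  elim: m => [_|m ih mn] {wa}w wa wgrid.
    rewrite mul0n expr0 mul1r !mul0r add0r.
    have wP (k : 'I_n) : exists j : 'I_N, w ord0 k = a ord0 k + (r / 4)%:C * nth 0 s j.
      have [t ts wt] := wgrid k (leq0n _).
      have ti : (index t s < N)%N by rewrite -ss index_mem.
      by exists (Ordinal ti); rewrite /= nth_index.
    have [h hP] := choice wP; have -> : w = P (finfun h); last exact: fe.
    by apply/rowP => k; rewrite mxE ffunE hP.
  pose k0 := Ordinal mn.
  pose w' : V := \row_k (if k == k0 then a ord0 k else w ord0 k).
  have w'a : rnorm (w' - a) <= r / 4 * rho.
    apply: rnorm_le_coord => [|k]; first by rewrite mulr_ge0 // ltW.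
    rewrite !mxE; case: eqP => _; last by have := wa k; rewrite !mxE.
    by rewrite subrr rnorm0 mulr_ge0 // ltW.
  have r2 : 0 < r / 2 by rewrite divr_gt0.
  have fw' : line_hol f w' (r / 2) M.
    apply: line_hol_sub fa _; apply: (@le_trans _ _ (r / 4 * 8^-1 + r / 2)); last by lra.
    by rewrite lerD2r (le_trans w'a) // ler_wpM2l // ltW.
  have := line_hol_unit r2 fw' (rnorm_delta R k0).
  rewrite (_ : r / 2 / 2 = r / 4); last by field.
  set g := (X in hol_bounded X) => gM.
  have gpt t k : (w' + ((r / 4)%:C * t) *: delta_mx ord0 k0) ord0 k =
      if k == k0 then a ord0 k + (r / 4)%:C * t else w ord0 k.
    by rewrite !mxE eqxx /=; case: eqP => _; rewrite ?mulr1 ?mulr0 ?addr0.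
  have ge t : t \in s -> rnorm (g t) <= 16 ^+ (m * N) * (m%:R * (4 * rho) ^+ N * M + e).
    move=> ts; apply: ih => [|k|k mk]; first exact: ltnW.
      rewrite mxE gpt mxE; case: eqP => _; last by have := wa k; rewrite !mxE.
      by rewrite addrC addKr rnormM rnorm_real gtr0_norm // ler_wpM2l ?(ltW r4) // sr.
    rewrite gpt; case: eqP => [->|kk0]; first by exists t.
    apply: wgrid; rewrite ltn_neqAle mk andbT; apply/eqP => mk'; apply: kk0.
    exact/val_inj.
  pose z := (w ord0 k0 - a ord0 k0) / (r / 4)%:C.
  have zr : rnorm z <= rho.
    rewrite rnormM rnormV rnorm_real gtr0_norm // ler_pdivrMr // mulrC.
    by have := wa k0; rewrite !mxE.
  have gz : g z = f w.
    congr f; apply/rowP => k; rewrite gpt; case: eqP => [->|//].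
    by rewrite /z mulrC divfK // addrC subrK.
  have b0 : 0 <= 16 ^+ (m * N) * (m%:R * (4 * rho) ^+ N * M + e).
    by rewrite mulr_ge0 ?addr_ge0 ?mulr_ge0 ?exprn_ge0 // mulr_ge0 // ltW.
  rewrite -gz (le_trans (sP g M _ gM b0 ge z zr)) //.
  rewrite mulSn exprD -(natr1 m); set B := 16 ^+ N; set D := 16 ^+ (m * N); set A := (4 * rho) ^+ N.
  rewrite (_ : B * D * _ = A * M * (B * D) + B * (D * (m%:R * A * M + e))); last by ring.
  rewrite lerD2r ler_peMr //.
    by rewrite mulr_ge0 ?exprn_ge0 // mulr_ge0 // ltW.
  by rewrite -exprD exprn_ege1 //; lra.
have := step n (leqnn n) w; rewrite mulrDr => h.
apply: le_trans (h _ _) _ => [k|k|].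
- exact: le_trans (coord_le_rnorm _ _) wa.
- by rewrite leqNgt ltn_ord.
- rewrite lerD2r le_eqVlt; apply/orP; left; apply/eqP.
  rewrite mulrCA -!mulrA; congr (_ * _); rewrite mulrA; congr (_ * _).
  by rewrite exprM -exprMn; congr (_ ^+ _); rewrite /rho /grid_radius; field; rewrite expf_neq0.
Qed.

End grid.

(** * Integral means over squares and polydiscs *)

Section plane.
Context (R : realType).
Local Notation RR := (measurableTypeR R * measurableTypeR R)%type.
Local Notation leb := (@lebesgue_measure R).

Definition plane : {sigma_finite_measure set RR -> \bar R} := product_sf leb leb.

Section plane_tonelli.
Variables (f : RR -> \bar R).
Hypotheses (mf : measurable_fun setT f) (f0 : forall x, (0 <= f x)%E).

Lemma plane_tonelli1 : (\int[plane]_z f z = \int[leb]_x \int[leb]_y f (x, y))%E.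
Proof. exact: (@fubini_tonelli1 _ _ _ _ _ leb leb f mf f0). Qed.

Lemma plane_tonelli2 : (\int[plane]_z f z = \int[leb]_y \int[leb]_x f (x, y))%E.
Proof. exact: (@fubini_tonelli2 _ _ _ _ _ leb leb f mf f0). Qed.

End plane_tonelli.

Section volume_tonelli.
Variables (n : nat) (f : n.+1.-tuple RR -> \bar R).
Hypotheses (mf : measurable_fun setT f) (f0 : forall x, (0 <= f x)%E).

Lemma measurable_tcons_comp : measurable_fun setT (fun x : RR * n.-tuple RR => f (tcons x)).
Proof. by apply: (measurableT_comp mf); exact: measurable_tcons. Qed.

Lemma volume_tonelli :
  (\int[volume R n.+1]_x f x = \int[plane]_p \int[volume R n]_x f (tcons (p, x)))%E.
Proof.
rewrite /volume /= [LHS]ge0_integral_pushforward //; last exact: measurable_tcons.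
exact: (@fubini_tonelli1 _ _ _ _ _ plane (volume R n) _ measurable_tcons_comp).
Qed.

End volume_tonelli.

End plane.

Section square_mean.
Variable R : realType.
Local Notation RR := (measurableTypeR R * measurableTypeR R)%type.
Local Notation leb := (@lebesgue_measure R).
Implicit Types (F : R[i] -> R[i]) (a : R[i]) (d : R) (h : RR -> \bar R).

Lemma rnorm_dist (V : normedModType R[i]) (u v : V) : `|rnorm u - rnorm v| <= rnorm (u - v).
Proof.
rewrite ler_norml; have := rnormD (u - v) v; have := rnormD (v - u) u.
by rewrite !subrK (rnormB v u) => h1 h2; apply/andP; lra.
Qed.

Lemma continuous_rnorm_hor F x y : {for x +i* y, continuous F} ->
  {for x, continuous (fun t => rnorm (F (t +i* y)))}.
Proof.
move=> /continuous_rnormP Fc; apply/cvgrPdist_lt => e e0.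
have [r r0 rF] := Fc _ e0; near=> t.
apply: le_lt_trans (rnorm_dist _ _) _; rewrite rnormB; apply: rF.
have -> : (t +i* y) - (x +i* y) = (t - x)%:C by apply/eqP; rewrite eq_complex /= subrr !eqxx.
by rewrite rnorm_real distrC; near: t; exact: cvgr_dist_lt.
Unshelve. all: by end_near. Qed.

Lemma continuous_rnorm_ver F x y : {for x +i* y, continuous F} ->
  {for y, continuous (fun t => rnorm (F (x +i* t)))}.
Proof.
move=> /continuous_rnormP Fc; apply/cvgrPdist_lt => e e0.
have [r r0 rF] := Fc _ e0; near=> t.
apply: le_lt_trans (rnorm_dist _ _) _; rewrite rnormB; apply: rF.
have -> : (x +i* t) - (x +i* y) = 'i * (t - y)%:C.
  by apply/eqP; rewrite eq_complex /=; apply/andP; split; apply/eqP; ring.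
by rewrite rnormM rnorm_i mul1r rnorm_real distrC; near: t; exact: cvgr_dist_lt.
Unshelve. all: by end_near. Qed.

(** Among the vertical lines of a strip of width [d] there is one along which the
    integral is at most the average. *)
Lemma good_line (V : measurableTypeR R -> \bar R) (u d c : R) : measurable_fun setT V ->
  (forall x, (0 <= V x)%E) -> 0 < d -> 0 <= c -> (\int[leb]_x V x < (c * d)%:E)%E ->
  exists2 x, u <= x <= u + d & (V x < c%:E)%E.
Proof.
move=> mV V0 d0 c0 Vc; apply/not_exists2P => no.
have big x : u <= x <= u + d -> (c%:E <= V x)%E.
  by move=> ux; have [] := no x => //; rewrite ltNge => /negP; rewrite negbK.
move: Vc; rewrite ltNge => /negP; apply.
have md : measurable (`[u, u + d]%classic : set (measurableTypeR R)) by exact: measurable_itv.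
have sub : (\int[leb]_(x in `[u, (u + d)%R]) V x <= \int[leb]_x V x)%E.
  exact: ge0_subset_integral.
apply: le_trans sub.
have -> : ((c * d)%:E = \int[leb]_(x in `[u, (u + d)%R]) cst c%:E x)%E.
  rewrite integral_cst //= lebesgue_measure_itv /= lte_fin ltrDl d0 EFinM.
  by rewrite -EFinD addrAC subrr add0r.
apply: ge0_le_integral => //; first exact: measurable_funTS.
Qed.

Lemma Rintegral_le_ereal (u : R -> R) (v : measurableTypeR R -> \bar R) x1 x2 (c : R) :
  (forall x, x1 <= x <= x2 -> {for x, continuous u}) -> measurable_fun setT v ->
  (forall x, (0 <= v x)%E) -> (forall x, 0 <= u x) ->
  (forall x, x1 <= x <= x2 -> ((u x)%:E <= v x)%E) ->
  (\int[leb]_x v x < c%:E)%E -> \int[leb]_(x in `[x1, x2]) u x <= c.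
Proof.
move=> uc mv v0 u0 uv vc; have ui := integrable_itvcc uc.
rewrite -lee_fin /Rintegral fineK; last exact: integrable_fin_num.
apply: le_trans (ltW vc).
have md : measurable (`[x1, x2]%classic : set (measurableTypeR R)) by exact: measurable_itv.
have sub : (\int[leb]_(x in `[x1, x2]) v x <= \int[leb]_x v x)%E.
  exact: ge0_subset_integral.
apply: le_trans sub.
apply: ge0_le_integral => //.
- by move=> x _; rewrite lee_fin.
- exact: measurable_int ui.
- exact: measurable_funTS.
Qed.

Lemma Rintegral_diff_le (u1 u2 w1 w2 : R -> R) x1 x2 (e c : R) : 0 <= e ->
  (forall x, x1 <= x <= x2 -> {for x, continuous u1}) ->
  (forall x, x1 <= x <= x2 -> {for x, continuous u2}) ->
  leb.-integrable `[x1, x2] (EFin \o (fun x => w1 x - w2 x)) ->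
  (forall x, x1 <= x <= x2 -> `|w1 x| <= e * u1 x) ->
  (forall x, x1 <= x <= x2 -> `|w2 x| <= e * u2 x) ->
  \int[leb]_(x in `[x1, x2]) u1 x <= c -> \int[leb]_(x in `[x1, x2]) u2 x <= c ->
  `|\int[leb]_(x in `[x1, x2]) (w1 x - w2 x)| <= 2 * e * c.
Proof.
move=> e0 u1c u2c wi w1u w2u I1 I2.
have i1 := integrable_itvcc u1c; have i2 := integrable_itvcc u2c.
have i12 : leb.-integrable `[x1, x2] (EFin \o (fun x => u1 x + u2 x)).
  by apply: integrable_itvcc => x xI; apply: cvgD; [exact: u1c|exact: u2c].
have i12e : leb.-integrable `[x1, x2] (EFin \o (fun x => e * (u1 x + u2 x))).
  apply: integrable_itvcc => x xI; apply: cvgMr; apply: cvgD; [exact: u1c|exact: u2c].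
apply: le_trans (le_normr_Rintegral _ wi) _ => //.
apply: (@le_trans _ _ (\int[leb]_(x in `[x1, x2]) (e * (u1 x + u2 x)))).
  apply: le_Rintegral => //; first exact: integrable_norm.
  move=> x /=; rewrite in_itv /= => xI; rewrite (le_trans (ler_normB _ _)) // mulrDr.
  by rewrite lerD ?w1u ?w2u.
rewrite RintegralZl // RintegralD // -mulrA mulrCA ler_wpM2l // mulr_natl mulr2n.
exact: lerD.
Qed.

(** Integrating the Cauchy inequality over four well-chosen lines bounds the value at
    the centre of a square by the mean over the square. *)
Lemma square_mean_Re F a d h : 0 < d ->
  differentiable_on_rect F (complex.Re a - 2 * d) (complex.Re a + 2 * d)
    (complex.Im a - 2 * d) (complex.Im a + 2 * d) ->
  measurable_fun setT h -> (forall p, (0 <= h p)%E) ->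
  (forall x y, complex.Re a - 2 * d <= x <= complex.Re a + 2 * d ->
     complex.Im a - 2 * d <= y <= complex.Im a + 2 * d ->
     ((rnorm (F (x +i* y)))%:E <= h (x, y))%E) ->
  ((`|complex.Re (F a)|)%:E <= (d ^- 2)%:E * \int[@plane R]_p h p)%E.
Proof.
move=> d0 Fd mh h0 Fh.
have d20 : 0 < d ^- 2 by rewrite invr_gt0 exprn_gt0.
have I0 : (0 <= \int[@plane R]_p h p)%E by exact: integral_ge0.
case: (ltP (\int[@plane R]_p h p)%E +oo%E) => [Ioo|]; last first.
  by rewrite leye_eq => /eqP ->; rewrite gt0_muley ?leey // lte_fin.
have Ifin : (\int[@plane R]_p h p)%E \is a fin_num by rewrite ge0_fin_numE.
pose I := fine (\int[@plane R]_p h p)%E.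
have IE : (\int[@plane R]_p h p)%E = I%:E by rewrite fineK.
have I00 : 0 <= I by rewrite -lee_fin -IE.
rewrite IE -EFinM lee_fin; apply/ler_addgt0Pr => e e0.
pose c := (I / d + e * d).
have c0 : 0 < c by rewrite ltr_wpDl ?mulr_gt0 // divr_ge0 // ltW.
have Ic : (I%:E < (c * d)%:E)%E.
  by rewrite lte_fin /c mulrDl divfK ?gt_eqF // ltrDl !mulr_gt0.
pose V x : \bar R := (\int[leb]_y h (x, y))%E.
pose H y : \bar R := (\int[leb]_x h (x, y))%E.
have mV : measurable_fun setT V by exact: measurable_fun_fubini_tonelli_F.
have mH : measurable_fun setT H by exact: measurable_fun_fubini_tonelli_G.
have V0 x : (0 <= V x)%E by exact: integral_ge0.
have H0 x : (0 <= H x)%E by exact: integral_ge0.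
have VI : (\int[leb]_x V x < (c * d)%:E)%E by rewrite -plane_tonelli1 // IE.
have HI : (\int[leb]_x H x < (c * d)%:E)%E by rewrite -plane_tonelli2 // IE.
have [x1 /andP[x1l x1r] Vx1] := good_line (complex.Re a - 2 * d) mV V0 d0 (ltW c0) VI.
have [x2 /andP[x2l x2r] Vx2] := good_line (complex.Re a + d) mV V0 d0 (ltW c0) VI.
have [y1 /andP[y1l y1r] Hy1] := good_line (complex.Im a - 2 * d) mH H0 d0 (ltW c0) HI.
have [y2 /andP[y2l y2r] Hy2] := good_line (complex.Im a + d) mH H0 d0 (ltW c0) HI.
have x12 : x1 <= x2 by lra.
have y12 : y1 <= y2 by lra.
have inX x : x1 <= x <= x2 -> complex.Re a - 2 * d <= x <= complex.Re a + 2 * d.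
  by move=> /andP[? ?]; apply/andP; lra.
have inY y : y1 <= y <= y2 -> complex.Im a - 2 * d <= y <= complex.Im a + 2 * d.
  by move=> /andP[? ?]; apply/andP; lra.
have Fd' : differentiable_on_rect F x1 x2 y1 y2.
  by apply: differentiable_on_subrect Fd; lra.
have aX : x1 < complex.Re a < x2 by apply/andP; lra.
have aY : y1 < complex.Im a < y2 by apply/andP; lra.
have ver x : complex.Re a - 2 * d <= x <= complex.Re a + 2 * d -> (V x < c%:E)%E ->
    \int[leb]_(y in `[y1, y2]) rnorm (F (x +i* y)) <= c.
  move=> xI Vx; apply: (@Rintegral_le_ereal _ (fun y => h (x, y))) => //.
  - move=> y /inY yI; apply: continuous_rnorm_ver; apply: differentiable_continuous; apply: Fd.
    by case/andP: xI => ? ?; case/andP: yI.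
  - exact: measurable_fun_pair2.
  - by move=> y; exact: rnorm_ge0.
  - by move=> y /inY yI; exact: Fh.
have hor y : complex.Im a - 2 * d <= y <= complex.Im a + 2 * d -> (H y < c%:E)%E ->
    \int[leb]_(x in `[x1, x2]) rnorm (F (x +i* y)) <= c.
  move=> yI Hy; apply: (@Rintegral_le_ereal _ (fun x => h (x, y))) => //.
  - move=> x /inX xI; apply: continuous_rnorm_hor; apply: differentiable_continuous; apply: Fd.
    by case/andP: xI => ? ?; case/andP: yI.
  - exact: measurable_fun_pair1.
  - by move=> x; exact: rnorm_ge0.
  - by move=> x /inX xI; exact: Fh.
have x1I : complex.Re a - 2 * d <= x1 <= complex.Re a + 2 * d by apply/andP; lra.
have x2I : complex.Re a - 2 * d <= x2 <= complex.Re a + 2 * d by apply/andP; lra.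
have y1I : complex.Im a - 2 * d <= y1 <= complex.Im a + 2 * d by apply/andP; lra.
have y2I : complex.Im a - 2 * d <= y2 <= complex.Im a + 2 * d by apply/andP; lra.
have ck z : on_edges x1 x2 y1 y2 z -> rnorm (F z * cauchy_kernel a z) <= d^-1 * rnorm (F z).
  move=> ze; rewrite rnormM mulrC ler_wpM2r ?rnorm_ge0 // rnorm_cauchy_kernel.
  have dz : d <= rnorm (z - a).
    case: ze => _ [] ze; [apply: le_trans (Re_le_rnorm _)|apply: le_trans (Re_le_rnorm _)|
      apply: le_trans (Im_le_rnorm _)|apply: le_trans (Im_le_rnorm _)];
    rewrite raddfB /= ze ler_normr; apply/orP; [right|left|right|left]; lra.
  by rewrite lef_pV2 // posrE // (lt_le_trans d0).
have Gc : continuous_on_edges (fun z => F z * cauchy_kernel a z) x1 x2 y1 y2.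
  move=> z ze; apply: differentiable_continuous.
  by apply: differentiable_mul_kernel (on_edges_neq aX aY ze) (Fd' z (proj1 ze)).
have cont x y : complex.Re a - 2 * d <= x <= complex.Re a + 2 * d ->
    complex.Im a - 2 * d <= y <= complex.Im a + 2 * d -> {for x +i* y, continuous F}.
  by move=> /andP[? ?] /andP[? ?]; apply: differentiable_continuous; apply: Fd.
have d10 : 0 <= d^-1 by rewrite invr_ge0 ltW.
have B1 : `|\int[leb]_(x in `[x1, x2]) (complex.Re ((fun z => F z * cauchy_kernel a z) (x +i* y1)) -
    complex.Re ((fun z => F z * cauchy_kernel a z) (x +i* y2)))| <= 2 * d^-1 * c.
  apply: (@Rintegral_diff_le (fun x => rnorm (F (x +i* y1))) (fun x => rnorm (F (x +i* y2)))) => //.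
  - by move=> x /inX xI; apply: continuous_rnorm_hor; exact: cont.
  - by move=> x /inX xI; apply: continuous_rnorm_hor; exact: cont.
  - exact: (integrable_hor y12 Gc).
  - move=> x /andP[? ?]; apply: le_trans (Re_le_rnorm _) _; apply: ck.
    by split=> //; constructor 3.
  - move=> x /andP[? ?]; apply: le_trans (Re_le_rnorm _) _; apply: ck.
    by split=> //; constructor 4.
  - exact: hor.
  - exact: hor.
have B2 : `|\int[leb]_(y in `[y1, y2]) (complex.Im ((fun z => F z * cauchy_kernel a z) (x2 +i* y)) -
    complex.Im ((fun z => F z * cauchy_kernel a z) (x1 +i* y)))| <= 2 * d^-1 * c.
  apply: (@Rintegral_diff_le (fun y => rnorm (F (x2 +i* y))) (fun y => rnorm (F (x1 +i* y)))) => //.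
  - by move=> y /inY yI; apply: continuous_rnorm_ver; exact: cont.
  - by move=> y /inY yI; apply: continuous_rnorm_ver; exact: cont.
  - exact: (integrable_ver x12 Gc).
  - move=> y /andP[? ?]; apply: le_trans (Im_le_rnorm _) _; apply: ck.
    by split=> //; constructor 2.
  - move=> y /andP[? ?]; apply: le_trans (Im_le_rnorm _) _; apply: ck.
    by split=> //; constructor 1.
  - exact: ver.
  - exact: ver.
have := cauchy_rect aX aY Fd'; rewrite /rect_int => B3.
have := le_trans B3 (le_trans (ler_normB _ _) (lerD B1 B2)) => B4.
have -> : d ^- 2 * I + e = d^-1 * c by rewrite /c; field; rewrite gt_eqF.
lra.
Qed.

Lemma square_mean F a d h : 0 < d ->
  differentiable_on_rect F (complex.Re a - 2 * d) (complex.Re a + 2 * d)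
    (complex.Im a - 2 * d) (complex.Im a + 2 * d) ->
  measurable_fun setT h -> (forall p, (0 <= h p)%E) ->
  (forall x y, complex.Re a - 2 * d <= x <= complex.Re a + 2 * d ->
     complex.Im a - 2 * d <= y <= complex.Im a + 2 * d ->
     ((rnorm (F (x +i* y)))%:E <= h (x, y))%E) ->
  ((rnorm (F a))%:E <= (2 / d ^+ 2)%:E * \int[@plane R]_p h p)%E.
Proof.
move=> d0 Fd mh h0 Fh.
have I0 : (0 <= \int[@plane R]_p h p)%E by exact: integral_ge0.
have h1 := square_mean_Re d0 Fd mh h0 Fh.
have h2 : ((`|complex.Im (F a)|)%:E <= (d ^- 2)%:E * \int[@plane R]_p h p)%E.
  have := @square_mean_Re (fun z => - 'i * F z) a d h d0.
  have -> : complex.Re (- 'i * F a) = complex.Im (F a).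
    by case: (F a) => u v /=; rewrite oppr0 mul0r mulN1r opprK add0r.
  apply; [|exact: mh|exact: h0|move=> x y xI yI].
    by move=> z /Fd Fz; exact: (differentiableM (differentiable_cst _ _) Fz).
  by rewrite rnormM rnormN rnorm_i mul1r; exact: Fh.
apply: (@le_trans _ _ (`|complex.Re (F a)|%:E + `|complex.Im (F a)|%:E)%E).
  by rewrite -EFinD lee_fin rnorm_le_ReIm.
apply: le_trans (leeD h1 h2) _.
have d20 : (0 <= (d ^- 2)%:E)%E by rewrite lee_fin invr_ge0 exprn_ge0 // ltW.
rewrite -ge0_muleDl // -EFinD (_ : d ^- 2 + d ^- 2 = 2 / d ^+ 2)%R; first exact: lexx.
by ring.
Qed.

End square_mean.

Section polydisc_mean.
Variable R : realType.
Local Notation RR := (measurableTypeR R * measurableTypeR R)%type.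

Definition cons_row n (z : R[i]) (w : 'rV[R[i]]_n) : 'rV[R[i]]_n.+1 :=
  \row_k (if unlift ord0 k is Some j then w ord0 j else z).

Lemma cons_row0 n z (w : 'rV[R[i]]_n) : cons_row z w ord0 ord0 = z.
Proof. by rewrite mxE unlift_none. Qed.

Lemma cons_rowS n z (w : 'rV[R[i]]_n) j : cons_row z w ord0 (lift ord0 j) = w ord0 j.
Proof. by rewrite mxE liftK. Qed.

Lemma to_cvec_tcons n (p : RR) (x : n.-tuple RR) :
  to_cvec (tcons (p, x)) = cons_row (p.1 +i* p.2) (to_cvec x).
Proof.
apply/rowP => k; case: (unliftP ord0 k) => [j ->|->].
  by rewrite cons_rowS !mxE !(tnth_nth p).
by rewrite cons_row0 mxE (tnth_nth p).
Qed.

Lemma cons_row_tail n (a : 'rV[R[i]]_n.+1) :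
  a = cons_row (a ord0 ord0) (\row_j a ord0 (lift ord0 j)).
Proof.
by apply/rowP => k; case: (unliftP ord0 k) => [j ->|->]; rewrite ?cons_rowS ?cons_row0 ?mxE.
Qed.

Definition in_box n (a : 'rV[R[i]]_n) (e : R) (w : 'rV[R[i]]_n) := forall k,
  complex.Re (a ord0 k) - e <= complex.Re (w ord0 k) <= complex.Re (a ord0 k) + e /\
  complex.Im (a ord0 k) - e <= complex.Im (w ord0 k) <= complex.Im (a ord0 k) + e.

Lemma cons_rowD0 n z t (w : 'rV[R[i]]_n) :
  cons_row z w + t *: delta_mx ord0 ord0 = cons_row (z + t) w.
Proof.
apply/rowP => k; rewrite !mxE; case: unliftP => [j ->|->] /=.
  by rewrite mulr0 addr0.
by rewrite mulr1.
Qed.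

Lemma cons_rowDS n z t (w : 'rV[R[i]]_n) j :
  cons_row z w + t *: delta_mx ord0 (lift ord0 j) = cons_row z (w + t *: delta_mx ord0 j).
Proof.
apply/rowP => k; rewrite !mxE; case: unliftP => [i ->|->] /=.
  by rewrite !mxE /= (inj_eq lift_inj).
by rewrite mulr0 addr0.
Qed.

(** One coordinate after the other, by Tonelli's theorem. *)
Lemma polydisc_mean n (f : 'rV[R[i]]_n -> R[i]) a (d : R) (H : n.-tuple RR -> \bar R) : 0 < d ->
  (forall w, in_box a (2 * d) w -> forall k,
    differentiable (fun t : R[i] => f (w + t *: delta_mx ord0 k)) 0) ->
  measurable_fun setT H -> (forall x, (0 <= H x)%E) ->
  (forall x, in_box a (2 * d) (to_cvec x) -> ((rnorm (f (to_cvec x)))%:E <= H x)%E) ->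
  ((rnorm (f a))%:E <= ((2 / d ^+ 2) ^+ n)%:E * \int[volume R n]_x H x)%E.
Proof.
move=> d0; set C := 2 / d ^+ 2.
have C0 : 0 < C by rewrite divr_gt0 // exprn_gt0.
elim: n f a H => [|n ih] f a H fd mH H0 fH.
  rewrite expr0 mul1e /volume /= integral_dirac // diracT mul1e.
  rewrite (_ : a = to_cvec [tuple]); last by apply/rowP; case.
  by apply: fH => -[].
pose a' : 'rV[R[i]]_n := \row_j a ord0 (lift ord0 j).
have aE : a = cons_row (a ord0 ord0) a' := cons_row_tail a.
have box z w : complex.Re (a ord0 ord0) - 2 * d <= complex.Re z <= complex.Re (a ord0 ord0) + 2 * d ->
    complex.Im (a ord0 ord0) - 2 * d <= complex.Im z <= complex.Im (a ord0 ord0) + 2 * d ->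
    in_box a' (2 * d) w -> in_box a (2 * d) (cons_row z w).
  move=> zr zi wb k; case: (unliftP ord0 k) => [j ->|->]; last by rewrite cons_row0.
  by rewrite cons_rowS; have := wb j; rewrite !mxE.
have a'box : in_box a' (2 * d) a'.
  by move=> k; split; apply/andP; lra.
pose h p : \bar R := ((C ^+ n)%:E * \int[volume R n]_x H (tcons (p, x)))%E.
have mHc := measurable_tcons_comp mH.
have I0 p : (0 <= \int[volume R n]_x H (tcons (p, x)))%E by exact: integral_ge0.
have Cn0 : (0 <= (C ^+ n)%:E)%E by rewrite lee_fin exprn_ge0 // ltW.
have mI : measurable_fun setT (fun p : RR => \int[volume R n]_x H (tcons (p, x)))%E.
  exact: (@measurable_fun_fubini_tonelli_F _ _ _ _ _ (volume R n) _ mHc (fun x => H0 (tcons x))).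
have mh : measurable_fun setT h by exact: measurable_funeM.
have h0 p : (0 <= h p)%E by rewrite mule_ge0.
rewrite [in rnorm _]aE.
apply: le_trans (@square_mean _ (fun z => f (cons_row z a')) (a ord0 ord0) d h d0 _ mh h0 _) _.
- move=> z [z1 z2 z3 z4].
  have zb : in_box a (2 * d) (cons_row z a') by apply: box => //; apply/andP.
  have := differentiable_shift_scale 1 z (fd _ zb ord0).
  rewrite (_ : (fun t : R[i] => f (cons_row z a' + (1 * (t - z)) *: delta_mx ord0 ord0)) =
    (fun z => f (cons_row z a'))) //.
  by apply/funext => t; rewrite cons_rowD0 mul1r addrC subrK.
- move=> x y xI yI; apply: (ih (fun w => f (cons_row (x +i* y) w)) a' (fun u => H (tcons ((x, y), u)))).
  + move=> w wb k; have := fd _ (box (x +i* y) w xI yI wb) (lift ord0 k).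
    by under eq_fun do rewrite cons_rowDS.
  + exact: (measurable_fun_pair2 (x, y) mHc).
  + by move=> u; exact: H0.
  + move=> u ub; have := fH (tcons ((x, y), u)); rewrite to_cvec_tcons /=; apply.
    exact: box.
- rewrite ge0_integralZl // volume_tonelli // (exprS C) (EFinM C) -muleA.
  exact: lexx.
Qed.

End polydisc_mean.

(** * Measurability and volume *)

Section measurability.
Variables (R : realType) (n : nat).
Local Notation RR := (measurableTypeR R * measurableTypeR R)%type.
Local Notation V := 'rV[R[i]]_n.
Implicit Types (U : set V) (w a : V) (x : n.-tuple RR).

Lemma measurable_coord_box (k : 'I_n) (u v : R * R) :
  measurable [set x : n.-tuple RR | u.1 < (tnth x k).1 < v.1 /\ u.2 < (tnth x k).2 < v.2].
Proof.
rewrite [X in measurable X](_ : _ = [set: n.-tuple RR] `&` (fun x : n.-tuple RR => tnth x k) @^-1`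
  (`]u.1, v.1[%classic `*` `]u.2, v.2[%classic)).
  by apply: measurable_tnth => //; apply: measurableX; exact: measurable_itv.
by rewrite setTI; apply/seteqP; split=> x /=; rewrite !in_itv.
Qed.

Lemma measurable_open_box (u v : 'I_n -> R * R) :
  measurable [set x : n.-tuple RR | forall k,
    (u k).1 < (tnth x k).1 < (v k).1 /\ (u k).2 < (tnth x k).2 < (v k).2].
Proof.
rewrite [X in measurable X](_ : _ = \bigcap_(k in [set: 'I_n]) [set x : n.-tuple RR |
   (u k).1 < (tnth x k).1 < (v k).1 /\ (u k).2 < (tnth x k).2 < (v k).2]).
  apply: fin_bigcap_measurable; first exact: finite_finset.
  by move=> k _; exact: measurable_coord_box.
apply/seteqP; split=> x /=; first by move=> h k _; exact: h.
by move=> h k; exact: h.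
Qed.

(** Open sets are countable unions of boxes with rational corners. *)
Lemma measurable_open U : open U -> measurable (@to_cvec R n @^-1` U).
Proof.
move=> oU; pose T := ({ffun 'I_n -> rat * rat} * nat)%type.
pose box (t : T) : set (n.-tuple RR) := [set x | forall k,
  (ratr (t.1 k).1 - t.2.+1%:R^-1 < (tnth x k).1 < ratr (t.1 k).1 + t.2.+1%:R^-1) /\
  (ratr (t.1 k).2 - t.2.+1%:R^-1 < (tnth x k).2 < ratr (t.1 k).2 + t.2.+1%:R^-1)].
pose F (t : T) : set (n.-tuple RR) :=
  [set x | box t x /\ (box t `<=` @to_cvec R n @^-1` U)].
have mF t : measurable (F t).
  have [sub|nsub] := pselect (box t `<=` @to_cvec R n @^-1` U); last first.
    rewrite (_ : F t = set0); first exact: measurable0.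
    by apply/seteqP; split=> // x [_ /nsub].
  rewrite (_ : F t = box t); last by apply/seteqP; split=> x => [[]|].
  exact: (measurable_open_box
    (fun k => (ratr (t.1 k).1 - t.2.+1%:R^-1, ratr (t.1 k).2 - t.2.+1%:R^-1))
    (fun k => (ratr (t.1 k).1 + t.2.+1%:R^-1, ratr (t.1 k).2 + t.2.+1%:R^-1))).
rewrite (_ : _ @^-1` _ = \bigcup_t F t); last first.
  apply/seteqP; split=> x; last by move=> [t _ [xt sub]]; exact: sub.
  move=> Ux; have [r [r0 rU]] := open_ball oU Ux.
  pose m := Num.bound (4 / r); have m1 : 0 < (m.+1%:R : R)^-1 by rewrite invr_gt0.
  have mr : (m.+1%:R : R)^-1 * 4 < r.
    rewrite mulrC ltr_pdivrMr // mulrC -ltr_pdivrMr //.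
    apply: lt_le_trans (archi_boundP _) _; first by rewrite divr_ge0 // ltW.
    by rewrite ler_nat leqnSn.
  have ratnear (y : R) : exists q : rat, ratr q - (m.+1%:R)^-1 < y < ratr q + (m.+1%:R)^-1.
    have [|q] := @rat_in_itvoo R (y - m.+1%:R^-1) (y + m.+1%:R^-1); first by rewrite ltrBlDr -addrA ltrDl addr_gt0.
    by rewrite in_itv /= => /andP[q1 q2]; exists q; rewrite ltrBlDr q2 -ltrBlDr q1.
  have ratnear2 (k : 'I_n) : exists q : rat * rat,
     (ratr q.1 - (m.+1%:R)^-1 < (tnth x k).1 < ratr q.1 + (m.+1%:R)^-1) /\
     (ratr q.2 - (m.+1%:R)^-1 < (tnth x k).2 < ratr q.2 + (m.+1%:R)^-1).
    have [q1 h1] := ratnear (tnth x k).1; have [q2 h2] := ratnear (tnth x k).2.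
    by exists (q1, q2).
  have [q qP] := choice ratnear2.
  exists (finfun q, m) => //; split; first by move=> k; rewrite /= ffunE; exact: qP.
  move=> y yb; apply: rU; apply: le_lt_trans mr.
  apply: rnorm_le_coord => [|k]; first by rewrite mulr_ge0 // ltW.
  rewrite !mxE (le_trans (rnorm_le_ReIm _)) //=.
  have := yb k; rewrite /= ffunE; have := qP k.
  move: m1; set e := (m.+1%:R)^-1; move=> m1 [/andP[? ?] /andP[? ?]] [/andP[? ?] /andP[? ?]].
  rewrite (_ : e * 4 = 2 * e + 2 * e); last by ring.
  by apply: lerD; rewrite ler_norml; apply/andP; lra.
by apply: countable_bigcupT_measurable => //; exact: countableP.
Qed.

Lemma measurable_continuous_on U (g : V -> R) : open U ->
  (forall w, U w -> forall e : R, 0 < e -> exists2 r : R, 0 < r &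
     forall y, rnorm (y - w) < r -> `|g y - g w| < e) ->
  measurable_fun (@to_cvec R n @^-1` U) (fun x => g (to_cvec x) : measurableTypeR R).
Proof.
move=> oU gc; have mU := measurable_open oU.
apply: (measurability _ (RGenOInfty.measurableE R)).
move=> /= _ [_ [t ->] <-].
rewrite [X in measurable X](_ : _ = @to_cvec R n @^-1` [set w | U w /\ t < g w]); last first.
  by apply/seteqP; split=> x /=; rewrite in_itv /= andbT.
apply: measurable_open; rewrite openE => w [Uw tw]; apply/nbhs_rnormP.
have [r1 [r10 rU]] := open_ball oU Uw.
have [|r2 r20 rg] := gc w Uw (g w - t); first by rewrite subr_gt0.
exists (Num.min r1 r2); first by rewrite lt_min r10.
move=> y; rewrite lt_min => /andP[/rU Uy /rg gyw]; split=> //.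
by move: gyw; rewrite ltr_norml => /andP[]; lra.
Qed.

Lemma measurable_holomorphic U (f : V -> R[i]) : open U -> holomorphic_on U f ->
  [/\ measurable_fun (@to_cvec R n @^-1` U) (fun x => rnorm (f (to_cvec x)) : measurableTypeR R),
    measurable_fun (@to_cvec R n @^-1` U) (fun x => complex.Re (f (to_cvec x)) : measurableTypeR R) &
    measurable_fun (@to_cvec R n @^-1` U) (fun x => complex.Im (f (to_cvec x)) : measurableTypeR R)].
Proof.
move=> oU fU; have fc w : U w -> forall e : R, 0 < e -> exists2 r : R, 0 < r &
    forall y, rnorm (y - w) < r -> rnorm (f y - f w) < e.
  by move=> Uw; exact: (continuous_rnormP f w).1 (differentiable_continuous (fU w Uw)).
have lip (g : R[i] -> R) : (forall u v, `|g u - g v| <= rnorm (u - v)) ->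
    measurable_fun (@to_cvec R n @^-1` U) (fun x => g (f (to_cvec x)) : measurableTypeR R).
  move=> gl; apply: (@measurable_continuous_on U (g \o f) oU) => w Uw e e0.
  have [r r0 rf] := fc w Uw e e0.
  by exists r => // y /rf; apply: le_lt_trans; exact: gl.
split; first by apply: (lip (@rnorm _ _)) => u v; exact: rnorm_dist.
- by apply: (lip (@complex.Re _)) => u v; rewrite -raddfB Re_le_rnorm.
- by apply: (lip (@complex.Im _)) => u v; rewrite -raddfB Im_le_rnorm.
Qed.

End measurability.

Section volume_facts.
Variable R : realType.
Local Notation RR := (measurableTypeR R * measurableTypeR R)%type.
Local Notation leb := (@lebesgue_measure R).

Definition open_box n (D : R) : set (n.-tuple RR) := [set x | forall k,
  - D < (tnth x k).1 < D /\ - D < (tnth x k).2 < D].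

Lemma tnth_tcons0 n (p : RR) (x : n.-tuple RR) : tnth (tcons (p, x)) ord0 = p.
Proof. by rewrite (tnth_nth p). Qed.

Lemma tnth_tconsS n (p : RR) (x : n.-tuple RR) j :
  tnth (tcons (p, x)) (lift ord0 j) = tnth x j.
Proof. by rewrite !(tnth_nth p). Qed.

Lemma volume_open_box n (D : R) : 0 < D -> (volume R n (@open_box n D) < +oo)%E.
Proof.
move=> D0; elim: n => [|n ih]; first by rewrite /volume /= diracE; case: (_ \in _); exact: ltry.
have sqE : @tcons _ (RR : measurableType _) n @^-1` @open_box n.+1 D =
    (`]- D, D[%classic `*` `]- D, D[%classic) `*` @open_box n D.
  apply/seteqP; split=> -[p x].
    move=> h; split; last by move=> k; have := h (lift ord0 k); rewrite tnth_tconsS.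
    by have := h ord0; rewrite tnth_tcons0 /= !in_itv.
  rewrite /= !in_itv /= => -[h1 h2] k; case: (unliftP ord0 k) => [j ->|->].
    by rewrite tnth_tconsS; exact: h2.
  by rewrite tnth_tcons0.
have -> : volume R n.+1 (@open_box n.+1 D) =
    (plane R \x volume R n)%E ((`](- D)%R, D[%classic `*` `](- D)%R, D[%classic) `*` @open_box n D).
  by rewrite -sqE.
have mb : measurable (@open_box n D).
  exact: (@measurable_open_box R n (fun=> (- D, - D)) (fun=> (D, D))).
have mi : measurable (`]- D, D[%classic : set (measurableTypeR R)) by exact: measurable_itv.
rewrite product_measure1E //; last exact: measurableX.
have li : (leb `](- D)%R, D[%classic < +oo)%E.
  by rewrite lebesgue_measure_itv /=; case: ifP => _; exact: ltry.
have pE : (plane R (`](- D)%R, D[%classic `*` `](- D)%R, D[%classic) < +oo)%E.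
  rewrite [X in (X < _)%E](_ : _ = leb `](- D)%R, D[%classic * leb `](- D)%R, D[%classic)%E.
    by apply: lte_mul_pinfty => //; rewrite ge0_fin_numE.
  exact: product_measure1E.
apply: lte_mul_pinfty; [exact: measure_ge0| |exact: ih].
by rewrite ge0_fin_numE //; exact: measure_ge0.
Qed.

Lemma volume_bounded n (Omega : set 'rV[R[i]]_n) (D : R) : open Omega ->
  (forall w, Omega w -> rnorm w < D) -> (volume R n (@to_cvec R n @^-1` Omega) < +oo)%E.
Proof.
move=> oO OD; have [|D0] := leP D 0.
  move=> D0; rewrite (_ : _ @^-1` _ = set0) ?measure0 //; apply/seteqP; split=> // x /OD.
  by rewrite ltNge (le_trans D0) // rnorm_ge0.
apply: le_lt_trans (volume_open_box n D0); apply: le_measure; rewrite ?inE.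
- exact: measurable_open.
- exact: (@measurable_open_box R n (fun=> (- D, - D)) (fun=> (D, D))).
- move=> x /OD xD k; have := le_lt_trans (coord_le_rnorm (to_cvec x) k) xD.
  rewrite mxE => h; have := le_lt_trans (Re_le_rnorm _) h; have := le_lt_trans (Im_le_rnorm _) h.
  by rewrite /= !ltr_norml.
Qed.

(** ** Dilations *)

Section scaling.
Variable c : R.
Hypothesis c0 : 0 < c.

Lemma measurable_scale : measurable_fun setT (fun x : measurableTypeR R => c * x : measurableTypeR R).
Proof. exact: mulrl_measurable. Qed.

Lemma scale_line (g : measurableTypeR R -> \bar R) : measurable_fun setT g ->
  (forall x, (0 <= g x)%E) ->
  (\int[leb]_x g x = c%:E * \int[leb]_x g (c * x)%R)%E.
Proof.
move=> mg g0; pose k : {nonneg R} := NngNum (ltW c0).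
pose nu := mscale k (pushforward leb (fun x : measurableTypeR R => c * x : measurableTypeR R)).
have E A : measurable A -> leb A = nu measurable_scale A.
  move=> mA; apply: (@lebesgue_measure_unique _ (nu measurable_scale)) => // _ [[a b]] _ <-.
  change (leb `]a, b] = c%:E * leb ((fun x : measurableTypeR R => (c * x)%R : measurableTypeR R) @^-1` `]a, b]))%E.
  rewrite (_ : _ @^-1` _ = `]a / c, b / c]%classic); last first.
    apply/seteqP; split=> x /=; rewrite !in_itv /= ltr_pdivrMr // ler_pdivlMr // (mulrC x) //.
  rewrite !lebesgue_measure_itv /= !lte_fin ltr_pM2r ?invr_gt0 //.
  case: ifP => _; last by rewrite mule0.
  by rewrite -!EFinD -EFinM -mulrBl mulrC divfK // gt_eqF.
rewrite (eq_measure_integral (nu measurable_scale)); last by move=> A mA _; exact: E.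
rewrite ge0_integral_mscale // ge0_integral_pushforward //.
exact: measurable_scale.
Qed.

Lemma scale_plane (g : RR -> \bar R) : measurable_fun setT g -> (forall x, (0 <= g x)%E) ->
  (\int[plane R]_p g p = (c ^+ 2)%:E * \int[plane R]_p g (c * p.1, c * p.2)%R)%E.
Proof.
move=> mg g0.
have ms : measurable_fun setT (fun p : RR => (c * p.1, c * p.2)%R : RR).
  apply/measurable_fun_pairP; split.
    exact: (measurableT_comp measurable_scale measurable_fst).
  exact: (measurableT_comp measurable_scale measurable_snd).
have mgs := measurableT_comp mg ms.
have mV := @measurable_fun_fubini_tonelli_F _ _ _ _ _ leb _ mg g0.
rewrite plane_tonelli1 // (plane_tonelli1 mgs) //.
rewrite (@scale_line (fun x => \int[leb]_y g (x, y))%E) //; last by move=> x; exact: integral_ge0.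
rewrite expr2 EFinM -muleA; congr (_ * _)%E.
rewrite -ge0_integralZl //.
- apply: eq_integral => x _; rewrite (@scale_line (fun y => g (c * x, y)%R)) //.
  exact: (measurable_fun_pair2 (c * x)%R mg).
- exact: (@measurable_fun_fubini_tonelli_F _ _ _ _ _ leb _ mgs (fun=> g0 _)).
- by move=> x _; apply: integral_ge0 => y _; exact: g0.
- by rewrite lee_fin ltW.
- by move=> x; exact: g0.
Qed.

Definition scale_tuple n (x : n.-tuple RR) : n.-tuple RR :=
  [tuple of map (fun p : RR => (c * p.1, c * p.2)%R : RR) x].

Lemma to_cvec_scale n (x : n.-tuple RR) : to_cvec (scale_tuple x) = c%:C *: to_cvec x.
Proof.
by apply/rowP => k; rewrite !mxE tnth_map /=; apply/eqP; rewrite eq_complex /=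
  !(mul0r, subr0, addr0) !eqxx.
Qed.

Lemma measurable_scale_tuple n : measurable_fun setT (@scale_tuple n).
Proof.
apply/measurable_fun_tnthP => k.
have ms : measurable_fun setT (fun p : RR => (c * p.1, c * p.2)%R : RR).
  apply/measurable_fun_pairP; split.
    exact: (measurableT_comp measurable_scale measurable_fst).
  exact: (measurableT_comp measurable_scale measurable_snd).
rewrite (_ : _ \o _ = (fun p : RR => (c * p.1, c * p.2)%R : RR) \o (fun x : n.-tuple RR => tnth x k)).
  exact: (measurableT_comp ms (measurable_tnth k)).
by apply/funext => x /=; rewrite tnth_map.
Qed.

Lemma scale_volume n (G : n.-tuple RR -> \bar R) : measurable_fun setT G ->
  (forall x, (0 <= G x)%E) ->
  (\int[volume R n]_x G x = (c ^+ (2 * n))%:E * \int[volume R n]_x G (scale_tuple x))%E.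
Proof.
elim: n G => [|n ih] G mG G0.
  rewrite muln0 expr0 mul1e; apply: eq_integral => x _; congr G.
  by apply: eq_from_tnth => -[].
have mGs : measurable_fun setT (G \o @scale_tuple n.+1).
  exact: (measurableT_comp mG (@measurable_scale_tuple n.+1)).
rewrite volume_tonelli // (volume_tonelli mGs); last by move=> x; exact: G0.
have tE p x : scale_tuple (tcons (p, x)) = tcons ((c * p.1, c * p.2)%R, scale_tuple x) :> n.+1.-tuple RR.
  exact: val_inj.
have mGc := measurable_tcons_comp mG.
pose K p : \bar R := (\int[volume R n]_x G (tcons (p, scale_tuple x)))%E.
have mGc' : measurable_fun setT (fun q : RR * n.-tuple RR => G (tcons (q.1, scale_tuple q.2))).
  apply: (measurableT_comp mGc (_ : measurable_fun setT (fun q : RR * n.-tuple RR => (q.1, scale_tuple q.2)))).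
  apply/measurable_fun_pairP; split; first exact: measurable_fst.
  exact: (measurableT_comp (@measurable_scale_tuple n) measurable_snd).
have mK : measurable_fun setT K.
  exact: (@measurable_fun_fubini_tonelli_F _ _ _ _ _ (volume R n) _ mGc' (fun=> G0 _)).
have K0 p : (0 <= K p)%E by exact: integral_ge0.
have -> : (\int[plane R]_p \int[volume R n]_x G (tcons (p, x)) =
    \int[plane R]_p ((c ^+ (2 * n))%:E * K p))%E.
  apply: eq_integral => p _; rewrite (ih (fun x => G (tcons (p, x)))) //.
  exact: (measurable_fun_pair2 p mGc).
rewrite ge0_integralZl ?lee_fin ?exprn_ge0 ?(ltW c0) // (scale_plane mK) //.
rewrite muleA -EFinM -exprD mulnS addnC; congr (_ * _)%E.
by apply: eq_integral => p _; apply: eq_integral => x _; rewrite /= tE.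
Qed.

End scaling.

End volume_facts.

Section powers.
Variable R : realType.
Implicit Types x y p : R.

Lemma le_one_powR x p : 1 <= p -> 0 <= x -> x <= 1 + x `^ p.
Proof.
move=> p1 x0; have [x1|/ltW x1] := leP x 1; first by rewrite ler_wpDr // powR_ge0.
by rewrite (le_trans (le1r_powR x1 p1)) // lerDr.
Qed.

Lemma powR_add_le x y p : 0 <= p -> 0 <= x -> 0 <= y ->
  (x + y) `^ p <= 2 `^ p * (x `^ p + y `^ p).
Proof.
move=> p0; wlog xy : x y / x <= y.
  move=> h; have [xy|/ltW yx] := leP x y; first exact: h.
  by move=> x0 y0; rewrite addrC [X in _ * X]addrC; exact: h.
move=> x0 y0; apply: (@le_trans _ _ ((2 * y) `^ p)).
  by apply: ge0_ler_powR => //; rewrite ?nnegrE ?addr_ge0 ?mulr_ge0 //; lra.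
by rewrite powRM // ler_wpM2l ?powR_ge0 // lerDr powR_ge0.
Qed.

Lemma powRVK x p : 0 < p -> 0 <= x -> (x `^ p) `^ p^-1 = x.
Proof. by move=> p0 x0; rewrite -powRrM mulfV ?gt_eqF // powRr1. Qed.

End powers.

Section Lp.
Context (R : realType) (n : nat).
Local Notation V := 'rV[R[i]]_n.
Local Notation RR := (measurableTypeR R * measurableTypeR R)%type.
Local Notation vol := (volume R n).
Implicit Types (Omega : set V) (f h : V -> R[i]) (p M : R).

Definition Lp_int Omega p f : \bar R :=
  (\int[vol]_(x in @to_cvec R n @^-1` Omega) (rnorm (f (to_cvec x)) `^ p)%R%:E)%E.

Lemma Lp_int_ge0 Omega p f : (0 <= Lp_int Omega p f)%E.
Proof. by apply: integral_ge0 => x _; rewrite lee_fin powR_ge0. Qed.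

Lemma measurable_pow_rnorm Omega p f : open Omega -> holomorphic_on Omega f ->
  measurable_fun (@to_cvec R n @^-1` Omega) (fun x => (rnorm (f (to_cvec x)) `^ p)%R%:E : \bar R).
Proof.
move=> oO fO; have [m1 _ _] := measurable_holomorphic oO fO.
apply/measurable_EFinP.
exact: (measurableT_comp (@measurable_powR R p : measurable_fun (setT : set (measurableTypeR R)) _) m1).
Qed.

Lemma Lp_norm_le Omega p f M : 0 < p -> 0 <= M ->
  (Lp_int Omega p f <= (M `^ p)%:E)%E -> (Lp_norm Omega p f <= M%:E)%E.
Proof.
move=> p0 M0 h; rewrite -[X in (_ <= X%:E)%E](powRVK p0 M0) -poweR_EFin.
apply: gt0_ler_poweR => //; first by rewrite invr_ge0 ltW.
  by rewrite in_itv /= leey andbT; exact: Lp_int_ge0.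
by rewrite in_itv /= leey andbT lee_fin powR_ge0.
Qed.

Lemma Lp_int_le Omega p f M : 0 < p -> 0 <= M ->
  (Lp_norm Omega p f <= M%:E)%E -> (Lp_int Omega p f <= (M `^ p)%:E)%E.
Proof.
move=> p0 M0 h; have -> : Lp_int Omega p f = (Lp_norm Omega p f `^ p)%E.
  rewrite /Lp_norm -poweRrM mulVf ?gt_eqF // poweRe1 //; exact: Lp_int_ge0.
rewrite -poweR_EFin; apply: gt0_ler_poweR => //; rewrite ?(ltW p0) // in_itv /= leey andbT.
  exact: poweR_ge0.
by rewrite lee_fin.
Qed.

Lemma bergmanP Omega p f : 0 < p ->
  bergman Omega p f <-> holomorphic_on Omega f /\ (Lp_int Omega p f < +oo)%E.
Proof.
move=> p0; split=> -[fO h]; split=> //.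
  by apply: lty_poweRy h; rewrite invr_eq0 gt_eqF.
exact: poweR_lty.
Qed.

Lemma bergman_norm Omega p f : bergman Omega p f ->
  exists2 M : R, 0 <= M & Lp_norm Omega p f = M%:E.
Proof.
move=> [_ h]; have h0 : (0 <= Lp_norm Omega p f)%E by exact: poweR_ge0.
exists (fine (Lp_norm Omega p f)); first exact: fine_ge0.
by rewrite fineK // ge0_fin_numE.
Qed.

Lemma Lp_int_sub Omega p f h : open Omega -> 0 <= p -> holomorphic_on Omega f ->
  holomorphic_on Omega h ->
  (Lp_int Omega p (fun z => f z - h z)%R
   <= (2 `^ p)%:E * (Lp_int Omega p f + Lp_int Omega p h))%E.
Proof.
move=> oO p0 fO hO; have mO := measurable_open oO.
rewrite /Lp_int -ge0_integralD //; [|by move=> x _; rewrite lee_fin powR_ge0|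
  exact: measurable_pow_rnorm|by move=> x _; rewrite lee_fin powR_ge0|exact: measurable_pow_rnorm].
rewrite -ge0_integralZl //; [|apply: emeasurable_funD; exact: measurable_pow_rnorm|
  by move=> x _; rewrite -EFinD lee_fin addr_ge0 ?powR_ge0].
apply: ge0_le_integral => //.
- by move=> x _; rewrite lee_fin powR_ge0.
- apply: (@measurable_pow_rnorm _ _ (fun z => f z - h z) oO) => z zO.
  by apply: differentiableB; [exact: fO|exact: hO].
- apply: measurable_funeM; apply: emeasurable_funD; exact: measurable_pow_rnorm.
- move=> x _; rewrite -EFinD -EFinM lee_fin; apply: le_trans (powR_add_le p0 _ _); rewrite ?rnorm_ge0 //.
  by apply: ge0_ler_powR; rewrite ?nnegrE ?addr_ge0 ?rnorm_ge0 // rnormDB.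
Qed.

Lemma Lp_int_scale Omega p f (c : R[i]) : open Omega -> holomorphic_on Omega f ->
  Lp_int Omega p (fun z => c * f z) = ((rnorm c `^ p)%:E * Lp_int Omega p f)%E.
Proof.
move=> oO fO; rewrite /Lp_int -ge0_integralZl //.
- by apply: eq_integral => x _; rewrite rnormM powRM ?rnorm_ge0.
- exact: measurable_open.
- exact: measurable_pow_rnorm.
- by move=> x _; rewrite lee_fin powR_ge0.
- by rewrite lee_fin powR_ge0.
Qed.

Lemma bergman_lin Omega p f h (c : R[i]) : open Omega -> 0 < p -> bergman Omega p f ->
  bergman Omega p h -> bergman Omega p (fun z => c * f z + h z).
Proof.
move=> oO p0 fB hB; have [fO fi] := (bergmanP Omega f p0).1 fB.
have [hO hi] := (bergmanP Omega h p0).1 hB; apply: (bergmanP _ _ p0).2.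
have cfO : holomorphic_on Omega (fun z => c * f z).
  by move=> z zO; apply: differentiableM; [exact: differentiable_cst|exact: fO].
have nhO : holomorphic_on Omega (fun z => - 1 * h z).
  by move=> z zO; apply: differentiableM; [exact: differentiable_cst|exact: hO].
split.
  by move=> z zO; apply: differentiableD; [exact: cfO|exact: hO].
rewrite (_ : (fun z => _) = (fun z => c * f z - (- 1 * h z))); last first.
  by apply/funext => z; rewrite mulN1r opprK.
apply: le_lt_trans (Lp_int_sub oO (ltW p0) cfO nhO) _.
have scale_fin (c' : R[i]) k : holomorphic_on Omega k -> (Lp_int Omega p k < +oo)%E ->
    (Lp_int Omega p (fun z => c' * k z)%R < +oo)%E.
  move=> kO ki; rewrite (Lp_int_scale p c' oO kO).
  by apply: lte_mul_pinfty ki; rewrite ?lee_fin ?powR_ge0.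
apply: lte_mul_pinfty; rewrite ?lee_fin ?powR_ge0 //.
by apply: lte_add_pinfty; exact: scale_fin.
Qed.

Lemma Lp_int_sup Omega p f M : open Omega -> 0 < p -> 0 <= M -> holomorphic_on Omega f ->
  (forall z, Omega z -> rnorm (f z) <= M) ->
  (Lp_int Omega p f <= (M `^ p)%:E * vol (@to_cvec R n @^-1` Omega))%E.
Proof.
move=> oO p0 M0 fO fM; have mO := measurable_open oO.
rewrite -integral_cst //; apply: ge0_le_integral => //.
- by move=> x _; rewrite lee_fin powR_ge0.
- exact: measurable_pow_rnorm.
- by move=> x xO; rewrite lee_fin; apply: ge0_ler_powR; rewrite ?nnegrE ?rnorm_ge0 ?fM // ltW.
Qed.

Lemma in_box_rnorm (a w : V) (e : R) : 0 <= e -> in_box a e w -> rnorm (w - a) <= 2 * e.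
Proof.
move=> e0 aw; apply: rnorm_le_coord; first by rewrite mulr_ge0.
move=> k; rewrite !mxE; apply: le_trans (rnorm_le_ReIm _) _.
have [/andP[h1 h2] /andP[h3 h4]] := aw k.
rewrite !raddfB /= mulr2n mulrDl mul1r lerD // ler_norml; apply/andP; split; lra.
Qed.

(** A subharmonicity estimate: the value at the centre of a polydisc is controlled by
    the mean of [1 + `|f| ^ p], and homogeneity removes the additive constant. *)
Lemma Lp_eval Omega p f (a : V) (d M : R) : open Omega ->
  (vol (@to_cvec R n @^-1` Omega) < +oo)%E -> 1 <= p -> 0 < d -> 0 <= M ->
  (forall w, rnorm (w - a) <= 4 * d -> Omega w) -> holomorphic_on Omega f ->
  (Lp_norm Omega p f <= M%:E)%E ->
  rnorm (f a) <= (2 / d ^+ 2) ^+ n * (fine (vol (@to_cvec R n @^-1` Omega)) + 1) * M.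
Proof.
move=> oO volO p1 d0 M0 aO fO fM; have mO := measurable_open oO.
have p0 : 0 < p by lra.
set W := _ @^-1` Omega in volO *; set Cd := (2 / d ^+ 2) ^+ n.
have Cd0 : 0 <= Cd by rewrite exprn_ge0 // divr_ge0 // exprn_ge0 // ltW.
have v0 : 0 <= fine (vol W) by apply: fine_ge0; exact: measure_ge0.
suff key l : 0 < l -> M <= l -> rnorm (f a) <= Cd * (fine (vol W) + 1) * l.
  apply/ler_addgt0Pr => e e0; set D := Cd * (fine (vol W) + 1).
  have D0 : 0 <= D by rewrite mulr_ge0 // addr_ge0.
  have eD : 0 < e / (D + 1) by rewrite divr_gt0 // ltr_wpDl.
  apply: le_trans (key (M + e / (D + 1)) _ _) _; first by rewrite ltr_wpDl.
    by rewrite lerDl ltW.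
  rewrite mulrDr lerD2l mulrCA ger_pMr // ler_pdivrMr ?mul1r ?ltr_wpDl //.
  by rewrite lerDl.
move=> l0 Ml.
have fl : (Lp_int Omega p f <= (l `^ p)%:E)%E.
  by apply: Lp_int_le => //; [exact: ltW|exact: le_trans fM _].
pose F z := l^-1%:C * f z.
have FO : holomorphic_on Omega F.
  by move=> z zO; apply: differentiableM; [exact: differentiable_cst|exact: fO].
have F1 : (Lp_int Omega p F <= 1)%E.
  rewrite Lp_int_scale // rnorm_real ger0_norm ?invr_ge0 ?(ltW l0) //.
  apply: le_trans (lee_wpmul2l _ fl) _; first by rewrite lee_fin powR_ge0.
  by rewrite -EFinM -powRM ?invr_ge0 ?(ltW l0) // mulVf ?gt_eqF // powR1.
suff h : rnorm (F a) <= Cd * (fine (vol W) + 1).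
  move: h; rewrite /F rnormM rnorm_real ger0_norm ?invr_ge0 ?(ltW l0) //.
  by rewrite mulrC ler_pdivrMr.
pose H : n.-tuple RR -> \bar R :=
  (fun x => (1 + rnorm (F (to_cvec x)) `^ p)%:E) \_ W.
have mF := measurable_pow_rnorm p oO FO.
have mH : measurable_fun setT H.
  apply/(measurable_restrictT _ _).1 => //.
  under eq_fun do rewrite EFinD.
  exact: emeasurable_funD.
have HE : (\int[vol]_x H x = vol W + Lp_int Omega p F)%E.
  rewrite /H -integral_mkcond.
  under eq_integral do rewrite EFinD.
  rewrite ge0_integralD //; last by move=> x _; rewrite lee_fin powR_ge0.
  by rewrite integral_cst // mul1e.
rewrite -lee_fin.
apply: le_trans (@polydisc_mean R n F a d H d0 _ mH _ _) _.
- move=> w wb k; have wO : Omega w.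
    apply: aO; apply: le_trans (in_box_rnorm _ wb) _; lra.
  exact: (differentiable_line _ (FO _ wO)).
- move=> x; rewrite /H patchE; case: ifP => // _; rewrite lee_fin addr_ge0 ?powR_ge0 //.
- move=> x xb; have wO : Omega (to_cvec x).
    apply: aO; apply: le_trans (in_box_rnorm _ xb) _; lra.
  rewrite /H patchE mem_set // lee_fin; apply: le_one_powR => //; exact: rnorm_ge0.
- rewrite HE EFinM; apply: lee_wpmul2l; first by rewrite lee_fin.
  by rewrite EFinD fineK ?leeD // ge0_fin_numE.
Qed.

End Lp.

Section geometry.
Context (R : realType) (n : nat).
Local Notation V := 'rV[R[i]]_n.
Implicit Types (Omega K : set V).

Lemma convex_combination Omega (z w : V) (t : R) : convex_subset Omega -> Omega z -> Omega w ->
  0 <= t <= 1 -> Omega (t%:C *: z + (1 - t)%:C *: w).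
Proof.
move=> cO Oz Ow /andP[t0 t1].
have tI : Itv.spec (@Itv.num_sem R[i]) (Itv.Real `[0%Z, 1%Z]) t%:C.
  by apply/and3P; split; rewrite ?realE ?bnd_simp ?lecR ?ler0c ?t0 ?t1 //= ?ler0c ?lecR ?t0 ?t1.
have := cO z w (Itv.Def tI).
by rewrite !inE => /(_ Oz Ow); rewrite /conv /= /unstable.onem rmorphB.
Qed.

Lemma star_shaped Omega (z : V) (t : R) : convex_subset Omega -> Omega 0 -> Omega z ->
  0 <= t <= 1 -> Omega (t%:C *: z).
Proof. by move=> cO O0 Oz /(convex_combination cO Oz O0); rewrite scaler0 addr0. Qed.

Lemma finite_net K (r : V -> R) : compact K -> (forall a, K a -> 0 < r a) ->
  exists s : seq V, (forall a, a \in s -> K a) /\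
    forall w, K w -> exists2 a, a \in s & rnorm (w - a) < r a.
Proof.
move=> cK r0; pose B a : set V := [set w | rnorm (w - a) < r a].
have oB a : K a -> open (B a).
  move=> Ka; rewrite openE => w /= wB; apply/nbhs_rnormP.
  exists (r a - rnorm (w - a)); first by rewrite subr_gt0.
  move=> v vw; apply: le_lt_trans (rnorm_tri w _ _) _.
  by rewrite -ltrBrDr.
move: cK; rewrite compact_cover => /(_ V K B oB)[].
  by move=> w Kw; exists w => //=; rewrite /B /= subrr rnorm0 r0.
move=> D DK KD; exists (finmap.enum_fset D); split.
  by move=> a aD; have := DK a aD; rewrite inE.
by move=> w /KD[a /= aD aB]; exists a.
Qed.

Lemma compact_thickening K Omega : compact K -> open Omega -> K `<=` Omega ->
  exists2 d : R, 0 < d & forall w, K w -> forall y, rnorm (y - w) < d -> Omega y.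
Proof.
move=> cK oO KO.
have ball a : exists r : R, 0 < r /\ (K a -> forall y, rnorm (y - a) < r -> Omega y).
  have [Ka|nKa] := pselect (K a); last by exists 1.
  by have [r [r0 rO]] := open_ball oO (KO _ Ka); exists r.
have [r rP] := choice ball.
have r20 a : K a -> 0 < r a / 2 by move=> _; rewrite divr_gt0 // (rP a).1.
have [s [sK sP]] := finite_net cK r20.
have [d d0 ds] : exists2 d : R, 0 < d & forall a, a \in s -> d <= r a / 2.
  elim: s {sK sP} => [|a s [d d0 ds]]; first by exists 1.
  exists (Num.min d (r a / 2)); first by rewrite lt_min d0 divr_gt0 // (rP a).1.
  move=> b; rewrite inE ge_min => /orP[/eqP ->|/ds ->//].
  by rewrite lexx orbT.
exists d => // w Kw y yw; have [a sa wa] := sP w Kw.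
apply: ((rP a).2 (sK a sa)); apply: le_lt_trans (rnorm_tri w _ _) _.
have := lt_le_trans yw (ds a sa); move: wa; set u := rnorm _; set v := rnorm _; lra.
Qed.

End geometry.

Section complex_integral.
Context d (T : measurableType d) (R : realType) (mu : {measure set T -> \bar R})
  (D : set T).
Hypothesis mD : measurable D.
Implicit Types F G : T -> R[i].

Definition cintegrable F :=
  mu.-integrable D (EFin \o (fun x => complex.Re (F x))) /\
  mu.-integrable D (EFin \o (fun x => complex.Im (F x))).

Lemma Re_lin (a x y : R[i]) : complex.Re (a * x + y) =
  complex.Re a * complex.Re x + (- complex.Im a) * complex.Im x + complex.Re y.
Proof. by case: a x y => [? ?] [? ?] [? ?] /=; rewrite mulNr. Qed.

Lemma Im_lin (a x y : R[i]) : complex.Im (a * x + y) =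
  complex.Re a * complex.Im x + complex.Im a * complex.Re x + complex.Im y.
Proof. by case: a x y => [? ?] [? ?] [? ?]. Qed.

Lemma integrable_lin3 (u v w : T -> R) (a b : R) : mu.-integrable D (EFin \o u) ->
  mu.-integrable D (EFin \o v) -> mu.-integrable D (EFin \o w) ->
  mu.-integrable D (EFin \o (fun x => a * u x + b * v x + w x)) /\
  \int[mu]_(x in D) (a * u x + b * v x + w x) =
  a * \int[mu]_(x in D) u x + b * \int[mu]_(x in D) v x + \int[mu]_(x in D) w x.
Proof.
move=> ui vi wi.
have aui : mu.-integrable D (EFin \o (fun x => a * u x)).
  exact: (integrableZl mD a ui).
have bvi : mu.-integrable D (EFin \o (fun x => b * v x)).
  exact: (integrableZl mD b vi).
have abi : mu.-integrable D (EFin \o (fun x => a * u x + b * v x)).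
  exact: (integrableD mD aui bvi).
split; first exact: (integrableD mD abi wi).
by rewrite RintegralD // RintegralD // !RintegralZl.
Qed.

Lemma cintegrable_lin F G (a : R[i]) : cintegrable F -> cintegrable G ->
  cintegrable (fun x => a * F x + G x).
Proof.
move=> [F1 F2] [G1 G2]; split.
  rewrite (_ : _ \o _ = EFin \o (fun x => complex.Re a * complex.Re (F x) +
    - complex.Im a * complex.Im (F x) + complex.Re (G x))).
    exact: (integrable_lin3 _ _ F1 F2 G1).1.
  by apply/funext => x /=; rewrite Re_lin.
rewrite (_ : _ \o _ = EFin \o (fun x => complex.Re a * complex.Im (F x) +
  complex.Im a * complex.Re (F x) + complex.Im (G x))).
  exact: (integrable_lin3 _ _ F2 F1 G2).1.
by apply/funext => x /=; rewrite Im_lin.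
Qed.

Lemma cRintegral_lin F G (a : R[i]) : cintegrable F -> cintegrable G ->
  cRintegral mu D (fun x => a * F x + G x) = a * cRintegral mu D F + cRintegral mu D G.
Proof.
move=> [F1 F2] [G1 G2]; rewrite /cRintegral.
under eq_Rintegral do rewrite Re_lin.
under [in X in _ +i* X]eq_Rintegral do rewrite Im_lin.
rewrite (integrable_lin3 _ _ F1 F2 G1).2 (integrable_lin3 _ _ F2 F1 G2).2.
apply/eqP; rewrite eq_complex Re_lin Im_lin /=.
by rewrite !eqxx.
Qed.

Lemma eq_cRintegral F G : (forall x, D x -> F x = G x) -> cRintegral mu D F = cRintegral mu D G.
Proof.
move=> FG; rewrite /cRintegral; congr (_ +i* _);
by apply: eq_Rintegral => x; rewrite inE => /FG ->.
Qed.

Lemma cRintegral_bound F (B : R) : (mu D = 1)%E -> cintegrable F ->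
  (forall x, D x -> rnorm (F x) <= B) -> rnorm (cRintegral mu D F) <= 2 * B.
Proof.
move=> muD [F1 F2] FB; apply: le_trans (rnorm_le_ReIm _) _.
have cB : mu.-integrable D (EFin \o cst B).
  apply: measurable_bounded_integrable => //; first by rewrite muD ltry.
  by exists `|B|; split=> [|M /ltW BM x _] //; rewrite num_real.
have key (u : T -> R) : mu.-integrable D (EFin \o u) -> (forall x, D x -> `|u x| <= B) ->
    `|\int[mu]_(x in D) u x| <= B.
  move=> ui uB; apply: le_trans (le_normr_Rintegral _ ui) _ => //.
  apply: (@le_trans _ _ (\int[mu]_(x in D) cst B x)).
    by apply: le_Rintegral => //; exact: integrable_norm.
  by rewrite Rintegral_cst // muD mulr1.
rewrite mulr2n mulrDl mul1r; apply: lerD.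
  by apply: key => // x /FB; apply: le_trans; exact: Re_le_rnorm.
by apply: key => // x /FB; apply: le_trans; exact: Im_le_rnorm.
Qed.

End complex_integral.

Section radial_integral.
Context (R : realType) (n : nat).
Local Notation V := 'rV[R[i]]_n.
Local Notation leb := (@lebesgue_measure R).
Variables (Omega K : set V) (g : V -> R[i]) (phi : V -> V) (alpha D G : R).
Hypotheses (oO : open Omega) (O0 : Omega 0)
  (star : forall z (t : R), Omega z -> 0 <= t <= 1 -> Omega (t%:C *: z))
  (OD : forall z, Omega z -> rnorm z < D) (KO : K `<=` Omega)
  (gO : holomorphic_on Omega g) (gG : forall z, Omega z -> rnorm (g z) <= G)
  (phiO : holomorphic_on Omega phi) (phiK : forall z, Omega z -> K (phi z))
  (phi0 : phi 0 = 0) (alpha0 : 0 <= alpha).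
Implicit Types f : V -> R[i].

Let phiOO z : Omega z -> Omega (phi z). Proof. by move=> /phiK/KO. Qed.

Let D0 : 0 < D. Proof. by apply: le_lt_trans (OD O0); exact: rnorm_ge0. Qed.

Let G0 : 0 <= G. Proof. exact: le_trans (rnorm_ge0 _) (gG O0). Qed.

(** The Schwarz lemma, up to a constant. *)
Lemma self_map_growth : exists2 C : R, 0 <= C & forall z, Omega z -> rnorm (phi z) <= C * rnorm z.
Proof.
have [r [r0 rO]] := open_ball oO O0.
exists (4 * D / r); first by rewrite divr_ge0 ?mulr_ge0 // ltW.
move=> z zO; have [zr|zr] := ltP (rnorm z) (r / 2); last first.
  apply: le_trans (ltW (OD (phiOO zO))) _.
  rewrite mulrAC ler_pdivlMr // -mulrA mulrCA ler_wpM2l ?ltW //.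
  by move: zr; set u := rnorm _; lra.
apply: rnorm_le_coord => [|k]; first by rewrite mulr_ge0 ?rnorm_ge0 // divr_ge0 ?mulr_ge0 // ltW.
have phik : line_hol (fun z => phi z ord0 k) 0 r D.
  apply: differentiable_line_hol => w; move/rO => wO; split.
    exact: le_trans (coord_le_rnorm _ _) (ltW (OD (phiOO wO))).
  apply: (@differentiable_comp _ _ _ _ phi (fun M : V => M ord0 k)); first exact: phiO.
  exact: differentiable_coord.
have := line_hol_lipschitz r0 phik zr.
by rewrite add0r phi0 mxE subr0.
Qed.

Definition radial_integrand f z (t : R) : R[i] :=
  radial_deriv f (phi (t%:C *: z)) * g (t%:C *: z) * (t `^ (alpha - 1))%:C.

Let B (C d : R) := n%:R * C * D * 4 / d * G.

Lemma radial_integrand_bound C d f (M : R) : 0 <= C -> 0 < d ->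
  (forall z, Omega z -> rnorm (phi z) <= C * rnorm z) ->
  (forall w, K w -> line_hol f w d M) ->
  forall z, Omega z -> forall t, 0 <= t <= 1 -> rnorm (radial_integrand f z t) <= B C d * M.
Proof.
move=> C0 d0 phiC fK z zO t tI; have M0 := line_hol_ge0 d0 (fK _ (phiK O0)).
have tzO := star zO tI; case/andP: tI => t0 t1.
rewrite /radial_integrand !rnormM rnorm_real ger0_norm ?powR_ge0 //.
have B0 : 0 <= B C d * M.
  by rewrite !mulr_ge0 ?invr_ge0 ?(ltW D0) ?(ltW d0).
have [->|tn0] := eqVneq t 0.
  rewrite scale0r phi0 (_ : radial_deriv f 0 = 0) ?rnorm0 ?mul0r //.
  by rewrite /radial_deriv big1 // => k _; rewrite mxE mul0r.
have tp : 0 < t by rewrite lt0r tn0.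
have h1 : rnorm (radial_deriv f (phi (t%:C *: z))) <= n%:R * ((C * (t * D)) * (4 * M / d)).
  apply: le_trans (radial_deriv_bound d0 (fK _ (phiK tzO))) _.
  rewrite ler_wpM2l // ler_wpM2r ?divr_ge0 ?mulr_ge0 ?(ltW d0) //.
  apply: le_trans (phiC _ tzO) _; rewrite ler_wpM2l // rnormZ rnorm_real ger0_norm //.
  by rewrite ler_wpM2l // ltW // OD.
have h2 : rnorm (radial_deriv f (phi (t%:C *: z))) * rnorm (g (t%:C *: z)) <=
    n%:R * ((C * (t * D)) * (4 * M / d)) * G.
  by apply: ler_pM; rewrite ?rnorm_ge0 // gG.
apply: le_trans (ler_wpM2r (powR_ge0 t (alpha - 1)) h2) _.
have -> : n%:R * ((C * (t * D)) * (4 * M / d)) * G * t `^ (alpha - 1) =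
    B C d * M * (t * t `^ (alpha - 1)) by rewrite /B; ring.
rewrite ler_piMr // -{1}(powRr1 t0) -powRD; last by apply/implyP => _.
by rewrite addrC subrK -(powRr0 t); apply: ger_powR => //; rewrite tp.
Qed.

Lemma holomorphic_composite f : holomorphic_on Omega f ->
  holomorphic_on Omega (fun w => radial_deriv f (phi w) * g w).
Proof.
move=> fO w wO; apply: differentiableM; last exact: gO.
apply: (@differentiable_comp _ _ _ _ phi (radial_deriv f)); first exact: phiO.
exact: (holomorphic_radial_deriv oO fO (phiOO wO)).
Qed.

Lemma differentiable_dilation f z (t : R) : holomorphic_on Omega f -> Omega (t%:C *: z) ->
  differentiable (fun z => f (t%:C *: z)) z.
Proof.
move=> fO zO; apply: (@differentiable_comp _ _ _ _ (fun z : V => t%:C *: z) f).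
  apply: differentiableZ; exact: ex_diff.
exact: fO.
Qed.

Lemma continuous_along_ray f z (t : R) : holomorphic_on Omega f -> Omega (t%:C *: z) ->
  forall e : R, 0 < e -> exists2 r : R, 0 < r &
    forall s : R, `|s - t| < r -> rnorm (f (s%:C *: z) - f (t%:C *: z)) < e.
Proof.
move=> fO zO e e0.
have /continuous_rnormP/(_ e e0)[r r0 rf] := differentiable_continuous (fO _ zO).
have z1 : 0 < rnorm z + 1 by rewrite ltr_wpDl // rnorm_ge0.
exists (r / (rnorm z + 1)); first by rewrite divr_gt0.
move=> s st; apply: rf; rewrite -scalerBl -rmorphB rnormZ rnorm_real.
apply: le_lt_trans (_ : `|s - t| * (rnorm z + 1) < r); last by rewrite -ltr_pdivlMr.
by rewrite ler_wpM2l // lerDl.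
Qed.

Lemma cintegrable_radial_integrand C d f (M : R) : 0 <= C -> 0 < d ->
  (forall z, Omega z -> rnorm (phi z) <= C * rnorm z) -> holomorphic_on Omega f ->
  (forall w, K w -> line_hol f w d M) -> forall z, Omega z ->
  cintegrable leb `[0, 1] (radial_integrand f z).
Proof.
move=> C0 d0 phiC fO fK z zO; have bd := radial_integrand_bound C0 d0 phiC fK zO.
have UO := holomorphic_composite fO.
have fin : (leb `[0%R, 1%R]%classic < +oo)%E by rewrite lebesgue_measure_itv /= lte_fin ltr01 ltry.
have mpow : measurable_fun (`[0, 1]%classic : set (measurableTypeR R))
    (fun t => t `^ (alpha - 1) : measurableTypeR R).
  apply: measurable_funTS; exact: measurable_powR.
have part (p : R[i] -> R) : (forall x y, p (x - y) = p x - p y) ->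
    (forall x, `|p x| <= rnorm x) -> (forall x (c : R), p (x * c%:C) = p x * c) ->
    leb.-integrable `[0, 1] (EFin \o (fun t => p (radial_integrand f z t))).
  move=> pB pn pZ; apply: measurable_bounded_integrable => //.
  - have -> : (fun t => p (radial_integrand f z t)) =
        (fun t => p (radial_deriv f (phi (t%:C *: z)) * g (t%:C *: z)) * (t `^ (alpha - 1))).
      by apply/funext => t; exact: pZ.
    apply: measurable_funM mpow; apply/measurable_EFinP.
    apply: (@measurable_int _ _ _ leb); apply: (@integrable_itvcc R _ 0 1) => t tI.
    apply/cvgrPdist_lt => e e0.
    have [r r0 rU] := continuous_along_ray UO (star zO tI) e0.
    near=> s; rewrite distrC -pB; apply: le_lt_trans (pn _) _; apply: rU.
    by rewrite distrC; near: s; exact: cvgr_dist_lt.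
  - exists (B C d * M); split=> [|x Bx t /=]; first by rewrite num_real.
    rewrite in_itv /= => tI; apply: le_trans (ltW Bx).
    exact: le_trans (pn _) (bd _ tI).
split; apply: part; [exact: raddfB|exact: Re_le_rnorm| |exact: raddfB|exact: Im_le_rnorm|].
  by case=> a b c /=; rewrite mulr0 subr0.
by case=> a b c /=; rewrite mulr0 add0r.
Unshelve. all: by end_near. Qed.

Let leb01 : leb `[0%R, 1%R]%classic = 1%E.
Proof. by rewrite lebesgue_measure_itv /= lte_fin ltr01 oppr0 adde0. Qed.

Let m01 : measurable (`[0, 1]%classic : set (measurableTypeR R)).
Proof. exact: measurable_itv. Qed.

Section bounds.
Variables (C d : R).
Hypotheses (C0 : 0 <= C) (d0 : 0 < d)
  (phiC : forall z, Omega z -> rnorm (phi z) <= C * rnorm z).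

Lemma C_op_bound f (M : R) : holomorphic_on Omega f -> (forall w, K w -> line_hol f w d M) ->
  forall z, Omega z -> rnorm (C_op alpha g phi f z) <= 2 * (B C d * M).
Proof.
move=> fO fK z zO; apply: (cRintegral_bound m01 leb01 (cintegrable_radial_integrand C0 d0 phiC fO fK zO)).
by move=> t /=; rewrite in_itv /=; exact: (radial_integrand_bound C0 d0 phiC fK zO).
Qed.

Lemma derive_lin f h (a : R[i]) w v : differentiable f w -> differentiable h w ->
  'D_v (fun z => a * f z + h z) w = a * 'D_v f w + 'D_v h w.
Proof.
move=> fw hw; have df := line_derivable (differentiable_line v fw).
have dh := line_derivable (differentiable_line v hw).
rewrite -[a * 'D_v f w]/(a *: 'D_v f w) -(deriveZ a df).
exact: (deriveD (derivableZ (k := a) df) dh).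
Qed.

Lemma radial_integrand_lin f h (a : R[i]) z t : holomorphic_on Omega f ->
  holomorphic_on Omega h -> Omega z -> 0 <= t <= 1 ->
  radial_integrand (fun w => a * f w + h w) z t =
  a * radial_integrand f z t + radial_integrand h z t.
Proof.
move=> fO hO zO tI; have wO := phiOO (star zO tI).
have rlin : radial_deriv (fun w => a * f w + h w) (phi (t%:C *: z)) =
    a * radial_deriv f (phi (t%:C *: z)) + radial_deriv h (phi (t%:C *: z)).
  rewrite /radial_deriv mulr_sumr -big_split /=; apply: eq_bigr => k _.
  by rewrite (derive_lin a _ (fO _ wO) (hO _ wO)) mulrDr mulrCA.
by rewrite /radial_integrand rlin !mulrDl !mulrA.
Qed.

Lemma C_op_lin f h (a : R[i]) (M N : R) : holomorphic_on Omega f ->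
  holomorphic_on Omega h -> (forall w, K w -> line_hol f w d M) ->
  (forall w, K w -> line_hol h w d N) -> forall z, Omega z ->
  C_op alpha g phi (fun w => a * f w + h w) z = a * C_op alpha g phi f z + C_op alpha g phi h z.
Proof.
move=> fO hO fK hK z zO.
have E : cRintegral leb `[0, 1] (radial_integrand (fun w => a * f w + h w) z) =
    cRintegral leb `[0, 1] (fun t => a * radial_integrand f z t + radial_integrand h z t).
  by apply: eq_cRintegral => t /=; rewrite in_itv /=; exact: radial_integrand_lin.
exact: (etrans E (cRintegral_lin m01 a (cintegrable_radial_integrand C0 d0 phiC fO fK zO)
  (cintegrable_radial_integrand C0 d0 phiC hO hK zO))).
Qed.

(** The three-point estimate passes through the integral sign. *)
Lemma C_op_holomorphic f (M : R) : holomorphic_on Omega f -> (forall w, K w -> line_hol f w d M) ->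
  holomorphic_on Omega (C_op alpha g phi f).
Proof.
move=> fO fK; apply: line_hol_holomorphic => a aO.
have [r [r0 rO]] := open_ball oO aO.
exists r, (2 * (B C d * M)); split; [exact: r0|apply: three_point_line_hol].
have line_t t : 0 <= t <= 1 -> three_point (fun z => radial_integrand f z t) a r (B C d * M).
  move=> tI; apply: line_hol_three_point => w /rO wO; split.
    exact: (radial_integrand_bound C0 d0 phiC fK wO).
  move=> v; apply: (@differentiable_line _ _ (fun z => radial_integrand f z t)).
  apply: differentiableM; last exact: differentiable_cst.
  exact: (differentiable_dilation (holomorphic_composite fO) (star wO tI)).
split; first by move=> w /rO wO; exact: C_op_bound.
move=> x s v t t' s0 xs t0 t'0 ts t's.
have inO (u : R[i]) : rnorm u * rnorm v < s / 4 -> Omega (x + u *: v).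
  move=> us; apply: rO; apply: le_lt_trans (rnorm_tri x _ _) _.
  rewrite [x + u *: v]addrC addrK rnormZ; move: xs us.
  by set p := rnorm _; set q := _ * _; lra.
have xO : Omega x by have := inO 0; rewrite scale0r addr0 rnorm0 mul0r; apply; rewrite divr_gt0.
have ki z : Omega z -> cintegrable leb `[0, 1] (radial_integrand f z).
  exact: (cintegrable_radial_integrand C0 d0 phiC fO fK).
have c0 : cintegrable leb `[0, 1] (fun=> 0 : R[i]).
  by split; apply: integrable0.
have I0 : cRintegral leb `[0, 1] (fun=> 0 : R[i]) = 0.
  by rewrite /cRintegral /Rintegral /= !integral0.
have alg (b b' u : R[i]) : (b - b') / u = u^-1 * b + (- u^-1) * b'.
  by rewrite mulrBl mulNr (mulrC b) (mulrC b').
pose q u y := u^-1 * radial_integrand f (x + u *: v) y + ((- u^-1) * radial_integrand f x y + 0).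
have qi u : rnorm u * rnorm v < s / 4 -> cintegrable leb `[0, 1] (q u).
  move=> us; apply: cintegrable_lin => //; first exact: ki (inO _ us).
  by apply: cintegrable_lin => //; exact: ki.
have qE u : rnorm u * rnorm v < s / 4 ->
    dquot (C_op alpha g phi f) x v u = cRintegral leb `[0, 1] (q u).
  move=> us; rewrite /q cRintegral_lin //; [|exact: ki (inO _ us)|]; last first.
    by apply: cintegrable_lin => //; exact: ki.
  rewrite cRintegral_lin //; last exact: ki.
  by rewrite I0 addr0; exact: alg.
have qd u y : q u y = dquot (fun z => radial_integrand f z y) x v u.
  by rewrite /q addr0 -alg.
rewrite !qE // (_ : _ - _ = cRintegral leb `[0, 1] (fun y => (- 1) * q t' y + q t y)); last first.
  by rewrite [RHS]cRintegral_lin //; [rewrite mulN1r addrC|exact: qi|exact: qi].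
have -> : 64 * (2 * (B C d * M)) / s ^+ 2 * rnorm v ^+ 2 * (rnorm t + rnorm t') =
    2 * (64 * (B C d * M) / s ^+ 2 * rnorm v ^+ 2 * (rnorm t + rnorm t')).
  by set e := s ^- 2; ring.
apply: (cRintegral_bound m01 leb01); first by apply: cintegrable_lin => //; exact: qi.
move=> y /=; rewrite in_itv /= => yI; rewrite mulN1r addrC !qd.
by apply: ((line_t y yI).2).
Qed.

End bounds.

End radial_integral.

Section sampling.
Context (R : realType) (n : nat).
Local Notation V := 'rV[R[i]]_n.
Implicit Types (Omega K : set V) (f : V -> R[i]) (S : (V -> R[i]) -> (V -> R[i])).

(** The properties of the integral operator on which everything else rests: it maps
    Bergman functions to bounded holomorphic functions, and up to an error exponentially
    small in [N] the result is controlled by of the order of [N ^ n] values of [f]. *)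
Definition sampled_operator Omega S (A : R) (L : nat)
    (P : forall N, 'I_L -> {ffun 'I_n -> 'I_N} -> V) :=
  (forall p f (M : R), 1 <= p -> bergman Omega p f -> 0 <= M ->
    (Lp_norm Omega p f <= M%:E)%E ->
    [/\ holomorphic_on Omega (S f),
      forall N i h, rnorm (f (P N i h)) <= A * M &
      forall N (e : R), 0 <= e -> (forall i h, rnorm (f (P N i h)) <= e) ->
      forall z, Omega z -> rnorm (S f z) <= A * (2^-1 ^+ N * M + 16 ^+ (n * N) * e)]) /\
  (forall p f h (a : R[i]), 1 <= p -> bergman Omega p f -> bergman Omega p h ->
    forall z, Omega z -> S (fun w => a * f w + h w) z = a * S f z + S h z).

Lemma Lp_eval_near Omega K (d : R) : open Omega ->
  (volume R n (@to_cvec R n @^-1` Omega) < +oo)%E -> 0 < d ->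
  (forall w, K w -> forall y, rnorm (y - w) < d -> Omega y) ->
  exists2 E : R, 0 <= E & forall p f (M : R), 1 <= p -> bergman Omega p f -> 0 <= M ->
    (Lp_norm Omega p f <= M%:E)%E -> forall w, K w -> line_hol f w (d / 2) (E * M).
Proof.
move=> oO volO d0 KO.
have d16 : 0 < d / 16 by rewrite divr_gt0.
have v0 : 0 <= fine (volume R n (@to_cvec R n @^-1` Omega)) by apply: fine_ge0; exact: measure_ge0.
exists ((2 / (d / 16) ^+ 2) ^+ n * (fine (volume R n (@to_cvec R n @^-1` Omega)) + 1)).
  by rewrite mulr_ge0 ?addr_ge0 // exprn_ge0 // divr_ge0 // exprn_ge0 // ltW.
move=> p f M p1 [fO fi] M0 fM w Kw; apply: differentiable_line_hol => a aw.
have near_a y : rnorm (y - a) <= 4 * (d / 16) -> Omega y.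
  move=> ya; apply: (KO w Kw); apply: le_lt_trans (rnorm_tri a _ _) _.
  by move: aw ya; set u := rnorm _; set v := rnorm _; lra.
split; first exact: (Lp_eval oO volO p1 d16 M0 near_a fO fM).
apply: fO; apply: near_a; rewrite subrr rnorm0; lra.
Qed.

Lemma sampling Omega K g phi (alpha D G : R) : (1 <= n)%N -> open Omega ->
  convex_subset Omega -> Omega 0 ->
  (forall z, Omega z -> rnorm z < D) -> compact K -> K `<=` Omega ->
  holomorphic_on Omega g -> (forall z, Omega z -> rnorm (g z) <= G) ->
  holomorphic_on Omega phi -> (forall z, Omega z -> K (phi z)) -> phi 0 = 0 -> 0 <= alpha ->
  exists (A : R) (L : nat) (P : forall N, 'I_L -> {ffun 'I_n -> 'I_N} -> V),
    0 <= A /\ sampled_operator Omega (C_op alpha g phi) A P.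
Proof.
move=> n1 oO cO O0 OD cK KO gO gG phiO phiK phi0 alpha0.
have star z t := @star_shaped R n Omega z t cO O0.
have volO := volume_bounded oO OD.
have [d d0 dK] := compact_thickening cK oO KO.
have [E E0 EK] := Lp_eval_near oO volO d0 dK.
have d2 : 0 < d / 2 by rewrite divr_gt0.
have [C C0 phiC] := self_map_growth oO O0 OD KO phiO phiK phi0.
have g0 := grid_radius_gt0 R n.
pose rho := d / 2 / 8 * grid_radius R n.
have rho0 : 0 < rho by rewrite mulr_gt0 // divr_gt0.
have [s [sK sP]] := finite_net cK (fun a _ => rho0).
pose L := size s.
have pts N (i : 'I_L) : exists P : {ffun 'I_n -> 'I_N} -> V,
    (forall h, rnorm (P h - s`_i) < d / 2) /\
    forall f (M e : R), line_hol f s`_i (d / 2) M -> 0 <= e -> (forall h, rnorm (f (P h)) <= e) ->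
    forall w, rnorm (w - s`_i) <= d / 2 / 4 * grid_radius R n ->
    rnorm (f w) <= n%:R * 2^-1 ^+ N * M + 16 ^+ (n * N) * e.
  exact: (grid_smallness (s`_i) N d2).
pose P N i := sval (cid (pts N i)); have PP N i := svalP (cid (pts N i)).
have siK (i : 'I_L) : K s`_i by apply: sK; apply: mem_nth.
have [B [B0 SB]] : exists B : R, 0 <= B /\ forall f (M : R), holomorphic_on Omega f ->
    (forall w, K w -> line_hol f w rho M) ->
    forall z, Omega z -> rnorm (C_op alpha g phi f z) <= 2 * (B * M).
  exists (n%:R * C * D * 4 / rho * G); split; last first.
    exact: (C_op_bound oO O0 star OD KO gO gG phiO phiK phi0 alpha0 C0 rho0 phiC).
  have D0 : 0 < D by apply: le_lt_trans (OD _ O0); exact: rnorm_ge0.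
  have G0 : 0 <= G by apply: le_trans (gG _ O0); exact: rnorm_ge0.
  by rewrite !mulr_ge0 ?invr_ge0 // ltW.
have nE : 1 <= n%:R * E + 1 by rewrite lerDr mulr_ge0.
exists ((2 * B + 1) * (n%:R * E + 1) + E), L, P; split.
  by rewrite addr_ge0 // mulr_ge0 ?addr_ge0 ?mulr_ge0.
split.
  move=> p f M p1 fB M0 fM; have fO := fB.1.
  have fK := EK p f M p1 fB M0 fM.
  split.
  - exact: (C_op_holomorphic oO O0 star OD KO gO gG phiO phiK phi0 alpha0 C0 d2 phiC fO fK).
  - move=> N i h; have [/(_ h) Ph _] := PP N i.
    apply: le_trans (fK _ (siK i) _ Ph).1 _; rewrite ler_wpM2r // lerDr.
    by rewrite mulr_ge0 ?addr_ge0 ?mulr_ge0.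
  - move=> N e e0 fe z zO; set m := n%:R * 2^-1 ^+ N * (E * M) + 16 ^+ (n * N) * e.
    have t0 : 0 <= 2^-1 ^+ N :> R by rewrite exprn_ge0 // invr_ge0.
    have u0 : 0 <= 16 ^+ (n * N) :> R by rewrite exprn_ge0.
    have m0 : 0 <= m by rewrite addr_ge0 ?mulr_ge0.
    have fm w : K w -> line_hol f w rho m.
      move=> Kw; apply: differentiable_line_hol => y yw; split; last first.
        apply: fO; apply: (dK w Kw); apply: lt_le_trans yw _.
        rewrite /rho -!mulrA ger_pMr //; have := grid_radius_le R n; move: g0.
        by set q := grid_radius _ _ => q0 q8; lra.
      have [a as_ wa] := sP w Kw.
      have il : (index a s < L)%N by rewrite index_mem.
      pose i := Ordinal il; have wi : rnorm (w - s`_i) < rho by rewrite nth_index.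
      apply: ((PP N i).2 f (E * M) e (fK _ (siK i)) e0 (fe i)).
      apply: le_trans (rnorm_tri w _ _) _; move: yw wi; rewrite /rho.
      by set q := rnorm _; set q' := rnorm _; set q'' := grid_radius _ _; lra.
    apply: le_trans (SB f m fO fm z zO) _.
    apply: (@le_trans _ _ ((2 * B + 1) * (n%:R * E + 1) * (2^-1 ^+ N * M + 16 ^+ (n * N) * e))).
      rewrite mulrA -[X in _ <= X]mulrA; apply: ler_pM; rewrite ?mulr_ge0 ?lerDl //.
      have h1 : n%:R * 2^-1 ^+ N * (E * M) <= (n%:R * E + 1) * (2^-1 ^+ N * M).
        rewrite (_ : _ * _ * _ = n%:R * E * (2^-1 ^+ N * M)); last by ring.
        by rewrite ler_wpM2r ?mulr_ge0 // lerDl.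
      have h2 : 16 ^+ (n * N) * e <= (n%:R * E + 1) * (16 ^+ (n * N) * e).
        by rewrite ler_peMl // mulr_ge0.
      by rewrite mulrDr lerD.
    by rewrite ler_wpM2r ?lerDl // addr_ge0 // mulr_ge0.
move=> p f h a p1 fB hB z zO.
have [M M0 fM] := bergman_norm fB; have [N N0 hN] := bergman_norm hB.
have fK := EK p f M p1 fB M0; rewrite fM lexx in fK.
have hK := EK p h N p1 hB N0; rewrite hN lexx in hK.
exact: (C_op_lin oO O0 star OD KO gO gG phiO phiK phi0 alpha0 C0 d2 phiC a fB.1 hB.1
  (fK isT) (hK isT) zO).
Qed.

End sampling.

Section extraction.
Variable R : realType.

(** A bounded sequence of functions has a cluster point for pointwise convergence, by
    Tychonoff's theorem; a subsequence is close to it on any prescribed finite sets. *)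
Lemma finite_sets_extraction (I : eqType) (u : nat -> I -> R) (c : R) (s : nat -> seq I)
    (e : nat -> R) : (forall k x, - c <= u k x <= c) -> (forall k, 0 < e k) ->
  exists (l : I -> R) (h : nat -> nat), {homo h : i j / (i < j)%N} /\
    forall k x, x \in s k -> `|u (h k) x - l x| < e k.
Proof.
move=> uc e0.
pose X := [set f : prod_topology (fun _ : I => R^o) | forall x, `[- c, c]%classic (f x)].
have cX : compact X.
  exact: (@tychonoff I (fun _ => R^o) (fun _ => `[- c, c]%classic) (fun _ => @segment_compact R (- c) c)).
have [|l [_ lu]] := cX (fun A : set (prod_topology (fun _ : I => R^o)) => (u @ \oo) A) _.
  by exists 0%N => // k _ x; rewrite /= in_itv /=; exact: uc.
have near_l (r : seq I) (d : R) : 0 < d ->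
    nbhs (l : prod_topology (fun _ : I => R^o))
      [set f : prod_topology (fun _ : I => R^o) | forall x, x \in r -> `|f x - l x| < d].
  move=> d0; elim: r => [|x r ih]; first by apply: filterE => f x.
  have px : nbhs (l : prod_topology (fun _ : I => R^o))
      [set f : prod_topology (fun _ : I => R^o) | `|f x - l x| < d].
    have pc : continuous (proj x : prod_topology (fun _ : I => R^o) -> R^o).
      exact: proj_continuous.
    have := pc l; move=> /cvgrPdist_lt/(_ d d0); apply: filterS => f.
    by rewrite /= /proj distrC.
  apply: filterS2 ih px => f fr fx y; rewrite inE => /orP[/eqP ->//|]; exact: fr.
have pick m k : exists j, (m < j)%N /\ forall x, x \in s k -> `|u j x - l x| < e k.
  have tail : (u @ \oo) [set f | exists2 j, (m < j)%N & f = u j].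
    by exists m.+1 => // j /= mj; exists j.
  have [f [[j mj ->] fs]] := lu _ _ tail (near_l (s k) (e k) (e0 k)).
  by exists j.
have [F FP] := choice (fun mk : nat * nat => pick mk.1 mk.2).
pose h := fix h k := if k is k'.+1 then F (h k', k'.+1) else F (0%N, 0%N).
exists l, h; split.
  by apply: homo_ltn => [? ? ?|k]; [exact: ltn_trans|exact: (FP (h k, k.+1)).1].
by case=> [|k] x xs; [exact: (FP (0%N, 0%N)).2|exact: (FP (h k, k.+1)).2].
Qed.

Lemma finite_sets_extraction_complex (I : eqType) (u : nat -> I -> R[i]) (c : R)
    (s : nat -> seq I) (e : nat -> R) :
  (forall k l x, x \in s k -> rnorm (u l x) <= c) -> (forall k, 0 < e k) ->
  exists (l : I -> R[i]) (h : nat -> nat), {homo h : i j / (i < j)%N} /\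
    forall k x, x \in s k -> rnorm (u (h k) x - l x) < e k.
Proof.
move=> uc e0.
pose part (b : bool) (z : R[i]) : R := if b then complex.Re z else complex.Im z.
pose c' := `|c|.
pose v k (xb : I * bool) := if rnorm (u k xb.1) <= c' then part xb.2 (u k xb.1) else 0.
have vc k xb : - c' <= v k xb <= c'.
  rewrite -ler_norml /v; case: ifP => h; last by rewrite normr0 /c'.
  by apply: le_trans h; case: xb.2; [exact: Re_le_rnorm|exact: Im_le_rnorm].
have e20 k : 0 < e k / 2 by rewrite divr_gt0.
pose s' k := [seq (x, true) | x <- s k] ++ [seq (x, false) | x <- s k].
have [l [h [hh hl]]] := @finite_sets_extraction (I * bool)%type v c' s' (fun k => e k / 2) vc e20.
exists (fun x => l (x, true) +i* l (x, false)), h; split=> // k x xs.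
have ub : rnorm (u (h k) x) <= c' by apply: le_trans (uc k (h k) x xs) _; exact: ler_norm.
have := hl k (x, true); have := hl k (x, false).
rewrite !mem_cat !map_f ?orbT // /v /= ub /= => h1 h2.
apply: le_lt_trans (rnorm_le_ReIm _) _; rewrite !raddfB /=.
by have := h1 isT; have := h2 isT; lra.
Qed.

End extraction.

Section sampled_operators.
Context (R : realType) (n : nat).
Local Notation V := 'rV[R[i]]_n.
Local Notation vol := (volume R n).
Variables (Omega : set V) (S : (V -> R[i]) -> (V -> R[i])) (A : R) (L : nat)
  (P : forall N, 'I_L -> {ffun 'I_n -> 'I_N} -> V).
Hypotheses (n1 : (1 <= n)%N) (oO : open Omega)
  (volO : (vol (@to_cvec R n @^-1` Omega) < +oo)%E) (A0 : 0 <= A)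
  (SP : sampled_operator Omega S A P).
Implicit Types (f : V -> R[i]) (p q M : R) (T : (V -> R[i]) -> (V -> R[i])).

Lemma sampled_sup p f M : 1 <= p -> bergman Omega p f -> 0 <= M ->
  (Lp_norm Omega p f <= M%:E)%E -> forall z, Omega z -> rnorm (S f z) <= A * M.
Proof.
move=> p1 fB M0 fM z zO; have [_ _ /(_ 0%N 0 (lexx _))] := SP.1 p f M p1 fB M0 fM.
rewrite expr0 mul1r mulr0 addr0; apply=> // i h.
by case: (h (Ordinal n1)).
Qed.

Lemma Lp_norm_sup q : 0 < q -> exists2 c : R, 0 <= c & forall f M, 0 <= M ->
  holomorphic_on Omega f -> (forall z, Omega z -> rnorm (f z) <= M) ->
  (Lp_norm Omega q f <= (M * c)%:E)%E.
Proof.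
move=> q0; set v := fine (vol (@to_cvec R n @^-1` Omega)).
have v0 : 0 <= v by apply: fine_ge0; exact: measure_ge0.
exists (v `^ q^-1) => [|f M M0 fO fM]; first exact: powR_ge0.
apply: Lp_norm_le => //; first by rewrite mulr_ge0 ?powR_ge0.
apply: le_trans (Lp_int_sup oO q0 M0 fO fM) _.
rewrite powRM ?powR_ge0 // -powRrM mulVf ?gt_eqF // powRr1 // EFinM /v fineK //.
by rewrite ge0_fin_numE //; exact: measure_ge0.
Qed.

Lemma bergman_bounded q f M : 0 < q -> holomorphic_on Omega f ->
  (forall z, Omega z -> rnorm (f z) <= M) -> bergman Omega q f.
Proof.
move=> q0 fO fM; have [c c0 cP] := Lp_norm_sup q0; split=> //.
have fM' z : Omega z -> rnorm (f z) <= `|M|.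
  by move=> zO; rewrite (le_trans (fM z zO)) // ler_norm.
by apply: le_lt_trans (cP f `|M| (normr_ge0 _) fO fM') _; exact: ltry.
Qed.

Lemma sampled_bounded p q : 1 <= p -> 0 < q -> bounded_operator Omega p q S.
Proof.
move=> p1 q0; have [c c0 cP] := Lp_norm_sup q0.
have SO f : bergman Omega p f -> holomorphic_on Omega (S f).
  move=> fB; have [M M0 fM] := bergman_norm fB.
  have fM' : (Lp_norm Omega p f <= M%:E)%E by rewrite fM.
  by have [] := SP.1 p f M p1 fB M0 fM'.
split.
- move=> f fB; have [M M0 fM] := bergman_norm fB.
  have fM' : (Lp_norm Omega p f <= M%:E)%E by rewrite fM.
  exact: (bergman_bounded q0 (SO f fB) (sampled_sup p1 fB M0 fM')).
- by move=> a f h fB hB z zO; exact: (SP.2 p).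
- exists (A * c) => f fB; have [M M0 fM] := bergman_norm fB.
  have fM' : (Lp_norm Omega p f <= M%:E)%E by rewrite fM.
  rewrite fM -EFinM mulrAC; apply: cP; [by rewrite mulr_ge0|exact: SO|].
  exact: (sampled_sup p1 fB M0 fM').
Qed.

Lemma Lp_norm_sub p f (h : V -> R[i]) M : 1 <= p -> 0 <= M -> bergman Omega p f ->
  bergman Omega p h -> (Lp_norm Omega p f <= M%:E)%E -> (Lp_norm Omega p h <= M%:E)%E ->
  (Lp_norm Omega p (fun z => f z - h z)%R <= (4 * M)%:E)%E.
Proof.
move=> p1 M0 fB hB fM hM; have p0 : 0 < p by lra.
apply: Lp_norm_le => //; first by rewrite mulr_ge0.
apply: le_trans (Lp_int_sub oO (ltW p0) fB.1 hB.1) _.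
apply: (@le_trans _ _ ((2 `^ p)%:E * ((M `^ p)%:E + (M `^ p)%:E))%E).
  by apply: lee_wpmul2l; rewrite ?lee_fin ?powR_ge0 //; apply: leeD; exact: Lp_int_le.
rewrite -EFinD -EFinM lee_fin [X in X <= _](_ : _ = 2 `^ p * 2 * M `^ p); last by ring.
have -> : (4 * M) `^ p = 2 `^ p * 2 `^ p * M `^ p.
  by rewrite -!powRM // ?mulr_ge0 //; congr (_ `^ _); ring.
rewrite ler_wpM2r ?powR_ge0 // ler_wpM2l ?powR_ge0 //.
by apply: le1r_powR => //; lra.
Qed.

(** Bounded sequences are compared through their values at the sample points: where
    these are close for the levels up to [k], the images are uniformly close. *)
Lemma sampled_compact p q T : 1 <= p -> 0 < q -> bounded_operator Omega p q T ->
  (forall f, bergman Omega p f -> forall z, Omega z -> T f z = S f z) ->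
  compact_operator Omega p q T.
Proof.
move=> p1 q0 Tb TS; have p0 : 0 < p by lra.
split=> // u [M uM].
have M0 : 0 <= M.
  have [_ h] := uM 0%N; rewrite -lee_fin; apply: le_trans h; exact: poweR_ge0.
have uB k := (uM k).1; have uN k := (uM k).2.
have uO k : holomorphic_on Omega (S (u k)).
  by have [] := SP.1 p (u k) M p1 (uB k) M0 (uN k).
have uP k (N : nat) (i : 'I_L) (h : {ffun 'I_n -> 'I_N}) : rnorm (u k (P i h)) <= A * M.
  have [_ /(_ N i h)] := SP.1 p (u k) M p1 (uB k) M0 (uN k); exact.
have uS k z : Omega z -> rnorm (S (u k) z) <= A * M := sampled_sup p1 (uB k) M0 (uN k) (z := z).
pose s (k : nat) : seq V := flatten [seq [seq P (N := N) i h | i <- enum 'I_L, h <- enum {ffun 'I_n -> 'I_N}]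
  | N <- iota 0 k.+1].
have sP (k N : nat) i h : (N <= k)%N -> P (N := N) i h \in s k.
  move=> Nk; apply/flattenP.
  exists [seq P (N := N) i h | i <- enum 'I_L, h <- enum {ffun 'I_n -> 'I_N}].
    by apply/mapP; exists N => //; rewrite mem_iota add0n ltnS.
  by apply/allpairsP; exists (i, h); rewrite /= !mem_enum.
pose e k : R := 16 ^- (n * k) * 2^-1 ^+ k.
have e0 k : 0 < e k by rewrite mulr_gt0 ?invr_gt0 ?exprn_gt0 // invr_gt0.
have [|l [h [hh hl]]] := @finite_sets_extraction_complex R V u (A * M) s e _ e0.
  by move=> k j x /flattenP[t /mapP[N _ ->] /allpairsP[[i x'] [_ _ ->]]]; exact: uP.
pose b k : R := A * (4 * M + 2) * 2^-1 ^+ k.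
have cauchy N k j z : (N <= k)%N -> (N <= j)%N -> Omega z ->
    rnorm (S (u (h k)) z - S (u (h j)) z) <= b N.
  move=> Nk Nj zO.
  have eN m : (N <= m)%N -> e m <= e N.
    move=> Nm; apply: ler_pM; rewrite ?invr_ge0 ?exprn_ge0 ?invr_ge0 //.
      rewrite lef_pV2 ?posrE ?exprn_gt0 // ler_weXn2l ?leq_mul2l ?Nm ?orbT //; lra.
    by apply: ler_wiXn2l; rewrite ?invr_ge0 ?invf_le1 ?ler1n.
  have dB : bergman Omega p (fun w => (- 1) * u (h j) w + u (h k) w).
    exact: bergman_lin.
  have dE : (fun w => (- 1) * u (h j) w + u (h k) w) = (fun w => u (h k) w - u (h j) w).
    by apply/funext => w; rewrite mulN1r addrC.
  have dN : (Lp_norm Omega p (fun w => (- 1) * u (h j) w + u (h k) w)%R <= (4 * M)%:E)%E.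
    by rewrite dE; exact: (Lp_norm_sub p1 M0 (uB _) (uB _) (uN _) (uN _)).
  have M40 : 0 <= 4 * M by rewrite mulr_ge0.
  have e20 : 0 <= 2 * e N by rewrite mulr_ge0 // ltW.
  have small i (y : {ffun 'I_n -> 'I_N}) :
      rnorm ((- 1) * u (h j) (P i y) + u (h k) (P i y)) <= 2 * e N.
    rewrite mulN1r addrC; apply: le_trans (rnorm_tri (l (P i y)) _ _) _.
    rewrite (rnormB (l _)) (_ : 2 * e N = e N + e N); last by ring.
    by apply: lerD; [apply: le_trans (eN k Nk)|apply: le_trans (eN j Nj)]; apply/ltW/hl/sP.
  have [_ _ /(_ N (2 * e N) e20 small z zO)] := SP.1 p _ (4 * M) p1 dB M40 dN.
  rewrite (SP.2 p (u (h j)) (u (h k)) (- 1) p1 (uB _) (uB _) z zO) mulN1r [- _ + _]addrC.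
  move=> /le_trans; apply.
  rewrite /b -!mulrA ler_wpM2l // /e.
  have -> : 16 ^+ (n * N) * (2 * (16 ^- (n * N) * 2^-1 ^+ N)) = 2 * 2^-1 ^+ N :> R.
    by rewrite mulrCA mulVKf // gt_eqF // exprn_gt0.
  by set x := 2^-1 ^+ N; lra.
have bc : b @ \oo --> (0 : R).
  by apply: cvg_geometric; rewrite ger0_norm ?invr_ge0 // invf_lt1 // ltr1n.
have b_small (d : R) : 0 < d -> exists N, b N < d.
  move=> d0; have /cvgrPdist_lt/(_ d d0)[N _ NP] := bc; exists N.
  by have := NP N (leqnn N); rewrite sub0r normrN; apply: le_lt_trans; exact: ler_norm.
have lim z : exists v, Omega z -> forall d : R, 0 < d -> exists N, forall k, (N <= k)%N ->
    rnorm (S (u (h k)) z - v) < d.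
  have [zO|nzO] := pselect (Omega z); last by exists 0.
  have [|v vP] := @complex_cauchy_seq R (fun k => S (u (h k)) z); last by exists v.
  move=> d /b_small[N Nd]; exists N => k Nk; apply: le_lt_trans Nd; exact: cauchy.
have [v vP] := choice lim.
have vb N k z : (N <= k)%N -> Omega z -> rnorm (S (u (h k)) z - v z) <= b N.
  move=> Nk zO; apply/ler_addgt0Pr => d d0; have [N' N'P] := vP z zO d d0.
  apply: le_trans (rnorm_tri (S (u (h (maxn N N'))) z) _ _) _; apply: lerD.
    by apply: cauchy => //; exact: leq_maxl.
  by apply/ltW/N'P; exact: leq_maxr.
have vO : holomorphic_on Omega v.
  exact: (@holomorphic_limit _ _ Omega (fun k => S (u (h k))) v (A * M) oO
    (fun k => uO (h k)) (fun k => uS (h k)) vP).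
have vB : bergman Omega q v.
  apply: (@bergman_bounded q v (b 0%N + A * M)) => // z zO.
  rewrite -(subrK (S (u (h 0%N)) z) (v z)); apply: le_trans (rnormD _ _) _.
  by apply: lerD; [rewrite rnormB; exact: vb|exact: uS].
exists h, v; split => //.
have [c c0 cP] := Lp_norm_sup q0.
have up k : (Lp_norm Omega q (fun z => T (u (h k)) z - v z)%R <= (b k * c)%:E)%E.
  apply: cP.
  - by rewrite mulr_ge0 ?exprn_ge0 ?invr_ge0 // mulr_ge0 // addr_ge0 // mulr_ge0.
  - move=> z zO; apply: differentiableB; last exact: vO.
    by have [/(_ _ (uB (h k)))[]] := Tb => + _ _ _; exact.
  - by move=> z zO; rewrite TS //; exact: vb.
have bcE : (b k * c)%:E @[k --> \oo] --> 0%E.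
  by apply: cvg_EFin; [exact: nearW|rewrite -(mul0r c); apply: cvgMl].
apply: (squeeze_cvge _ (cvg_cst 0%E) bcE).
by apply: nearW => k; rewrite up andbT; exact: poweR_ge0.
Qed.

End sampled_operators.

Section powR_continuity.
Variable R : realType.

Lemma powR_near (p a e : R) : 0 < p -> 0 <= a -> 0 < e -> exists2 d : R, 0 < d &
  forall b, 0 <= b -> `|b - a| < d -> `|b `^ p - a `^ p| < e.
Proof.
move=> p0; rewrite le_eqVlt => /orP[/eqP <-|a0] e0.
  exists (e `^ p^-1); first by rewrite powR_gt0.
  move=> b b0; rewrite subr0 powR0 ?gt_eqF // subr0 !ger0_norm ?powR_ge0 // => be.
  have ee : (e `^ p^-1) `^ p = e by rewrite -powRrM mulVf ?gt_eqF // powRr1 // ltW.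
  by rewrite -[ltRHS]ee; apply: gt0_ltr_powR; rewrite ?nnegrE ?powR_ge0.
have ac : {for a, continuous (fun x : R => x `^ p)}.
  apply: differentiable_continuous; apply/derivable1_diffP; apply: derivable_powR.
  by rewrite in_itv /= a0.
have /cvgrPdist_lt/(_ e e0)/nbhs_normP[d /= d0 dP] := ac.
by exists d => // b b0 bd; rewrite distrC; apply: dP; rewrite /= distrC.
Qed.

Lemma powR_cvg (p a : R) (b : nat -> R) : 0 < p -> 0 <= a -> (forall k, 0 <= b k) ->
  (forall d : R, 0 < d -> exists N, forall k, (N <= k)%N -> `|b k - a| < d) ->
  b k `^ p @[k --> \oo] --> a `^ p.
Proof.
move=> p0 a0 b0 ba; apply/cvgrPdist_lt => e e0.
have [d d0 dP] := powR_near p0 a0 e0; have [N NP] := ba d d0.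
by exists N => // k Nk; rewrite distrC; apply: dP => //; exact: NP.
Qed.

(** A sequence of integrals bounded by a convergent sequence, in the limit inferior. *)
Lemma limn_einf_le (u : nat -> \bar R) (x : nat -> R) (y : R) :
  (forall k, (u k <= (x k)%:E)%E) -> x @ \oo --> y -> (limn_einf u <= y%:E)%E.
Proof.
move=> ux xy; rewrite limn_einf_lim; apply: lime_le; first exact: is_cvg_einfs.
apply: nearW => m; apply/lee_addgt0Pr => e e0.
have /cvgrPdist_lt/(_ e e0)[N _ NP] := xy.
apply: (@le_trans _ _ (u (maxn m N))).
  by apply: ereal_inf_lbound; exists (maxn m N) => //=; exact: leq_maxl.
apply: le_trans (ux _) _; rewrite -EFinD lee_fin.
have := NP (maxn m N) (leq_maxr m N); rewrite distrC => /(le_lt_trans (ler_norm _)); lra.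
Qed.

End powR_continuity.

Section dilations.
Context (R : realType) (n : nat).
Local Notation V := 'rV[R[i]]_n.
Local Notation vol := (volume R n).
Variables (Omega : set V).
Hypotheses (oO : open Omega) (cO : convex_subset Omega) (O0 : Omega 0).
Implicit Types (f : V -> R[i]) (p q M r : R).

Definition dilate r f (z : V) := f (r%:C *: z).

Lemma holomorphic_dilate U r f : holomorphic_on U f ->
  holomorphic_on [set z | U (r%:C *: z)] (dilate r f).
Proof. by move=> fU z zU; exact: (differentiable_dilation fU zU). Qed.

Lemma open_dilate U r : open U -> open [set z : V | U (r%:C *: z)].
Proof.
move=> oU; apply: (@open_comp _ _ (fun z : V => r%:C *: z)) => // z _.
exact: scaler_continuous.
Qed.

(** By convexity, r closure(Omega) lies in Omega for r < 1. *)
Lemma dilate_near_closure r f : 0 < r < 1 -> holomorphic_on Omega f ->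
  holomorphic_near (closure Omega) (dilate r f).
Proof.
move=> /andP[r0 r1] fO; exists [set z | Omega (r%:C *: z)].
split; [exact: open_dilate| |exact: holomorphic_dilate].
move=> z zO /=; have [d [d0 dO]] := open_ball oO O0.
have s0 : 0 < 1 - r by rewrite subr_gt0.
have e0 : 0 < d * (1 - r) / r by rewrite divr_gt0 // mulr_gt0.
have [y [yO /= yz]] : Omega `&` [set y | rnorm (y - z) < d * (1 - r) / r] !=set0.
  by apply: zO; apply/nbhs_rnormP; exists (d * (1 - r) / r).
pose w := (r / (1 - r))%:C *: (z - y).
have wO : Omega w.
  apply: dO; rewrite subr0 /w rnormZ rnorm_real ger0_norm; last by rewrite divr_ge0 ?ltW.
  rewrite rnormB; move: yz; rewrite ltr_pdivlMr // mulrC => yz.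
  by rewrite mulrAC ltr_pdivrMr // mulrC.
have rI : 0 <= r <= 1 by rewrite !ltW.
have := convex_combination cO yO wO rI.
rewrite /w scalerA -rmorphM /= mulrCA mulfV ?gt_eqF // mulr1 -scalerDr addrC subrK.
exact.
Qed.

Lemma dilate_bergman p r f : 0 < p -> 0 < r < 1 -> holomorphic_on Omega f ->
  holomorphic_on Omega (dilate r f) /\
  (Lp_int Omega p (dilate r f) <= (r ^- (2 * n))%:E * Lp_int Omega p f)%E.
Proof.
move=> p0 rI fO; case/andP: (rI) => r0 r1.
have inO z : Omega z -> Omega (r%:C *: z).
  by move=> zO; apply: star_shaped => //; rewrite !ltW.
have rO : holomorphic_on Omega (dilate r f).
  by move=> z zO; apply: (holomorphic_dilate fO); exact: inO.
split=> //; have mO := measurable_open oO.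
set W := @to_cvec R n @^-1` Omega in mO *.
pose G := (fun x => (rnorm (f (to_cvec x)) `^ p)%:E) \_ W.
have mG : measurable_fun setT G.
  apply/(measurable_restrictT _ _).1 => //; exact: measurable_pow_rnorm.
have G0 x : (0 <= G x)%E by rewrite /G patchE; case: ifP => // _; rewrite lee_fin powR_ge0.
have -> : Lp_int Omega p f = (\int[vol]_x G x)%E by rewrite /G -integral_mkcond.
rewrite (scale_volume r0 mG G0) muleA -EFinM mulVf ?gt_eqF ?exprn_gt0 // mul1e.
rewrite /Lp_int integral_mkcond; apply: ge0_le_integral => //.
- by move=> x _; rewrite patchE; case: ifP => // _; rewrite lee_fin powR_ge0.
- apply/(measurable_restrictT _ _).1 => //; exact: measurable_pow_rnorm.
- exact: (measurableT_comp mG (@measurable_scale_tuple R r n)).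
- move=> x _; rewrite patchE; case: ifPn => [|_]; last exact: G0.
  rewrite inE => xW; rewrite /G patchE mem_set; last by rewrite /W /= to_cvec_scale; exact: inO.
  by rewrite to_cvec_scale.
Qed.

Let rate k : R := 1 - 2^-1 ^+ k.+1.

Let rateI k : 0 < rate k < 1.
Proof.
rewrite /rate subr_gt0 gtrBl exprn_gt0 ?invr_gt0 // andbT.
by rewrite exprn_ilt1 ?invr_ge0 // invf_lt1 // ltr1n.
Qed.

Let rate1 : rate @ \oo --> (1 : R).
Proof.
rewrite -[X in _ --> X]subr0; apply: cvgB; first exact: cvg_cst.
have h : geometric (1 : R) 2^-1 @ \oo --> 0.
  by apply: cvg_geometric; rewrite ger0_norm ?invr_ge0 // invf_lt1 // ltr1n.
rewrite (_ : (fun k => _) = (fun k => geometric (1 : R) 2^-1 k.+1)).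
  by move: h; rewrite -(cvg_shiftS (geometric (1 : R) 2^-1)).
by apply/funext => k; rewrite /= mul1r.
Qed.

(** The argument of Riesz: Fatou's lemma, applied to the nonnegative functions
    [2 ^ p (|f_r| ^ p + |f| ^ p) - |f_r - f| ^ p], turns pointwise convergence and
    convergence of the norms into convergence in the mean. *)
Lemma dilate_cvg p f (e : R) : 0 < p -> bergman Omega p f -> 0 < e ->
  exists2 r, 0 < r < 1 & (Lp_int Omega p (fun z => dilate r f z - f z)%R < e%:E)%E.
Proof.
move=> p0 fB e0; have [fO fi] := (bergmanP Omega f p0).1 fB.
apply/not_exists2P => no.
have big k : (e%:E <= Lp_int Omega p (fun z => dilate (rate k) f z - f z)%R)%E.
  by have [/(_ (rateI k))//|] := no (rate k); rewrite ltNge => /negP; rewrite negbK.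
have mO := measurable_open oO; set W := @to_cvec R n @^-1` Omega in mO.
have dO k := (dilate_bergman p0 (rateI k) fO).1.
have dI k := (dilate_bergman p0 (rateI k) fO).2.
have fif : Lp_int Omega p f \is a fin_num by rewrite ge0_fin_numE // Lp_int_ge0.
pose I := fine (Lp_int Omega p f).
have IE : Lp_int Omega p f = I%:E by rewrite fineK.
pose F k (x : n.-tuple (measurableTypeR R * measurableTypeR R)) : R :=
  2 `^ p * (rnorm (dilate (rate k) f (to_cvec x)) `^ p + rnorm (f (to_cvec x)) `^ p) -
  rnorm (dilate (rate k) f (to_cvec x) - f (to_cvec x)) `^ p.
have F0 k x : 0 <= F k x.
  rewrite subr_ge0; apply: le_trans (powR_add_le (ltW p0) (rnorm_ge0 _) (rnorm_ge0 _)).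
  by apply: ge0_ler_powR; rewrite ?nnegrE ?addr_ge0 ?rnorm_ge0 ?rnormDB // ltW.
have doO k : holomorphic_on Omega (fun z => dilate (rate k) f z - f z).
  by move=> z zO; apply: differentiableB; [exact: dO|exact: fO].
have m1 k := (measurable_EFinP _ _).1 (measurable_pow_rnorm p oO (dO k)).
have m2 := (measurable_EFinP _ _).1 (measurable_pow_rnorm p oO fO).
have m3 k := (measurable_EFinP _ _).1 (measurable_pow_rnorm p oO (doO k)).
have mF k : measurable_fun W (EFin \o F k).
  apply/measurable_EFinP; apply: measurable_funB => //.
  by apply: measurable_funM => //; apply: measurable_funD.
pose x k := 2 `^ p * (rate k ^- (2 * n) * I + I) - e.
have FI k : (\int[vol]_(y in W) (F k y)%:E <= (x k)%:E)%E.
  rewrite /x EFinB leeBrDr //.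
  apply: (@le_trans _ _ (\int[vol]_(y in W) (F k y)%:E +
     Lp_int Omega p (fun z => dilate (rate k) f z - f z)%R)%E); first by rewrite leeD2l.
  rewrite /Lp_int -ge0_integralD //; [|by move=> y _; rewrite lee_fin|exact: mF|
    by move=> y _; rewrite lee_fin powR_ge0|exact: (measurable_pow_rnorm p oO (doO k))].
  under eq_integral do rewrite -EFinD subrK EFinM EFinD.
  rewrite ge0_integralZl //; [|apply: emeasurable_funD; exact: measurable_pow_rnorm|
    by move=> y _; rewrite -EFinD lee_fin addr_ge0 ?powR_ge0].
  rewrite ge0_integralD //; [|by move=> y _; rewrite lee_fin powR_ge0|exact: measurable_pow_rnorm|
    by move=> y _; rewrite lee_fin powR_ge0|exact: measurable_pow_rnorm].
  rewrite EFinM; apply: lee_wpmul2l; first by rewrite lee_fin powR_ge0.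
  rewrite EFinD EFinM -IE; apply: leeD => //; exact: dI.
have xc : x @ \oo --> 2 `^ p * (I + I) - e.
  apply: cvgB; last exact: cvg_cst.
  apply: cvgMr; apply: cvgD; last exact: cvg_cst.
  rewrite -[X in _ --> X]mul1r; apply: cvgMl.
  rewrite -[X in _ --> X]invr1 -(expr1n R (2 * n)); apply: cvgV; first by rewrite expr1n oner_eq0.
  elim: (2 * n)%N => [|m ih]; first exact: cvg_cst.
  by under eq_fun do rewrite exprS; rewrite exprS; apply: cvgM.
have Fc y : W y -> limn_einf (fun k => (F k y)%:E) = (2 `^ p * 2 * rnorm (f (to_cvec y)) `^ p)%:E.
  move=> yW; set z := to_cvec y.
  have near1 (d : R) : 0 < d -> exists N, forall k, (N <= k)%N ->
      rnorm (dilate (rate k) f z - f z) < d.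
    move=> d0; have := @continuous_along_ray R n Omega f z 1 fO.
    rewrite scale1r => /(_ yW d d0)[r r0 rP].
    have /cvgrPdist_lt/(_ r r0)[N _ NP] := rate1.
    by exists N => k Nk; apply: rP; rewrite distrC; exact: NP.
  have c1 : rnorm (dilate (rate k) f z) `^ p @[k --> \oo] --> rnorm (f z) `^ p.
    apply: powR_cvg => //; [exact: rnorm_ge0|by move=> k; exact: rnorm_ge0|].
    move=> d /near1[N NP]; exists N => k /NP; apply: le_lt_trans; exact: rnorm_dist.
  have c2 : rnorm (dilate (rate k) f z - f z) `^ p @[k --> \oo] --> (0 : R).
    rewrite -(powR0 (lt0r_neq0 p0)); apply: powR_cvg => //; first by move=> k; exact: rnorm_ge0.
    by move=> d /near1[N NP]; exists N => k /NP; rewrite subr0 ger0_norm ?rnorm_ge0.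
  have c3 : F k y @[k --> \oo] --> 2 `^ p * (rnorm (f z) `^ p + rnorm (f z) `^ p) - 0.
    apply: cvgB => //; apply: cvgMr; apply: cvgD => //; exact: cvg_cst.
  have c4 : (F k y)%:E @[k --> \oo] -->
      (2 `^ p * (rnorm (f z) `^ p + rnorm (f z) `^ p) - 0)%:E.
    by apply: cvg_EFin; [exact: nearW|exact: c3].
  have [-> _] := cvg_limn_einf_sup c4.
  by congr (_%:E); rewrite subr0; ring.
have := fatou vol mO mF (fun k y _ => (F0 k y : (0 <= (EFin \o F k) y)%E)).
rewrite (eq_integral (fun y => ((2 `^ p * 2)%:E * (rnorm (f (to_cvec y)) `^ p)%:E)%E)); last first.
  by move=> y; rewrite inE => yW; rewrite Fc // EFinM.
rewrite ge0_integralZl //; [|exact: measurable_pow_rnorm|by move=> y _; rewrite lee_fin powR_ge0].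
rewrite -/(Lp_int Omega p f) IE => h.
have := le_trans h (limn_einf_le FI xc).
by rewrite -EFinM lee_fin; lra.
Qed.

End dilations.

Section uniqueness.
Context (R : realType) (n : nat).
Local Notation V := 'rV[R[i]]_n.
Local Notation vol := (volume R n).
Variables (Omega : set V) (S T : (V -> R[i]) -> (V -> R[i])) (A : R) (L : nat)
  (P : forall N, 'I_L -> {ffun 'I_n -> 'I_N} -> V) (p q : R).
Hypotheses (n1 : (1 <= n)%N) (oO : open Omega) (cO : convex_subset Omega) (O0 : Omega 0)
  (volO : (vol (@to_cvec R n @^-1` Omega) < +oo)%E) (A0 : 0 <= A)
  (SP : sampled_operator Omega S A P) (p1 : 1 <= p) (q1 : 1 <= q)
  (Tb : bounded_operator Omega p q T)
  (TS : forall f, holomorphic_near (closure Omega) f -> forall z, Omega z -> T f z = S f z).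

(** Both operators are bounded and they agree on the dilates of [f], which converge
    to [f] in the mean; evaluation at a point is continuous. *)
Lemma extension_unique f z : bergman Omega p f -> Omega z -> T f z = S f z.
Proof.
move=> fB zO; have p0 : 0 < p := lt_le_trans ltr01 p1.
have [d [d0 dO]] := open_ball oO zO.
have [|E E0 EP] := @Lp_eval_near R n Omega [set z] d oO volO d0; first by move=> w /= ->.
have [TB Tlin [M TM]] := Tb.
pose B := E * `|M| + A; have B0 : 0 <= B by rewrite addr_ge0 // mulr_ge0.
have key (h : R) : 0 < h -> rnorm (T f z - S f z) <= B * h.
  move=> h0; have hp : 0 < h `^ p by rewrite powR_gt0.
  have [r rI rf] := dilate_cvg oO cO O0 p0 fB hp.
  have [rO rIf] := dilate_bergman oO cO O0 p0 rI fB.1.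
  have rB : bergman Omega p (dilate r f).
    apply: (bergmanP _ _ p0).2; split=> //; apply: le_lt_trans rIf _.
    have [fO fi] := (bergmanP Omega f p0).1 fB.
    apply: lte_mul_pinfty fi; rewrite ?lee_fin ?invr_ge0 ?exprn_ge0 //.
    by case/andP: rI => /ltW.
  pose D w := (- 1) * f w + dilate r f w.
  have DE : D = (fun w => dilate r f w - f w) by apply/funext => w; rewrite /D mulN1r addrC.
  have DB : bergman Omega p D by exact: bergman_lin.
  have Dh : (Lp_norm Omega p D <= h%:E)%E.
    by apply: (Lp_norm_le p0 (ltW h0)); rewrite DE; exact: ltW rf.
  have TD := Tlin (- 1) f (dilate r f) fB rB z zO; rewrite -/D in TD.
  have SD := SP.2 p f (dilate r f) (- 1) p1 fB rB z zO; rewrite -/D in SD.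
  have agree := TS (dilate_near_closure oO cO O0 rI fB.1) zO.
  have -> : T f z - S f z = S D z - T D z.
    by rewrite TD SD agree; ring.
  apply: le_trans (rnormDB _ _) _; rewrite /B mulrDl addrC; apply: lerD; last first.
    exact: (sampled_sup n1 SP p1 DB (ltW h0) Dh).
  have TDh : (Lp_norm Omega q (T D) <= (`|M| * h)%:E)%E.
    apply: le_trans (TM D DB) _; rewrite EFinM.
    apply: (@le_trans _ _ (`|M|%:E * Lp_norm Omega p D)%E).
      by apply: lee_wpmul2r; [exact: poweR_ge0|rewrite lee_fin ler_norm].
    by apply: lee_wpmul2l; rewrite // lee_fin.
  have Mh : 0 <= `|M| * h by rewrite mulr_ge0 // ltW.
  have zz : rnorm (z - z) < d / 2 by rewrite subrr rnorm0 divr_gt0.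
  have [TDz _] := EP q (T D) (`|M| * h) q1 (TB D DB) Mh TDh z erefl z zz.
  by rewrite -mulrA.
apply/eqP; rewrite -subr_eq0; apply/eqP/rnorm_eq0/le_anti; rewrite rnorm_ge0 andbT.
apply/ler_addgt0Pr => e e0; rewrite add0r.
have B1 : 0 < B + 1 by rewrite ltr_wpDl.
apply: le_trans (key (e / (B + 1)) _) _; first by rewrite divr_gt0.
by rewrite mulrCA ger_pMr // ler_pdivrMr // mul1r lerDl.
Qed.

End uniqueness.

Section inner_product.
Context (R : realType) (n : nat).
Local Notation V := 'rV[R[i]]_n.
Local Notation RR := (measurableTypeR R * measurableTypeR R)%type.
Local Notation vol := (volume R n).
Variable (Omega : set V).
Hypotheses (oO : open Omega).
Implicit Types (f h k : V -> R[i]).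

Local Notation W := (@to_cvec R n @^-1` Omega).
Local Notation A2 := (bergman Omega 2).

Lemma two_gt0 : 0 < 2 :> R. Proof. by []. Qed.

Lemma bergman2_integrable f : A2 f ->
  vol.-integrable W (EFin \o (fun x => rnorm (f (to_cvec x)) ^+ 2)).
Proof.
move=> fB; have [fO fi] := (bergmanP Omega f two_gt0).1 fB.
have sq x : rnorm (f (to_cvec x)) `^ 2 = rnorm (f (to_cvec x)) ^+ 2.
  by rewrite -powR_mulrn // rnorm_ge0.
apply/integrableP; split.
  have := measurable_pow_rnorm 2 oO fO; congr (measurable_fun _ _).
  by apply/funext => x /=; rewrite sq.
apply: le_lt_trans fi; rewrite le_eqVlt; apply/orP; left; apply/eqP.
by apply: eq_integral => x _; rewrite /= sq ger0_norm // exprn_ge0 // rnorm_ge0.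
Qed.

Lemma inner_cintegrable f h : A2 f -> A2 h ->
  cintegrable vol W (fun x => f (to_cvec x) * (h (to_cvec x))^*%R).
Proof.
move=> fB hB; have mO := measurable_open oO.
have [_ f1 f2] := measurable_holomorphic oO fB.1.
have [_ h1 h2] := measurable_holomorphic oO hB.1.
have dom : vol.-integrable W (EFin \o (fun x => rnorm (f (to_cvec x)) ^+ 2 +
    rnorm (h (to_cvec x)) ^+ 2)).
  exact: (integrableD mO (bergman2_integrable fB) (bergman2_integrable hB)).
have bound (p : R[i] -> R) x : (forall z, `|p z| <= rnorm z) ->
    (`|(p (f (to_cvec x) * (h (to_cvec x))^*%R))%:E| <=
     `|(rnorm (f (to_cvec x)) ^+ 2 + rnorm (h (to_cvec x)) ^+ 2)%:E|)%E.
  move=> pz; rewrite /= lee_fin; apply: le_trans (pz _) _; apply: le_trans (ler_norm _).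
  rewrite rnormM rnormJ; move: (rnorm_ge0 (f (to_cvec x))) (rnorm_ge0 (h (to_cvec x))).
  by set a := rnorm _; set b := rnorm _ => a0 b0; nra.
have ReE (a b : R[i]) : complex.Re (a * b^*%R) =
    complex.Re a * complex.Re b + complex.Im a * complex.Im b.
  by case: a b => [? ?] [? ?] /=; rewrite mulrN opprK.
have ImE (a b : R[i]) : complex.Im (a * b^*%R) =
    complex.Im a * complex.Re b - complex.Re a * complex.Im b.
  by case: a b => [? ?] [? ?] /=; rewrite mulrN addrC.
split; apply: (le_integrable mO _ _ dom).
- apply/measurable_EFinP; under eq_fun do rewrite ReE.
  by apply: measurable_funD; apply: measurable_funM.
- by move=> x _; apply: bound; exact: Re_le_rnorm.
- apply/measurable_EFinP; under eq_fun do rewrite ImE.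
  by apply: measurable_funB; apply: measurable_funM.
- by move=> x _; apply: bound; exact: Im_le_rnorm.
Qed.

Lemma eq_inner f f' h h' : (forall z, Omega z -> f z = f' z) ->
  (forall z, Omega z -> h z = h' z) -> inner Omega f h = inner Omega f' h'.
Proof. by move=> ff hh; apply: eq_cRintegral => x xO; rewrite ff // hh. Qed.

Lemma inner_linl f k h (a : R[i]) : A2 f -> A2 k -> A2 h ->
  inner Omega (fun z => a * f z + k z) h = a * inner Omega f h + inner Omega k h.
Proof.
move=> fB kB hB; have mO := measurable_open oO.
have := cRintegral_lin mO a (inner_cintegrable fB hB) (inner_cintegrable kB hB).
move/(etrans _); apply; apply: eq_cRintegral => x _.
by rewrite mulrDl mulrA.
Qed.

Lemma inner_linr f k h (a : R[i]) : A2 f -> A2 k -> A2 h ->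
  inner Omega h (fun z => a * f z + k z) = a^*%R * inner Omega h f + inner Omega h k.
Proof.
move=> fB kB hB; have mO := measurable_open oO.
have := cRintegral_lin mO (a^*%R) (inner_cintegrable hB fB) (inner_cintegrable hB kB).
move/(etrans _); apply; apply: eq_cRintegral => x _.
by rewrite rmorphD rmorphM /= mulrDr mulrCA.
Qed.

Lemma Lp_int_inner f : A2 f -> Lp_int Omega 2 f = (complex.Re (inner Omega f f))%:E.
Proof.
move=> fB; rewrite /inner /cRintegral /= /Rintegral.
have sq x : complex.Re (f (to_cvec x) * (f (to_cvec x))^*%R) = rnorm (f (to_cvec x)) `^ 2.
  rewrite powR_mulrn ?rnorm_ge0 // rnormC sqr_sqrtr ?addr_ge0 ?sqr_ge0 //.
  by case: (f _) => u v /=; rewrite mulrN opprK !expr2.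
under [in RHS]eq_integral do rewrite sq.
rewrite fineK // ge0_fin_numE ?Lp_int_ge0 //.
exact: ((bergmanP Omega f two_gt0).1 fB).2.
Qed.

Section combinations.
Context (I : Type) (c : I -> R[i]) (e : I -> V -> R[i]).
Hypothesis eB : forall i, A2 (e i).

Definition combination (s : seq I) (z : V) := \sum_(i <- s) c i * e i z.

Lemma combination_cons i s : combination (i :: s) = fun z => c i * e i z + combination s z.
Proof. by apply/funext => z; rewrite /combination big_cons. Qed.

Lemma combination_nil : combination [::] = fun=> 0.
Proof. by apply/funext => z; rewrite /combination big_nil. Qed.

Lemma bergman0 : A2 (fun=> 0).
Proof.
apply: (bergmanP _ _ two_gt0).2; split; first by move=> z _; exact: differentiable_cst.
rewrite /Lp_int (eq_integral (fun=> 0%E)) ?integral0 // => x _.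
by rewrite rnorm0 powR0.
Qed.

Lemma bergman_combination s : A2 (combination s).
Proof.
elim: s => [|i s ih]; first by rewrite combination_nil; exact: bergman0.
by rewrite combination_cons; exact: (bergman_lin (c i) oO two_gt0 (eB i) ih).
Qed.

Lemma inner0l h : inner Omega (fun=> 0) h = 0.
Proof.
rewrite /inner (@eq_cRintegral _ _ _ _ _ _ (fun=> 0)); last by move=> x _; rewrite mul0r.
by rewrite /cRintegral /Rintegral /= !integral0.
Qed.

Lemma inner0r h : inner Omega h (fun=> 0) = 0.
Proof.
rewrite /inner (@eq_cRintegral _ _ _ _ _ _ (fun=> 0)); last first.
  by move=> x _; rewrite rmorph0 mulr0.
by rewrite /cRintegral /Rintegral /= !integral0.
Qed.

Lemma inner_combinationl s h : A2 h ->
  inner Omega (combination s) h = \sum_(i <- s) c i * inner Omega (e i) h.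
Proof.
move=> hB; elim: s => [|i s ih]; first by rewrite combination_nil inner0l big_nil.
by rewrite combination_cons (inner_linl (c i) (eB i) (bergman_combination s) hB) ih big_cons.
Qed.

Lemma inner_combinationr s h : A2 h ->
  inner Omega h (combination s) = \sum_(i <- s) (c i)^*%R * inner Omega h (e i).
Proof.
move=> hB; elim: s => [|i s ih]; first by rewrite combination_nil inner0r big_nil.
by rewrite combination_cons (inner_linr (c i) (eB i) (bergman_combination s) hB) ih big_cons.
Qed.

Lemma operator_combination T s z : linear_operator Omega 2 T -> Omega z ->
  T (combination s) z = \sum_(i <- s) c i * T (e i) z.
Proof.
move=> Tlin zO; elim: s => [|i s ih].
  rewrite combination_nil big_nil; have := Tlin 1 _ _ bergman0 bergman0 z zO.
  rewrite (_ : (fun _ => _) = (fun=> 0)); last by apply/funext => w; rewrite mulr0 addr0.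
  by rewrite mul1r => /eqP; rewrite -subr_eq subrr eq_sym => /eqP.
by rewrite combination_cons (Tlin (c i) (e i) _ (eB i) (bergman_combination s) z zO) ih big_cons.
Qed.

End combinations.

End inner_product.

Section singular_values.
Context (R : realType) (n : nat).
Local Notation V := 'rV[R[i]]_n.
Local Notation vol := (volume R n).
Variables (Omega : set V) (S T : (V -> R[i]) -> (V -> R[i])) (A : R) (L : nat)
  (P : forall N, 'I_L -> {ffun 'I_n -> 'I_N} -> V).
Hypotheses (n1 : (1 <= n)%N) (oO : open Omega)
  (volO : (vol (@to_cvec R n @^-1` Omega) < +oo)%E) (A0 : 0 <= A)
  (SP : sampled_operator Omega S A P) (Tb : bounded_operator Omega 2 2 T)
  (TS : forall f, bergman Omega 2 f -> forall z, Omega z -> T f z = S f z).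

(** A homogeneous linear system with more unknowns than equations. *)
Lemma nonzero_solution (F : fieldType) (j : nat) (X : finType) (Q : 'I_j -> X -> F) :
  (#|X| < j)%N -> exists c : 'I_j -> F,
    (exists i, c i != 0) /\ forall x, \sum_i c i * Q i x = 0.
Proof.
move=> Xj; pose M : 'M[F]_(j, #|X|) := \matrix_(i, x) Q i (enum_val x).
have /rowV0Pn[v /sub_kermxP vM v0] : kermx M != 0.
  by rewrite -mxrank_eq0 mxrank_ker -lt0n subn_gt0 (leq_ltn_trans (rank_leq_col M)).
exists (fun i => v ord0 i); split.
  by have /rV0Pn[k vk] := v0; exists k.
move=> x; have /matrixP/(_ ord0 (enum_rank x)) := vM; rewrite !mxE.
by move=> vMx; apply: etrans vMx; apply: eq_bigr => i _; rewrite !mxE enum_rankK.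
Qed.

Lemma eigenvalue_bound j N (e : 'I_j -> V -> R[i]) (tau : 'I_j -> R) (sigma : R) :
  (L * N ^ n < j)%N -> Defs.orthonormal Omega e -> 0 <= sigma -> (forall i, sigma <= tau i) ->
  (forall i, abs_eigenvector Omega T (tau i) (e i)) ->
  sigma <= A * (fine (vol (@to_cvec R n @^-1` Omega)) + 1) * 2^-1 ^+ N.
Proof.
move=> Nj eo sigma0 st eT; set v := fine _.
have v0 : 0 <= v by apply: fine_ge0; exact: measure_ge0.
have eB i : bergman Omega 2 (e i) by case: (eT i) => _ [].
have [TB Tlin _] := Tb.
have [|c [[i0 ci0] cQ]] := @nonzero_solution _ j ('I_L * {ffun 'I_n -> 'I_N})%type
    (fun i x => e i (P x.1 x.2)).
  by rewrite card_prod card_ffun !card_ord.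
pose f := combination c e (index_enum 'I_j).
have fB : bergman Omega 2 f by exact: (bergman_combination oO c eB).
have ef i : inner Omega (e i) f = (c i)^*%R.
  rewrite (inner_combinationr oO c eB _ (eB i)) (bigD1 i) //= big1 => [|k ki].
    by rewrite eo eqxx mulr1 addr0.
  by rewrite eo eq_sym (negbTE ki) mulr0.
have ccE (z : R[i]) : z * z^*%R = (rnorm z ^+ 2)%:C by rewrite -normCK rnormE rmorphXn.
pose s : R := \sum_i rnorm (c i) ^+ 2.
have s0 : 0 < s.
  rewrite /s (bigD1 i0) //= ltr_pwDl ?exprn_gt0 ?rnorm_gt0 //.
  by apply: sumr_ge0 => i _; rewrite exprn_ge0 // rnorm_ge0.
have ff : inner Omega f f = s%:C.
  rewrite (inner_combinationl oO c eB _ fB) /s rmorph_sum /=; apply: eq_bigr => i _.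
  by rewrite ef ccE.
have TfB : bergman Omega 2 (T f) := TB f fB.
have TfE : inner Omega (T f) (T f) = (\sum_i rnorm (c i) ^+ 2 * tau i ^+ 2)%:C.
  have -> : inner Omega (T f) (T f) =
      inner Omega (combination c (fun i => T (e i)) (index_enum 'I_j)) (T f).
    by apply: eq_inner => // z zO; exact: (operator_combination oO c eB _ Tlin zO).
  rewrite (inner_combinationl oO c (fun i => TB _ (eB i)) _ TfB).
  rewrite rmorph_sum /=; apply: eq_bigr => i _.
  have [_ [_ ->]] := eT i; last exact: fB.
  by rewrite ef mulrCA ccE -rmorphM /= mulrC.
have lower : sigma ^+ 2 * s <= complex.Re (inner Omega (T f) (T f)).
  rewrite TfE /= /s mulr_sumr; apply: ler_sum => i _.
  rewrite mulrC ler_wpM2l ?exprn_ge0 ?rnorm_ge0 // lerXn2r ?nnegrE //.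
  exact: le_trans (st i).
have fN : (Lp_norm Omega 2 f <= (Num.sqrt s)%:E)%E.
  apply: (Lp_norm_le (two_gt0 R) (sqrtr_ge0 s)).
  by rewrite Lp_int_inner // ff /= powR_mulrn ?sqrtr_ge0 // sqr_sqrtr // ltW.
have fP i h : rnorm (f (P (N := N) i h)) <= 0.
  by have := cQ (i, h); rewrite /= -[X in X = 0]/(f (P i h)) => ->; rewrite rnorm0.
have one2 : 1 <= 2 :> R by rewrite ler1n.
have Sf z : Omega z -> rnorm (T f z) <= A * (2^-1 ^+ N * Num.sqrt s).
  move=> zO; rewrite TS //.
  have [_ _ /(_ N 0 (lexx _) fP z zO)] := SP.1 2 f (Num.sqrt s) one2 fB (sqrtr_ge0 _) fN.
  by rewrite mulr0 addr0.
have t0 : 0 <= 2^-1 ^+ N :> R by rewrite exprn_ge0 // invr_ge0.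
have B0 : 0 <= A * (2^-1 ^+ N * Num.sqrt s) by rewrite !mulr_ge0 // sqrtr_ge0.
have upper : complex.Re (inner Omega (T f) (T f)) <= (A * (2^-1 ^+ N * Num.sqrt s)) ^+ 2 * v.
  rewrite -lee_fin -Lp_int_inner //.
  apply: le_trans (Lp_int_sup oO (two_gt0 R) B0 TfB.1 Sf) _.
  rewrite powR_mulrn // [X in (_ <= X)%E]EFinM /v fineK // ge0_fin_numE //; exact: measure_ge0.
have := le_trans lower upper.
rewrite !exprMn sqr_sqrtr ?(ltW s0) //.
have -> : A ^+ 2 * (2^-1 ^+ N ^+ 2 * s) * v = A ^+ 2 * 2^-1 ^+ N ^+ 2 * v * s by ring.
rewrite ler_pM2r // => h.
rewrite -(ler_pXn2r (n := 2)) ?nnegrE ?mulr_ge0 ?addr_ge0 //.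
have -> : (A * (v + 1) * 2^-1 ^+ N) ^+ 2 = A ^+ 2 * 2^-1 ^+ N ^+ 2 * (v + 1) ^+ 2 by ring.
apply: le_trans h _; rewrite ler_wpM2l ?mulr_ge0 ?sqr_ge0 //.
by rewrite sqrrD1; have := sqr_ge0 v; lra.
Qed.

Lemma level_choice j : (1 <= j)%N -> exists N, (L * N ^ n < j)%N /\ (j <= (L.+1 * N.+1) ^ n)%N.
Proof.
move=> j1; have ex : exists N, (L.+1 * N ^ n < j)%N by exists 0%N; rewrite exp0n // muln0.
have bd N : (L.+1 * N ^ n < j)%N -> (N <= j)%N.
  move=> /ltnW; apply: leq_trans; apply: (@leq_trans (N ^ n)); last exact: leq_pmull.
  by case: N => // N; rewrite -{1}(expn1 N.+1) leq_pexp2l.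
case: (ex_maxnP ex bd) => N NP Nmax; exists N; split.
  by apply: leq_ltn_trans NP; rewrite leq_mul2r leqnSn orbT.
have : (j <= L.+1 * N.+1 ^ n)%N.
  by rewrite leqNgt; apply/negP => /Nmax; rewrite ltnn.
move/leq_trans; apply; rewrite expnMn leq_mul2r; apply/orP; right.
by rewrite -{1}(expn1 L.+1) leq_pexp2l.
Qed.

Lemma singular_value_decay : exists C c : R, [/\ 0 < C, 0 < c & forall j, (1 <= j)%N ->
  0 <= singular_value Omega T j <= C * expR (- c * j%:R `^ n%:R^-1)].
Proof.
set v := fine (vol (@to_cvec R n @^-1` Omega)).
have v0 : 0 <= v by apply: fine_ge0; exact: measure_ge0.
have B0 : 0 <= A * (v + 1) by rewrite mulr_ge0 // addr_ge0.
have ln2 : 0 < ln 2 :> R by rewrite ln_gt0 // ltr1n.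
exists (2 * (A * (v + 1)) + 1), (ln 2 / L.+1%:R); split.
- by rewrite ltr_wpDl // mulr_ge0.
- by rewrite divr_gt0.
move=> j j1; have [N [Nj jN]] := level_choice j1.
set E := expR _; have E0 : 0 <= E by exact: expR_ge0.
have step : 2^-1 ^+ N <= 2 * E.
  have root : j%:R `^ n%:R^-1 <= (L.+1 * N.+1)%:R :> R.
    have -> : (L.+1 * N.+1)%:R = (((L.+1 * N.+1) ^ n)%:R : R) `^ n%:R^-1.
      rewrite natrX -powR_mulrn // -powRrM mulfV ?powRr1 //.
      by rewrite pnatr_eq0 -lt0n.
    by apply: ge0_ler_powR; rewrite ?nnegrE ?invr_ge0 ?ler_nat.
  have : expR (- (N.+1%:R * ln 2)) <= E.
    rewrite ler_expR mulNr lerN2.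
    apply: le_trans (ler_wpM2l (ltW (divr_gt0 ln2 (ltr0Sn R L))) root) _.
    by rewrite natrM mulrA divfK ?pnatr_eq0 // mulrC.
  rewrite expRN expRM_natl lnK ?posrE // exprS invfM exprVn => h.
  by have := ler_wpM2l (ler0n R 2) h; rewrite mulrA mulfV // mul1r.
pose X := [set sigma | 0 <= sigma /\ exists e : 'I_j -> V -> R[i],
         Defs.orthonormal Omega e /\
         forall i, exists2 tau, sigma <= tau & abs_eigenvector Omega T tau (e i)].
have Xub sigma : X sigma -> sigma <= (2 * (A * (v + 1)) + 1) * E.
  move=> [sigma0 [e [eo eT]]].
  have [tau tauP] := choice (fun i => let: ex_intro2 t a b := eT i in ex_intro _ t (conj a b)).
  apply: (@le_trans _ _ (A * (v + 1) * 2^-1 ^+ N)).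
    apply: (eigenvalue_bound Nj eo sigma0) => i; [exact: (tauP i).1|exact: (tauP i).2].
  apply: (@le_trans _ _ (A * (v + 1) * (2 * E))); first by rewrite ler_wpM2l.
  by set a := A * (v + 1); rewrite (_ : (2 * a + 1) * E = a * (2 * E) + E) ?lerDl //; ring.
have bE0 : 0 <= (2 * (A * (v + 1)) + 1) * E.
  by apply: mulr_ge0 E0; rewrite addr_ge0 // mulr_ge0.
rewrite /singular_value -/X; have [->|/set0P[x Xx]] := eqVneq X set0; first by rewrite sup0 lexx.
apply/andP; split; last by apply: ge_sup; [exists x|exact: Xub].
apply: (le_trans Xx.1); apply: ub_le_sup => //; exists ((2 * (A * (v + 1)) + 1) * E).
exact: Xub.
Qed.

End singular_values.

Section summability.
Variable R : realType.

Lemma expR_ge_power (y : R) m : 0 <= y -> (0 < m)%N -> (y / m%:R) ^+ m <= expR y.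
Proof.
move=> y0 m0; have m1 : 0 < m%:R :> R by rewrite ltr0n.
have {2}-> : y = m%:R * (y / m%:R) by rewrite mulrCA mulfV ?mulr1 // gt_eqF.
rewrite expRM_natl lerXn2r ?nnegrE ?divr_ge0 ?expR_ge0 // ?(ltW m1) //.
by apply: le_trans (expR_ge1Dx _); rewrite lerDr.
Qed.

Lemma inverse_square_step (D : R) j : 0 <= D -> (0 < j)%N ->
  D / j%:R ^+ 2 <= 2 * D * (j%:R^-1 - j.+1%:R^-1).
Proof.
move=> D0 j0; have j1 : 1 <= j%:R :> R by rewrite ler1n.
rewrite -(natr1 j); set x := j%:R in j1 *.
have x0 : 0 < x by lra.
have -> : 2 * D * (x^-1 - (x + 1)^-1) = D * (2 / (x * (x + 1))).
  by field; rewrite !gt_eqF //; lra.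
rewrite ler_wpM2l // ler_pdivlMr ?mulr_gt0 //; last by lra.
rewrite mulrC ler_pdivrMr ?exprn_gt0 //; nra.
Qed.

Lemma exp_root_summable n (C c s : R) (x : nat -> R) : (0 < n)%N -> 0 < C -> 0 < c -> 0 < s ->
  (forall j, (1 <= j)%N -> 0 <= x j <= C * expR (- c * j%:R `^ n%:R^-1)) ->
  (\sum_(1 <= j <oo) (x j `^ s)%:E < +oo)%E.
Proof.
move=> n0 C0 c0 s0 xC; have cs0 : 0 < c * s by rewrite mulr_gt0.
have m0 : 0 < (2 * n)%:R :> R by rewrite ltr0n muln_gt0.
pose D := C `^ s * ((2 * n)%:R / (c * s)) ^+ (2 * n).
have D0 : 0 <= D by rewrite mulr_ge0 ?powR_ge0 // exprn_ge0 // divr_ge0 ?ltW.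
have term j : (1 <= j)%N -> x j `^ s <= D / j%:R ^+ 2.
  move=> j1; have /andP[xj0 xjC] := xC j j1.
  pose r : R := j%:R `^ n%:R^-1.
  have r0 : 0 < r by rewrite powR_gt0 // ltr0n.
  have rn : r ^+ (2 * n) = j%:R ^+ 2.
    rewrite mulnC exprM -(powR_mulrn n (ltW r0)) -powRrM mulVf ?powRr1 //.
    by rewrite pnatr_eq0 -lt0n.
  have e0 : 0 <= C * expR (- c * r) by rewrite mulr_ge0 ?expR_ge0 // ltW.
  have h1 : x j `^ s <= C `^ s * expR (- (c * s * r)).
    apply: le_trans (_ : (C * expR (- c * r)) `^ s <= _).
      by apply: ge0_ler_powR; rewrite ?nnegrE // ltW.
    rewrite powRM ?expR_ge0 ?(ltW C0) // -expRM (_ : - c * r * s = - (c * s * r)) //.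
    by ring.
  apply: le_trans h1 _; rewrite /D -[X in _ <= X]mulrA ler_wpM2l ?powR_ge0 // expRN.
  have y0 : 0 < c * s * r by rewrite mulr_gt0.
  have h2 := expR_ge_power (ltW y0) (_ : 0 < 2 * n)%N.
  have -> : ((2 * n)%:R / (c * s)) ^+ (2 * n) / j%:R ^+ 2 = ((c * s * r / (2 * n)%:R) ^+ (2 * n))^-1.
    rewrite -rn -exprVn -exprMn -exprVn; congr (_ ^+ _).
    by move: m0; move: (2 * n)%:R => a a0; field; rewrite !gt_eqF.
  by rewrite lef_pV2 ?posrE ?expR_gt0 ?exprn_gt0 ?divr_gt0 // h2 // muln_gt0.
have partial k : \sum_(1 <= j < k.+1) x j `^ s <= 2 * D * (1 - k.+1%:R^-1).
  elim: k => [|k ih]; first by rewrite big_geq // invr1 subrr mulr0.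
  rewrite big_nat_recr //=; apply: le_trans (lerD ih (term k.+1 isT)) _.
  apply: le_trans (lerD (lexx _) (inverse_square_step D0 (ltn0Sn k))) _.
  by rewrite -mulrDr addrA subrK.
have nn k : (1 <= k)%N -> true -> (0 <= (x k `^ s)%:E)%E by rewrite lee_fin powR_ge0.
apply: (@le_lt_trans _ _ (2 * D)%:E); last exact: ltry.
apply: lime_le; first exact: is_cvg_nneseries.
apply: nearW => -[|k]; first by rewrite big_geq // lee_fin mulr_ge0.
rewrite sumEFin lee_fin; apply: le_trans (partial k) _.
by apply: ler_piMr; [exact: mulr_ge0|rewrite lerBlDr lerDl invr_ge0].
Qed.

End summability.

Local Close Scope complex_scope.

Theorem proposition4p8 (R : realType) (n : nat) (n_ge1 : (1 <= n)%N)
  (Omega : set 'rV[R[i]]_n)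
  (Omega_open : open Omega) (Omega_bounded : bounded_set Omega)
  (Omega_convex : convex_subset Omega)
  (Omega0 : Omega 0)
  (Omega_smooth : smooth_boundary Omega) (Omega_finite_type : finite_type Omega)
  (alpha : R) (alpha_ge0 : 0 <= alpha)
  (g : 'rV[R[i]]_n -> R[i]) (g_Hinfty : Hinfty Omega g)
  (phi : 'rV[R[i]]_n -> 'rV[R[i]]_n) (phi_holo : holomorphic_on Omega phi)
  (phi_Omega : forall z, Omega z -> Omega (phi z)) (phi0 : phi 0 = 0)
  (phi_compact : exists K : set 'rV[R[i]]_n,
     [/\ compact K, K `<=` Omega & phi @` Omega `<=` K]) :
  (forall p q : R, 1 < p -> 1 < q ->
     (exists T, bounded_extension Omega p q alpha g phi T) /\
     (forall T, bounded_extension Omega p q alpha g phi T ->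
        compact_operator Omega p q T)) /\
  (forall T, bounded_extension Omega 2 2 alpha g phi T ->
     (forall s : R, 0 < s -> schatten Omega s T) /\
     (exists C c : R, [/\ 0 < C, 0 < c &
        forall j : nat, (1 <= j)%N ->
          singular_value Omega T j <= C * expR (- c * j%:R `^ (n%:R^-1))])).
Proof.
have [D OD] : exists D : R, forall z, Omega z -> rnorm z < D.
  have [M [_ MP]] := Omega_bounded; exists (complex.Re (M + 1) + 1)%R => z zO.
  have := MP (M + 1) _ z zO; rewrite ltrDl ltr01 => /(_ isT) /=.
  rewrite lecE => /andP[_]; rewrite -/(rnorm z) => /le_lt_trans; apply.
  by rewrite ltrDl.
have [G gG] : exists G : R, forall z, Omega z -> rnorm (g z) <= G.
  have [M MP] := g_Hinfty.2; exists (complex.Re M) => z zO.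
  by have := MP z zO; rewrite lecE => /andP[].
have [K [cK KO phiK]] := phi_compact.
have phiK' z : Omega z -> K (phi z) by move=> zO; apply: phiK; exists z.
have [A [L [P [A0 SP]]]] := sampling n_ge1 Omega_open Omega_convex Omega0 OD cK KO
  g_Hinfty.1 gG phi_holo phiK' phi0 alpha_ge0.
have volO := volume_bounded Omega_open OD.
have unique p q T : 1 <= p -> 1 <= q -> bounded_extension Omega p q alpha g phi T ->
    forall f, bergman Omega p f -> forall z, Omega z -> T f z = C_op alpha g phi f z.
  move=> p1 q1 [Tb TC] f fB z zO.
  exact: (extension_unique n_ge1 Omega_open Omega_convex Omega0 volO A0 SP p1 q1 Tb TC fB zO).
have cpt p q T : 1 <= p -> 1 <= q -> bounded_extension Omega p q alpha g phi T ->
    compact_operator Omega p q T.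
  move=> p1 q1 TE; apply: (sampled_compact n_ge1 Omega_open volO A0 SP p1 _ TE.1 (unique p q T p1 q1 TE)).
  exact: lt_le_trans q1.
split.
  move=> p q /ltW p1 /ltW q1; split; last by move=> T; exact: cpt.
  exists (C_op alpha g phi); split=> //.
  apply: (sampled_bounded n_ge1 Omega_open volO A0 SP p1).
  exact: lt_le_trans q1.
have two1 : 1 <= 2 :> R by rewrite ler1n.
move=> T TE; have [C [c [C0 c0 Tj]]] :=
  singular_value_decay n_ge1 Omega_open volO A0 SP TE.1 (unique 2 2 T two1 two1 TE).
split; last by exists C, c; split=> // j /Tj/andP[].
move=> s s0; split; first exact: cpt.
exact: (exp_root_summable n_ge1 C0 c0 s0 Tj).
Qed.
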